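(* (i) For every $\mathbf{y}\in V$, $\lim_{c\to0+}F(\mathbf{t},\mathbf{y}+c\phi;\Lambda)=F(\mathbf{t},\mathbf{y};\Lambda)$. (ii) $F(\mathbf{t},\mathbf{y};\Lambda)$ is continuous in $\mathbf{y}$ on $V\setminus\bigcup_{f\in\widetilde\Lambda}(\mathfrak{H}_{\Lambda\setminus\{f\}}+\mathbb{Z}^r)$. In particular, if $\widetilde\Lambda$ is empty, then $F(\mathbf{t},\mathbf{y};\Lambda)$ is continuous on the whole of $V$ and is independent of the choice of $\phi$. (iii) $F(\mathbf{t},\mathbf{y};\Lambda)$ is holomorphic in $\mathbf{t}$ in a neighborhood of the origin of $\mathbb{C}^{\sharp\Lambda}$.
   Context: Fix an integer $r\ge1$ and let $V=\mathbb{R}^r$ with the standard inner product $\langle\cdot,\cdot\rangle$. An element $f=(\vec f,b_f)\in V\times\mathbb{C}$ is regarded as the affine functional $f(\mathbf{v})=\langle\vec f,\mathbf{v}\rangle+b_f$. Let $\Lambda\subset(\mathbb{Z}^r\setminus\{0\})\times\mathbb{C}$ be a finite set such that the $\mathbb{Z}$-module generated by $\vec\Lambda=\{\vec f:f\in\Lambda\}$ has rank $r$. Let $\widetilde\Lambda=\{f\in\Lambda:$ the $\mathbb{Z}$-module generated by $\vec\Lambda\setminus\{\vec f\}$ has rank $\neq r\}$. For $H\subset\Lambda$ whose vectors generate a module of rank $r-1$, $\mathfrak{H}_H=\sum_{g\in H}\mathbb{R}\vec g$. Let $\mathscr{B}$ be the set of subsets $B\subset\Lambda$ with $r$ elements such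 that $\vec B=\{\vec f:f\in B\}$ is a basis of $V$; for $B\in\mathscr{B}$ and $f\in B$, $\vec f^B$ denotes the dual basis vector, i.e. $\langle\vec g,\vec f^B\rangle=\delta_{gf}$ for $g,f\in B$. Let $\mathscr{R}$ be the set of subsets $R\subset\Lambda$ with $r-1$ elements whose vectors are linearly independent. Fix $\phi\in V\setminus\bigcup_{R\in\mathscr{R}}\mathfrak{H}_R$. For $\mathbf{y}\in V$, $B\in\mathscr{B}$, $f\in B$ put $\{\mathbf{y}\}_{B,f}=\{\langle\mathbf{y},\vec f^B\rangle\}$ if $\langle\phi,\vec f^B\rangle>0$ and $\{\mathbf{y}\}_{B,f}=1-\{-\langle\mathbf{y},\vec f^B\rangle\}$ if $\langle\phi,\vec f^B\rangle<0$, where $\{a\}=a-\lfloor a\rfloor$. For $\mathbf{y}\in V$ and $\mathbf{t}=(t_f)_{f\in\Lambda}\in\mathbb{C}^{\sharp\Lambda}$ define $$F(\mathbf{t},\mathbf{y};\Lambda)=\sum_{B\in\mathscr{B}}\Bigl(\prod_{g\in\Lambda\setminus B}\frac{t_g}{t_g-2\pi\sqrt{-1}b_g-\sum_{f\in B}(t_f-2\pi\sqrt{-1}b_f)\langle\vec g,\vec f^B\rangle}\Bigr)\frac{1}{\sharp(\mathbb{Z}^r/\langle\vec B\rangle)}\sum_{\mathbf{w}\in\mathbb{Z}^r/\langle\vec B\rangle}\prod_{f\in B}\frac{t_f\exp((t_f-2\pi\sqrt{-1}b_f)\{\mathbf{y}+\mathbf{w}\}_{B,f})}{\exp(t_f-2\pi\sqrt{-1}b_f)-1},$$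 where $\langle\vec B\rangle=\sum_{f\in B}\mathbb{Z}\vec f$. *)

(* Defs.v *)
From HB Require Import structures.
From mathcomp Require Import all_boot all_order all_algebra.
From mathcomp Require Import finmap complex.
From mathcomp Require Import all_classical all_reals all_analysis.

Set Implicit Arguments.
Unset Strict Implicit.
Unset Printing Implicit Defensive.

Import Order.TTheory GRing.Theory Num.Theory.
Import numFieldNormedType.Exports.

Local Open Scope classical_set_scope.
Local Open Scope complex_scope.
Local Open Scope ring_scope.

Definition cexp (R : realType) (z : R[i]) : R[i] :=
  let: x +i* y := z in (expR x * cos y) +i* (expR x * sin y).

Definition frac (R : realType) (a : R) : R := a - (Num.floor a)%:~R.

Definition dot (R : realType) (r : nat) (u v : 'rV[R]_r) : R :=
  \sum_(i < r) u 0 i * v 0 i.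

(* The rank of a subgroup M of Z^r is dim_Q (Q (x) M), i.e. the dimension of
   the rational span of any generating family. *)
Definition rankZ (r : nat) (X : seq 'rV[int]_r) : nat :=
  \dim <<[seq (map_mx intr u : 'rV[rat]_r) | u <- X]>>%VS.

(* A finite set Lambda of n affine functionals is given by an injective
   enumeration Lam by 'I_n, so that subsets of Lambda are sets {set 'I_n} and
   C^(#Lambda) is 'rV[R[i]^o]_n. *)
Section GeneratingFunction.
Context {R : realType} {r n : nat} (Lam : 'I_n -> 'rV[int]_r * R[i]).

Definition vec (f : 'I_n) : 'rV[int]_r := (Lam f).1.
Definition bcst (f : 'I_n) : R[i] := (Lam f).2.

Definition realv (u : 'rV[int]_r) : 'rV[R]_r := map_mx intr u.

Definition Ltilde : {set 'I_n} :=
  [set f | rankZ [seq u <- codom vec | u != vec f] != r].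

Definition hspan (H : {set 'I_n}) : {vspace 'rV[R]_r} :=
  <<[seq realv (vec g) | g in H]>>%VS.

Definition is_base (B : {set 'I_n}) : bool :=
  (#|B| == r) && basis_of fullv [seq realv (vec f) | f in B].

Definition is_indep (A : {set 'I_n}) : bool :=
  (#|A| == r.-1) && free [seq realv (vec f) | f in A].

Definition generic (phi : 'rV[R]_r) : Prop :=
  forall A : {set 'I_n}, is_indep A -> phi \notin hspan A.

Definition dualv (B : {set 'I_n}) (f : 'I_n) : 'rV[R]_r :=
  xget 0 [set u | forall g, g \in B -> dot (realv (vec g)) u = (g == f)%:R].

Definition lattice (B : {set 'I_n}) : set 'rV[int]_r :=
  [set u | exists m : 'I_n -> int, u = \sum_(f in B) m f *: vec f].

(* Z^r / <B>, as the set of its cosets; it is finite when B is a base. *)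
Definition cosets (B : {set 'I_n}) : set (set 'rV[int]_r) :=
  [set [set w + u | u in lattice B] | w in [set: 'rV[int]_r]].

Definition bfrac (phi y : 'rV[R]_r) (B : {set 'I_n}) (f : 'I_n) : R :=
  if 0 < dot phi (dualv B f) then frac (dot y (dualv B f))
  else 1 - frac (- dot y (dualv B f)).

(* t_f - 2 pi i b_f *)
Definition tshift (t : 'rV[R[i]^o]_n) (f : 'I_n) : R[i] :=
  t 0 f - (2 * pi)%:C * 'i%C * bcst f.

Definition den (t : 'rV[R[i]^o]_n) (B : {set 'I_n}) (g : 'I_n) : R[i] :=
  tshift t g
  - \sum_(f in B) tshift t f * (dot (realv (vec g)) (dualv B f))%:C.

(* The sum over Z^r / <B> is evaluated at a chosen representative of each
   coset; bfrac does not depend on the choice. *)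
Definition Fformula (phi : 'rV[R]_r) (t : 'rV[R[i]^o]_n) (y : 'rV[R]_r) : R[i] :=
  \sum_(B : {set 'I_n} | is_base B)
    (\prod_(g in ~: B) (t 0 g / den t B g))
    * (#|` fset_set (cosets B)|%:R)^-1
    * \sum_(W \in cosets B)
        \prod_(f in B)
          (t 0 f
           * cexp (tshift t f * (bfrac phi (y + realv (xget 0 W)) B f)%:C)
           / (cexp (tshift t f) - 1)).

(* t is off the zero locus of every denominator of Fformula. *)
Definition offpoles (t : 'rV[R[i]^o]_n) : Prop :=
  forall B : {set 'I_n}, is_base B ->
    (forall g, g \notin B -> den t B g != 0)
    /\ (forall f, f \in B -> cexp (tshift t f) - 1 != 0).

(* Fformula is meromorphic in t, and some of its apparent poles (including
   those through the origin) cancel.  genF is the corresponding meromorphic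
   function with its removable singularities removed: the formula off the
   zeros of the denominators, and its limit there.  At a genuine pole the
   value is irrelevant. *)
Definition genF (phi : 'rV[R]_r) (t : 'rV[R[i]^o]_n) (y : 'rV[R]_r) : R[i]^o :=
  if `[< offpoles t >] then Fformula phi t y
  else lim ((Fformula phi s y : R[i]^o) @[s --> within offpoles (nbhs t)]).

(* Complex (Frechet) differentiability on a neighbourhood. *)
Definition holomorphic_at (G : 'rV[R[i]^o]_n -> R[i]^o) (t : 'rV[R[i]^o]_n) : Prop :=
  \forall s \near t, differentiable G s.

(* The points t at which genF is defined for all y. *)
Definition Fdom (phi : 'rV[R]_r) : set 'rV[R[i]^o]_n :=
  [set t | offpoles t \/ forall y, holomorphic_at (genF phi ^~ y) t].

Definition walls : set 'rV[R]_r :=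
  [set y | exists f w, f \in Ltilde /\ y - realv w \in hspan (~: [set f])].

End GeneratingFunction.

(* Main.v *)
(** Off its poles, F is (prod_g t_g) Q, where Q is a sum over the bases B of products of
    inverse denominators times the mean, over a box of Z^r, of the products over f in B of
    exp(tau_f {y + w}_{B,f}) / (exp tau_f - 1), with tau_f = t_f - 2 pi i b_f.

    Fractional parts at y + h equal those at y taken in a direction close to h, up to O(h).
    Hence (i), and continuity at y amounts to independence of phi at y.  When phi crosses
    one hyperplane orthogonal to dual vectors, the jump of Q is a common factor times
    sum_f prod_{g <> f} 1 / (p_g - p_f), over the functionals f not contained in a flat of
    rank r - 1.  Lagrange's identity makes it vanish unless there is only one such f, that
    is, unless f lies in Lambda~, and then the jump occurs on the walls of f only.

    For (iii), write Q_S for the sum over the bases contained in S.  If g is not a coloop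
    of S, then Q_S(y + s g) solves a linear differential equation in s with source
    Q_{S \ g}, and periodicity gives
      (exp tau_g - 1) Q_S(y) = int_0^1 exp(tau_g (1 - s)) Q_{S \ g}(y + s g) ds.
    By induction prod_g (exp tau_g - 1) Q extends holomorphically, with bounds uniform in y.
    Limits of Riemann sums are taken along an ultrafilter, in a class of functions with
    uniform quadratic Taylor remainders.

    At a removable singularity t, F restricted to a generic line t + z v is a quotient
    of functions with Taylor expansions in z uniform in y.  So |F(t + z v, y) - F(t, y)| <= C z
    with C independent of y, and (i) and (ii) pass to the limit z -> 0. *)
Require Import Defs.
From HB Require Import structures.
From mathcomp Require Import all_boot all_order all_algebra.
From mathcomp Require Import finmap complex ring lra.
From mathcomp Require Import all_classical all_reals all_analysis.
Import Order.TTheory GRing.Theory Num.Theory.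
Import numFieldNormedType.Exports.
Set Implicit Arguments.
Unset Strict Implicit.
Unset Printing Implicit Defensive.
Local Open Scope classical_set_scope.
Local Open Scope complex_scope.
Local Open Scope ring_scope.
Local Notation Re := complex.Re.
Local Notation Im := complex.Im.

(** * Complex modulus and exponential *)

(** The groups Z^r / <B> differ from base to base. A common box (Z / N)^r, with N Z^r inside every
    <B>, lets one translation act on all terms at once, which the comparison of jumps requires. The
    recursion needs Q to be independent of the direction all along the segment from y to y + g. It
    is therefore proved first at rational points y off all discontinuities, and carried to the other
    points by one-sided approximation. The inverse denominators have no bound near the origin. They
    enter only estimates at a fixed t off the poles; the constants that must be uniform come from
    Q_{S \ g} alone, and averaging does not enlarge them. A class defined by quadratic remainders is
    closed under pointwise limits, so no integral and no Cauchy estimate is needed. F is then the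
    extension of prod_g (exp tau_g - 1) Q times the functions t_g / (exp tau_g - 1), holomorphic
    near 0 whether or not tau_g is a period of exp at t = 0. At a removable singularity the value is
    a limit taken separately for each y. Exchanging it with a limit in y requires a uniform rate; on
    a generic line this comes from a denominator that does not involve y. *)

Definition nc (R : realType) (z : R[i]) : R := ComplexField.Normc.normc z.
Arguments nc {R} z : simpl never.

Section ComplexModulus.
Context {R : realType}.
Implicit Types (z w : R[i]) (x : R).

Lemma ncE z : `|z| = (nc z)%:C. Proof. by []. Qed.

Lemma nc_ge0 z : 0 <= nc z.
Proof. by case: z => a b; rewrite /nc /= sqrtr_ge0. Qed.

Lemma nc0 : nc (0 : R[i]) = 0. Proof. exact: ComplexField.Normc.normc0. Qed.
Lemma nc1 : nc (1 : R[i]) = 1. Proof. exact: ComplexField.Normc.normc1. Qed.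
Lemma ncM z w : nc (z * w) = nc z * nc w.
Proof. exact: ComplexField.Normc.normcM. Qed.
Lemma ncV z : nc z^-1 = (nc z)^-1.
Proof. exact: ComplexField.Normc.normcV. Qed.
Lemma ncN z : nc (- z) = nc z.
Proof. exact: normcN. Qed.
Lemma ncD z w : nc (z + w) <= nc z + nc w.
Proof. exact: le_normcD. Qed.
Lemma ncB z w : nc (z - w) <= nc z + nc w.
Proof. by rewrite -[nc w]ncN ncD. Qed.
Lemma ncBC z w : nc (z - w) = nc (w - z).
Proof. by rewrite -ncN opprB. Qed.

Lemma nc_eq0 z : (nc z == 0) = (z == 0).
Proof.
apply/eqP/eqP => [/ComplexField.Normc.eq0_normc //|->]; exact: nc0.
Qed.

Lemma nc_gt0 z : (0 < nc z) = (z != 0).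
Proof. by rewrite lt0r nc_ge0 andbT nc_eq0. Qed.

Lemma nc_real x : nc x%:C = `|x|.
Proof. by rewrite /nc /= expr0n /= addr0 sqrtr_sqr. Qed.

Lemma nc_sum (I : Type) (s : seq I) (P : pred I) (F : I -> R[i]) :
  nc (\sum_(i <- s | P i) F i) <= \sum_(i <- s | P i) nc (F i).
Proof.
elim/big_ind2: _ => [|a b c d ab cd|//]; first by rewrite nc0.
exact: (le_trans (ncD _ _)) (lerD ab cd).
Qed.

Lemma nc_Re z : `|Re z| <= nc z.
Proof.
case: z => a b; rewrite /nc /= -sqrtr_sqr ler_wsqrtr // lerDl; exact: sqr_ge0.
Qed.

Lemma nc_Im z : `|Im z| <= nc z.
Proof.
case: z => a b; rewrite /nc /= -[X in X <= _]sqrtr_sqr ler_wsqrtr // lerDr.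
exact: sqr_ge0.
Qed.

Lemma nc_le_ReIm z : nc z <= `|Re z| + `|Im z|.
Proof.
case: z => a b; rewrite /nc /=.
have ge0 : 0 <= `|a| + `|b| by rewrite addr_ge0.
rewrite -[X in _ <= X]ger0_norm // -sqrtr_sqr ler_wsqrtr //.
rewrite sqrrD !real_normK ?num_real // -addrA [X in _ <= _ + X]addrC addrA.
by rewrite lerDl mulrn_wge0 // mulr_ge0.
Qed.

Lemma sqr_nc z : nc z ^+ 2 = Re z ^+ 2 + Im z ^+ 2.
Proof.
case: z => a b; rewrite /nc /= sqr_sqrtr // addr_ge0 // sqr_ge0 //.
Qed.

Lemma ltC_nc (e : R[i]) : 0 < e -> 0 < Re e /\ forall z, (`|z| < e) = (nc z < Re e).
Proof.
case: e => a b; rewrite ltcE /= => /andP [/eqP -> a0]; split=> // z.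
by rewrite ncE ltcE /= eqxx.
Qed.

Lemma cvg_ncP (T : Type) (F : set_system T) {FF : Filter F} (u : T -> R[i]^o) (l : R[i]^o) :
  u x @[x --> F] --> l <-> forall e : R, 0 < e -> \forall x \near F, nc (l - u x) < e.
Proof.
split=> [/cvgrPdist_lt H e e0|H].
  have e0' : 0 < e%:C :> R[i] by rewrite ltcE /= eqxx.
  have [_ E] := ltC_nc e0'.
  by apply: filterS (H _ e0') => x; rewrite E.
apply/cvgrPdist_lt => e e0; have [e0' E] := ltC_nc e0.
by apply: filterS (H _ e0') => x; rewrite E.
Qed.

Lemma cvg_nc_le (T : Type) (F : set_system T) {FF : ProperFilter F} (u : T -> R[i]^o)
    (l : R[i]^o) (c : R) :
  u x @[x --> F] --> l -> (\forall x \near F, nc (u x) <= c) -> nc l <= c.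
Proof.
move=> /cvg_ncP H B; rewrite leNgt; apply/negP => lt.
have e0 : 0 < nc l - c by rewrite subr_gt0.
have [x [h1 h2]] := filter_ex (filterI (H _ e0) B).
have := ncD (l - u x) (u x); rewrite subrK => h3.
by move: h1 h2 h3; set p := nc _; set q := nc _; set s := nc _; lra.
Qed.

(** Compactness of [-c, c] gives a cluster point of the image; as U contains every set or its
    complement, a cluster point is a limit. *)
Lemma ultra_cvg_real (T : Type) (U : set_system T) (UU : UltraFilter U) (u : T -> R)
    (c : R) : (forall k, `|u k| <= c) -> exists l : R, u x @[x --> U] --> l.
Proof.
move=> uc; have PU := @ultra_proper _ _ UU.
have : (u x @[x --> U]) [set x | x \in `[- c, c]].
  rewrite /= /fmap /=; apply: filterE => k /=.
  by rewrite in_itv /= -ler_norml uc.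
move=> H; have [p [_ clp]] := segment_compact (fmap_proper_filter u PU) H.
exists p => A Ap.
have [//|nA] := in_ultra_setVsetC (u @^-1` A) UU.
by have [z [/= ? ?]] := clp (~` A) A nA Ap.
Qed.

Lemma ultra_cvg (T : Type) (U : set_system T) (UU : UltraFilter U) (u : T -> R[i])
    (c : R) : (forall k, nc (u k) <= c) ->
  exists l : R[i], (u x : R[i]^o) @[x --> U] --> (l : R[i]^o).
Proof.
move=> uc; have PU := @ultra_proper _ _ UU.
have [a Ha] := ultra_cvg_real UU (fun k => le_trans (nc_Re _) (uc k)).
have [b Hb] := ultra_cvg_real UU (fun k => le_trans (nc_Im _) (uc k)).
exists (a +i* b)%C; apply/cvg_ncP => e e0.
have e2 : 0 < e / 2 by rewrite divr_gt0.
move/cvgrPdist_lt : Ha => /(_ _ e2) Ha; move/cvgrPdist_lt : Hb => /(_ _ e2) Hb.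
apply: filterS (filterI Ha Hb) => k [h1 h2].
apply: le_lt_trans (nc_le_ReIm _) _.
move: h1 h2; case: (u k) => x y /=; lra.
Qed.

End ComplexModulus.

Section ComplexExponential.
Context {R : realType}.
Implicit Types (z w : R[i]) (x y : R).

Lemma cexpD z w : cexp (z + w) = cexp z * cexp w.
Proof.
case: z => a b; case: w => c d; rewrite /cexp /=.
rewrite expRD cosD sinD; congr Complex; ring.
Qed.

Lemma cexp0 : cexp (0 : R[i]) = 1.
Proof. by rewrite /cexp /= expR0 cos0 sin0 mulr1 mulr0. Qed.

Lemma nc_cexp z : nc (cexp z) = expR (Re z).
Proof.
case: z => a b; rewrite /cexp /nc /= !exprMn -mulrDr cos2Dsin2 mulr1 sqrtr_sqr.
by rewrite ger0_norm // expR_ge0.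
Qed.

Lemma cexp_neq0 z : cexp z != 0.
Proof. by rewrite -nc_gt0 nc_cexp expR_gt0. Qed.

Lemma cexpN z : cexp (- z) = (cexp z)^-1.
Proof.
by apply: (mulIf (cexp_neq0 z)); rewrite -cexpD addNr cexp0 mulVf ?cexp_neq0.
Qed.

Lemma cexp_sum (I : Type) (s : seq I) (P : pred I) (F : I -> R[i]) :
  cexp (\sum_(i <- s | P i) F i) = \prod_(i <- s | P i) cexp (F i).
Proof. exact: (big_morph _ cexpD cexp0). Qed.

Lemma cexpX z k : cexp (z *+ k) = cexp z ^+ k.
Proof. by elim: k => [|k IH]; rewrite ?mulr0n ?cexp0 // mulrS exprS cexpD IH. Qed.

Lemma nc_cexp_le z : nc (cexp z) <= expR (nc z).
Proof.
by rewrite nc_cexp ler_expR; apply: le_trans (nc_Re z); rewrite ler_norm.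
Qed.

Lemma sin_le_norm y : `|sin y| <= `|y|.
Proof.
wlog y0 : y / 0 <= y.
  move=> H; have [/H //|/ltW y0] := leP 0 y.
  by rewrite -normrN -sinN -[ `|y| ]normrN H // oppr_ge0.
have ds x : x \in `]0, y[ -> is_derive x 1 (sin : R -> R) (cos x).
  by move=> _; apply: is_derive_sin.
have cs : {within `[0, y], continuous (sin : R -> R)}.
  by apply: continuous_subspaceT => x; apply: continuous_sin.
have [c _] := MVT_segment y0 ds cs.
rewrite sin0 !subr0 => ->; rewrite normrM ler_piMl //; exact: cos_max.
Qed.

Lemma cos_sub1_le y : `|cos y - 1| <= y ^+ 2.
Proof.
have -> : cos y - 1 = - (sin (y / 2) ^+ 2 *+ 2).
  rewrite [in LHS](_ : y = (y / 2) *+ 2); last by rewrite -mulr_natr divfK.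
  by rewrite cos_mulr2n cos2sin2; ring.
rewrite normrN normrMn normrX.
have /(lerXn2r 2) : `|sin (y / 2)| <= `|y / 2| by exact: sin_le_norm.
rewrite !nnegrE !normr_ge0 => /(_ isT isT).
rewrite [ `|y / 2| ^+ 2 ]real_normK ?num_real // => h.
have := sqr_ge0 y; rewrite expr_div_n in h; move: h.
by set s := _ ^+ 2; set t := y ^+ 2; rewrite -mulr_natr; lra.
Qed.

Lemma sin_sub_le y : `|y| <= 1 -> `|sin y - y| <= y ^+ 2.
Proof.
wlog y0 : y / 0 <= y.
  move=> H; have [/H //|/ltW y0] := leP 0 y.
  move=> y1; have := H (- y); rewrite oppr_ge0 y0 normrN y1 sinN -opprD normrN sqrrN.
  by apply.
rewrite ger0_norm // => y1.
have ds x : x \in `]0, y[ -> is_derive x 1 (fun x : R => sin x - x) (cos x - 1).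
  by move=> _; apply: is_deriveB.
have cs : {within `[0, y], continuous (fun x : R => sin x - x)}.
  by apply: continuous_subspaceT => x; apply: cvgB; [exact: continuous_sin|exact: cvg_id].
have [c] := MVT_segment y0 ds cs.
rewrite in_itv /= => /andP [c0 cy]; rewrite sin0 !subr0 => ->.
rewrite normrM (ger0_norm y0) expr2 ler_wpM2r //.
apply: le_trans (cos_sub1_le _) _; rewrite expr2.
by nra.
Qed.

(** Both bounds follow from e^x >= 1 + x taken at x and at - x, together with e^x e^(-x) = 1. *)
Lemma expR_sub_le x : `|x| <= 2^-1 -> `|expR x - 1 - x| <= 2 * x ^+ 2.
Proof.
rewrite ler_norml => /andP [x1 x2].
have h1 := @expR_ge1Dx R x; have h2 := @expR_ge1Dx R (- x).
have h3 : expR x * expR (- x) = 1 by rewrite -expRD subrr expR0.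
have h4 := expR_gt0 x.
rewrite ler_norml; apply/andP; split; first by nra.
by nra.
Qed.

Lemma cexp_taylor1_half z : nc z <= 2^-1 -> nc (cexp z - 1 - z) <= 4 * nc z ^+ 2.
Proof.
move=> z1; have := nc_Re z; have := nc_Im z; rewrite sqr_nc.
case: z z1 => a b z1; rewrite [Re _]/= [Im _]/= => hb ha.
have a1 : `|a| <= 2^-1 by exact: le_trans z1.
have b1 : `|b| <= 1 by apply: le_trans (le_trans hb z1) _; lra.
apply: le_trans (nc_le_ReIm _) _; rewrite /= ?subr0.
have eE : `|expR a - 1| <= 2 * `|a|.
  have -> : expR a - 1 = (expR a - 1 - a) + a by ring.
  apply: le_trans (ler_normD _ _) _.
  apply: le_trans (lerD (expR_sub_le a1) (lexx _)) _.
  by rewrite -real_normK ?num_real //; have := normr_ge0 a; nra.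
have e2 : expR a <= 2 by move: eE; rewrite ler_norml; lra.
have h1 : `|expR a * cos b - 1 - a| <= 2 * a ^+ 2 + 2 * b ^+ 2.
  have -> : expR a * cos b - 1 - a = (expR a - 1 - a) + expR a * (cos b - 1) by ring.
  apply: le_trans (ler_normD _ _) _; apply: lerD; first exact: expR_sub_le.
  by rewrite normrM ler_pM // ?cos_sub1_le // ger0_norm // expR_ge0.
have h2 : `|expR a * sin b - b| <= 2 * (`|a| * `|b|) + b ^+ 2.
  have -> : expR a * sin b - b = (expR a - 1) * sin b + (sin b - b) by ring.
  apply: le_trans (ler_normD _ _) _; apply: lerD; last exact: sin_sub_le.
  by rewrite normrM mulrA ler_pM // sin_le_norm.
apply: le_trans (lerD h1 h2) _.
by rewrite -[a ^+ 2]real_normK ?num_real // -[b ^+ 2]real_normK ?num_real //; nra.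
Qed.

Lemma cexp_taylor1 (c : R) : 0 <= c -> exists2 K : R, 0 <= K &
  forall z, nc z <= c -> nc (cexp z - 1 - z) <= K * nc z ^+ 2.
Proof.
move=> c0; have ec := expR_ge0 c.
exists (4 + 4 * (expR c + 1 + c)) => [|z zc]; first by lra.
have z0 := nc_ge0 z.
(* Away from 0 the crude bound exp c + 1 + c suffices, since |z|^2 >= 1/4 there; hence the second
   term of the constant. *)
have [z1|z1] := leP (nc z) 2^-1.
  apply: le_trans (cexp_taylor1_half z1) _; rewrite ler_wpM2r ?sqr_ge0 //; lra.
have : nc (cexp z - 1 - z) <= expR c + 1 + c.
  apply: le_trans (ncB _ _) _; apply: lerD => //.
  apply: le_trans (ncB _ _) _; rewrite nc1 lerD2r.
  by apply: le_trans (nc_cexp_le z) _; rewrite ler_expR.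
move=> /le_trans; apply; have : 4^-1 <= nc z ^+ 2 by nra.
by set q := _ ^+ 2; nra.
Qed.

Lemma cexp_lip (c : R) : 0 <= c -> exists2 K : R, 0 <= K &
  forall z w, nc z <= c -> nc w <= c -> nc (cexp z - cexp w) <= K * nc (z - w).
Proof.
move=> c0; have [|K K0 HK] := @cexp_taylor1 (c + c); first exact: addr_ge0.
have ec := expR_ge0 c.
exists (expR c * (1 + K * (c + c))) => [|z w zc wc].
  by rewrite mulr_ge0 // addr_ge0 // mulr_ge0 // addr_ge0.
have -> : cexp z - cexp w = cexp w * (cexp (z - w) - 1).
  by rewrite mulrBr mulr1 -cexpD addrCA subrr addr0.
rewrite ncM -mulrA; apply: ler_pM; rewrite ?nc_ge0 //.
  by apply: le_trans (nc_cexp_le w) _; rewrite ler_expR.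
have d := le_trans (ncB z w) (lerD zc wc).
have -> : cexp (z - w) - 1 = (cexp (z - w) - 1 - (z - w)) + (z - w) by ring.
apply: le_trans (ncD _ _) _; have := HK _ d; have := nc_ge0 (z - w).
move: d; set p := nc (z - w); set q := nc _ => d p0 /le_trans.
have : K * (p * p) <= K * ((c + c) * p) by rewrite ler_wpM2l // ler_wpM2r.
move=> h; have -> : (1 + K * (c + c)) * p = K * ((c + c) * p) + p by ring.
by rewrite expr2 => /(_ _ h) h'; rewrite lerD2r.
Qed.

End ComplexExponential.

(** * Dual bases *)

Section DotProduct.
Context {R : realType} {r : nat}.
Implicit Types (u v w : 'rV[R]_r) (a : R).

Lemma dotC u v : dot u v = dot v u.
Proof. by apply: eq_bigr => i _; rewrite mulrC. Qed.

Lemma dotDl u v w : dot (u + v) w = dot u w + dot v w.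
Proof. by rewrite -big_split; apply: eq_bigr => i _; rewrite mxE mulrDl. Qed.

Lemma dotZl a u v : dot (a *: u) v = a * dot u v.
Proof. by rewrite mulr_sumr; apply: eq_bigr => i _; rewrite mxE mulrA. Qed.

Lemma dotDr u v w : dot u (v + w) = dot u v + dot u w.
Proof. by rewrite !(dotC u) dotDl. Qed.

Lemma dotZr a u v : dot u (a *: v) = a * dot u v.
Proof. by rewrite !(dotC u) dotZl. Qed.

Lemma dotNl u v : dot (- u) v = - dot u v.
Proof. by rewrite -scaleN1r dotZl mulN1r. Qed.

Lemma dotNr u v : dot u (- v) = - dot u v.
Proof. by rewrite !(dotC u) dotNl. Qed.

Lemma dotBl u v w : dot (u - v) w = dot u w - dot v w.
Proof. by rewrite dotDl dotNl. Qed.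

Lemma dotBr u v w : dot u (v - w) = dot u v - dot u w.
Proof. by rewrite dotDr dotNr. Qed.

Lemma dot0l u : dot 0 u = 0.
Proof. by rewrite -(scale0r 0) dotZl mul0r. Qed.

Lemma dot0r u : dot u 0 = 0.
Proof. by rewrite dotC dot0l. Qed.

Lemma dot_suml (I : Type) (s : seq I) (P : pred I) (F : I -> 'rV[R]_r) v :
  dot (\sum_(i <- s | P i) F i) v = \sum_(i <- s | P i) dot (F i) v.
Proof. by apply: (big_morph (fun x => dot x v)) => [x y|]; rewrite ?dotDl ?dot0l. Qed.

Lemma dot_delta i v : dot (delta_mx 0 i) v = v 0 i.
Proof.
rewrite /dot (bigD1 i) //= mxE !eqxx mul1r big1 ?addr0 // => j ji.
by rewrite mxE eqxx (negbTE ji) mul0r.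
Qed.

Lemma dot_inj u v : (forall w, dot w u = dot w v) -> u = v.
Proof.
by move=> h; apply/rowP => i; rewrite -dot_delta h dot_delta.
Qed.

Lemma dot_self_gt0 u : u != 0 -> 0 < dot u u.
Proof.
move=> u0; rewrite lt0r sumr_ge0 ?andbT => [|i _]; last by rewrite -expr2 sqr_ge0.
apply: contraNneq u0 => h; apply/eqP/rowP => i; rewrite mxE.
have /(_ i isT)/eqP : forall j, true -> u 0 j * u 0 j = 0.
  by apply: psumr_eq0P h => j _; rewrite -expr2 sqr_ge0.
by rewrite mulf_eq0 orbb => /eqP.
Qed.

Lemma dot_norm_le u v : `|dot u v| <= `|u| * \sum_(i < r) `|v 0 i|.
Proof.
apply: le_trans (ler_norm_sum _ _ _) _; rewrite mulr_sumr; apply: ler_sum => i _.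
by rewrite normrM ler_wpM2r // /Num.norm /= mx_normrE; apply: (le_bigmax _ _ (0, i)).
Qed.

End DotProduct.

Section SpanOfFamily.
Context {F : fieldType} {n : nat}.

(** Without repetitions in [s], the coefficients can be indexed by elements of 'I_n, even if [v] is
    not injective. *)
Lemma span_seqP (V : vectType F) (v : 'I_n -> V) (s : seq 'I_n) x : uniq s ->
  x \in <<[seq v f | f <- s]>>%VS ->
  exists c : 'I_n -> F, x = \sum_(f <- s) c f *: v f.
Proof.
elim: s x => [|a s IH] x /=.
  by rewrite span_nil memv0 => _ /eqP ->; exists (fun=> 0); rewrite big_nil.
move=> /andP [ans us]; rewrite span_cons => /memv_addP [_ /vlineP [k ->] [y /(IH _ us) [c ->]]] ->.
exists (fun f => if f == a then k else c f); rewrite big_cons eqxx; congr (_ + _).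
by apply: eq_big_seq => f fs; case: eqP fs ans => // -> ->.
Qed.

Lemma span_imageP (V : vectType F) (v : 'I_n -> V) (B : {set 'I_n}) x :
  x \in <<[seq v f | f in B]>>%VS ->
  exists c : 'I_n -> F, x = \sum_(f in B) c f *: v f.
Proof.
move=> /(span_seqP (enum_uniq _)) [c ->]; exists c.
by rewrite big_enum.
Qed.

Lemma mem_span_image (V : vectType F) (v : 'I_n -> V) (B : {set 'I_n}) f :
  f \in B -> v f \in <<[seq v f | f in B]>>%VS.
Proof. by move=> fB; apply/memv_span/map_f; rewrite mem_enum. Qed.

Lemma free_image_eq0 (V : vectType F) (v : 'I_n -> V) (B : {set 'I_n}) (c : 'I_n -> F) :
  free [seq v f | f in B] -> \sum_(f in B) c f *: v f = 0 ->
  forall f, f \in B -> c f = 0.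
Proof.
move=> fr h f fB.
have sz : size [seq v f | f in B] = #|B| by rewrite size_map -cardE.
move/(@freeP _ _ _ (in_tuple _)) : fr => fr.
have lt : (index f (enum B) < size [seq v f | f in B])%N.
  by rewrite size_map index_mem mem_enum.
have := fr (fun i => c (nth f (enum B) i)) _ (Ordinal lt).
rewrite /= nth_index ?mem_enum //; apply.
rewrite -[RHS]h -[RHS]big_enum /= (big_nth f) size_map big_mkord.
by apply: eq_bigr => i _; rewrite (nth_map f) // -(size_map v).
Qed.

Lemma free_imageP (V : vectType F) (v : 'I_n -> V) (B : {set 'I_n}) :
  (forall c : 'I_n -> F, \sum_(f in B) c f *: v f = 0 -> forall f, f \in B -> c f = 0) ->
  free [seq v f | f in B].
Proof.
move=> H; apply/(@freeP _ _ _ (in_tuple _)) => k h i.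
have [f0 _] : {f0 | f0 \in B}.
  have : (i < size (enum B))%N by rewrite -(size_map v).
  by case E : (enum B) => [|f0 s] // _; exists f0; rewrite -mem_enum E mem_head.
have lt : (i < size (enum B))%N by rewrite -(size_map v).
pose c f := oapp k 0 (insub (index f (enum B))).
have cE (j : 'I_(size [seq v f | f in B])) : c (nth f0 (enum B) j) = k j.
  have ltj : (j < size (enum B))%N by rewrite -(size_map v).
  by rewrite /c index_uniq ?enum_uniq // valK.
rewrite -cE; apply: H; last by rewrite -mem_enum mem_nth.
rewrite -[RHS]h -[LHS]big_enum /= (big_nth f0) big_mkord.
have sz : size (enum B) = size [seq v f | f in B] by rewrite size_map.
rewrite (big_ord_widen _ (fun j => c (nth f0 (enum B) j) *: v (nth f0 (enum B) j)) (eq_leq sz)).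
apply: eq_big => [j|j _]; first by rewrite sz ltn_ord.
by rewrite cE (nth_map f0) // sz.
Qed.

(** The entries of the dual vector are the values of the f-th coordinate functional of the free
    family on the unit vectors. *)
Lemma dual_family_exists (r : nat) (v : 'I_n -> 'rV[F]_r) (B : {set 'I_n}) f :
  free [seq v f | f in B] -> f \in B ->
  exists u : 'rV[F]_r, forall g, g \in B -> \sum_(i < r) v g 0 i * u 0 i = (g == f)%:R.
Proof.
move=> fr fB; set X := in_tuple [seq v f | f in B].
have sz : size [seq v f | f in B] = size (enum B) by rewrite size_map.
have lt g : g \in B -> (index g (enum B) < size [seq v f | f in B])%N.
  by move=> gB; rewrite sz index_mem mem_enum.
pose i := Ordinal (lt _ fB).
exists (\row_j coord X i (delta_mx 0 j)) => g gB.
have -> : (g == f) = (i == Ordinal (lt _ gB)).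
  rewrite -[RHS]val_eqE /=; apply/idP/idP => [/eqP -> //|/eqP h]; apply/eqP.
  by rewrite -[g](@nth_index _ f _ (enum B)) ?mem_enum // -h nth_index ?mem_enum.
have fX : free X by [].
rewrite eq_sym; have <- := coord_free (Ordinal (lt _ gB)) i fX.
have -> : X`_(Ordinal (lt _ gB)) = v g.
  by rewrite /= (nth_map f) ?index_mem ?mem_enum // nth_index ?mem_enum.
rewrite [in RHS](row_sum_delta (v g)) linear_sum; apply: eq_bigr => j _ /=.
by rewrite linearZ /= mxE.
Qed.

End SpanOfFamily.

Lemma dim_rV (F : fieldType) (r : nat) : \dim {: 'rV[F]_r} = r.
Proof. by rewrite dimvf /dim /= mul1n. Qed.

Section DualBasis.
Context {R : realType} {r n : nat} (Lam : 'I_n -> 'rV[int]_r * R[i]).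
Local Notation rv f := (realv (R := R) (vec Lam f)).
Local Notation base := (is_base Lam).
Local Notation dv := (dualv Lam).
Implicit Types (B : {set 'I_n}) (f g : 'I_n).

Lemma baseP B : base B -> #|B| = r /\ free [seq rv f | f in B].
Proof. by case/andP => /eqP ? /basis_free. Qed.

Lemma base_of_free B : #|B| = r -> free [seq rv f | f in B] -> base B.
Proof.
move=> cB fr; rewrite /is_base cB eqxx /= basisEfree fr subvf dim_rV.
by rewrite size_map -cardE cB /=.
Qed.

Lemma dualvP B f g : base B -> f \in B -> g \in B -> dot (rv g) (dv B f) = (g == f)%:R.
Proof.
move=> bB fB gB; have [_ fr] := baseP bB.
rewrite /dualv; case: xgetP => [u _ /(_ _ gB)//|] H.
have [u Hu] := dual_family_exists fr fB.
by have := H u; case; apply: Hu.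
Qed.

Lemma dualv_expand B y : base B -> y = \sum_(f in B) dot y (dv B f) *: rv f.
Proof.
move=> bB; have : y \in <<[seq rv f | f in B]>>%VS.
  by case/andP : bB => _ /span_basis ->; rewrite memvf.
move=> /(span_imageP (v := fun f => rv f)) [c yE].
rewrite [LHS]yE; apply: eq_bigr => f fB; congr (_ *: _).
rewrite yE dot_suml (bigD1 f) //= dotZl dualvP // eqxx mulr1 big1 ?addr0 // => g /andP [gB gf].
by rewrite dotZl dualvP // (negbTE gf) mulr0.
Qed.

Lemma dual_unique B u v : base B ->
  (forall g, g \in B -> dot (rv g) u = dot (rv g) v) -> u = v.
Proof.
move=> bB h; apply: dot_inj => w; rewrite (dualv_expand w bB) !dot_suml.
by apply: eq_bigr => f fB; rewrite !dotZl h.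
Qed.

(** Pairing a linear relation with [u f] isolates one coefficient, so a biorthogonal family of the
    right size certifies both the base and its dual vectors. *)
Lemma base_of_dual B (u : 'I_n -> 'rV[R]_r) : #|B| = r ->
  (forall f g, f \in B -> g \in B -> dot (rv g) (u f) = (g == f)%:R) ->
  base B /\ forall f, f \in B -> dv B f = u f.
Proof.
move=> cB H; have bB : base B.
  apply: base_of_free => //; apply: (free_imageP (v := fun f => rv f)) => c h f fB.
  have := congr1 (fun x => dot x (u f)) h; rewrite /= dot0l dot_suml (bigD1 f) //= dotZl H // eqxx mulr1.
  rewrite big1 ?addr0 // => g /andP [gB gf].
  by rewrite dotZl H // (negbTE gf) mulr0.
split=> // f fB; apply: (dual_unique bB) => g gB.
by rewrite dualvP // H.
Qed.

Lemma dualv_neq0 B f : base B -> f \in B -> dv B f != 0.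
Proof.
move=> bB fB; apply/eqP => h; have := dualvP bB fB fB.
by rewrite h dot0r eqxx => /eqP; rewrite eq_sym oner_eq0.
Qed.

(** A pivot: the dual vector of f is rescaled to pair to 1 with g, and the other dual vectors are
    corrected by multiples of it so as to become orthogonal to g. *)
Lemma base_exchange B f g : base B -> f \in B -> dot (rv g) (dv B f) != 0 ->
  let B' := g |: (B :\ f) in
  [/\ base B', dv B' g = (dot (rv g) (dv B f))^-1 *: dv B f &
     forall h, h \in B -> h != f ->
       dv B' h = dv B h - (dot (rv g) (dv B h) / dot (rv g) (dv B f)) *: dv B f].
Proof.
move=> bB fB c0 B'; set c := dot _ _ in c0 *.
have gB : g \in B -> g = f.
  move=> gB; apply/eqP; apply: contraNT c0 => gf.
  by rewrite /c dualvP // (negbTE gf).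
have gnB : g \notin B :\ f.
  by rewrite !inE; apply/negP => /andP [/eqP gf /gB].
have cB' : #|B'| = r.
  by rewrite cardsU1 gnB; have := cardsD1 f B; rewrite fB; have [-> _] := baseP bB => ->.
pose u h := if h == g then c^-1 *: dv B f
  else dv B h - (dot (rv g) (dv B h) / c) *: dv B f.
have [|bB' dB'] := @base_of_dual B' u cB'.
  move=> h k; rewrite /u !inE => hB' kB'.
  case: (eqVneq h g) hB' => [-> _|hg /= /andP [hf hB]].
    rewrite dotZr; case: (eqVneq k g) kB' => [-> _|kg /= /andP [kf kB]].
      by rewrite mulVf.
    by rewrite dualvP // (negbTE kf) mulr0.
  rewrite dotBr dotZr; case: (eqVneq k g) kB' => [-> _|kg /= /andP [kf kB]].
    by rewrite divfK // subrr eq_sym (negbTE hg).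
  by rewrite (dualvP bB fB kB) (negbTE kf) mulr0 subr0 dualvP.
split=> // [|h hB hf]; first by rewrite dB' ?setU11 // /u eqxx.
have hg : h != g by apply: contraNneq gnB => <-; rewrite !inE hf.
by rewrite dB' ?inE ?hf ?hB ?orbT // /u (negbTE hg).
Qed.

Lemma dot_realv_rat (w : 'rV[int]_r) (u : 'rV[rat]_r) :
  dot (realv (R := R) w) (map_mx ratr u) =
  ratr (\sum_(i < r) (map_mx intr w : 'rV[rat]_r) 0 i * u 0 i).
Proof.
rewrite rmorph_sum; apply: eq_bigr => i _; rewrite !mxE rmorphM /= ratr_int //.
Qed.

(** The vectors are integral, so they have a dual family over Q as well. By uniqueness it is the
    real one, whose entries therefore have a common denominator. *)
Lemma dualv_int1 B f : base B -> f \in B -> exists2 m : nat, (0 < m)%N &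
  forall w : 'rV[int]_r, dot (realv w) (dv B f) * m%:R \is a Num.int.
Proof.
move=> bB fB; have [cB fr] := baseP bB.
pose vq f := map_mx intr (vec Lam f) : 'rV[rat]_r.
have frq : free [seq vq f | f in B].
  apply: (free_imageP (v := vq)) => c h g gB.
  have := free_image_eq0 (v := fun f => rv f) (c := ratr \o c) fr _ gB.
  move=> /(_ _)/eqP; rewrite fmorph_eq0 => H; apply/eqP; apply: H.
  apply/rowP => i; have := congr1 (fun x : 'rV[rat]_r => ratr (x 0 i) : R) h.
  rewrite !mxE rmorph0 => <-; rewrite !summxE rmorph_sum; apply: eq_bigr => k _.
  by rewrite !mxE rmorphM /= ratr_int.
have [u Hu] := dual_family_exists frq fB.
have dE : dv B f = map_mx ratr u.
  apply: (dual_unique bB) => g gB; rewrite dualvP // dot_realv_rat Hu //.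
  by rewrite rmorph_nat.
exists (\prod_(i < r) `|denq (u 0%R i)|)%N.
  by rewrite prodn_gt0 // => i; rewrite absz_gt0 denq_neq0.
move=> w; rewrite dE /dot mulr_suml rpred_sum // => i _.
rewrite (bigD1 i) //= natrM !mxE mulrA rpredM ?rpred_nat // -mulrA rpredM //.
  exact: intr_int.
have -> : `|denq (u 0 i)|%:R = ratr (denq (u 0 i))%:~R :> R.
  by rewrite -[in RHS]absz_denq -pmulrn ratr_nat.
rewrite -rmorphM /= -[X in X * _]divq_num_den divfK ?intr_eq0 ?denq_neq0 //.
by rewrite ratr_int intr_int.
Qed.

Lemma dualv_int : exists2 N0 : nat, (1 < N0)%N &
  forall B f (w : 'rV[int]_r), base B -> f \in B ->
    dot (realv w) (dv B f) * N0%:R \is a Num.int.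
Proof.
have H (p : {set 'I_n} * 'I_n) : exists m : nat, (0 < m)%N /\
    (base p.1 -> p.2 \in p.1 -> forall w : 'rV[int]_r,
       dot (realv w) (dv p.1 p.2) * m%:R \is a Num.int).
  have [bB|nb] := boolP (base p.1); last by exists 1%N.
  have [fB|nf] := boolP (p.2 \in p.1); last by exists 1%N.
  by have [m m0 Hm] := dualv_int1 bB fB; exists m.
have [m Hm] := choice H.
(* The factor 2 keeps the modulus above 1; otherwise 'Z_N would not have N elements. *)
exists (2 * \prod_p m p)%N.
  have : (0 < \prod_p m p)%N by rewrite prodn_gt0 // => p; case: (Hm p).
  by case: (\prod_p m p)%N => // k _; rewrite mulnS.
move=> B f w bB fB; rewrite (bigD1 (B, f)) //= !natrM mulrCA rpredM ?rpred_nat //.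
by rewrite mulrA rpredM ?rpred_nat //; apply: (Hm (B, f)).2.
Qed.

End DualBasis.

(** * Averages over boxes *)

Lemma nc_avg (R : realType) (J : finType) (F : J -> R[i]) (c : R) : (0 < #|J|)%N ->
  (forall j, nc (F j) <= c) -> nc (#|J|%:R^-1 * \sum_j F j) <= c.
Proof.
move=> J0 Fc; have JR : (0 : R) < #|J|%:R by rewrite ltr0n.
rewrite ncM ncV -(rmorph_nat (real_complex R)) nc_real ger0_norm // ler_pdivrMl //.
apply: le_trans (nc_sum _ _ _) _.
by apply: le_trans (ler_sum _ (fun j _ => Fc j)) _; rewrite sumr_const mulr_natl.
Qed.

Section BoxMean.
Context {R : realType} {r : nat} (N : nat) (N_gt1 : (1 < N)%N).
Implicit Types (h : 'rV[int]_r -> R[i]) (u : 'rV[int]_r).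

Definition Zv (w : 'rV['Z_N]_r) : 'rV[int]_r :=
  map_mx (fun x : 'Z_N => Posz (nat_of_ord x)) w.

(** The box {0, ..., N - 1}^r is indexed by the group (Z / N)^r, so that a translation permutes it
    up to multiples of N. *)
Definition mean h : R[i] := (N ^ r)%:R^-1 * \sum_(w : 'rV['Z_N]_r) h (Zv w).

Definition box_periodic h := forall w u, h (w + N%:Z *: u) = h w.

Lemma intr_Zp_eq0 (m : int) : m%:~R = 0 :> 'Z_N -> (N %| m)%Z.
Proof.
rewrite (divz_eq m N); set q := (m %/ N)%Z.
have [s sE] : exists s : nat, (m %% N)%Z = s.
  by exists `|(m %% N)%Z|%N; rewrite gez0_abs // modz_ge0 // -lt0n ltnW.
have sN : (s < N)%N by rewrite -ltz_nat -sE ltz_pmod // ltz_nat ltnW.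
rewrite sE intrD intrM -[X in q%:~R * X]pmulrn pchar_Zp // mulr0 add0r -pmulrn => /(congr1 val).
rewrite /= val_Zp_nat // modn_small // => ->.
by rewrite addr0 dvdz_mull.
Qed.

Lemma Zv0 : Zv 0 = 0.
Proof. by apply/rowP => i; rewrite !mxE. Qed.

Lemma Zv_add u : exists u0 : 'rV['Z_N]_r, forall w, exists k,
  Zv w + u = Zv (w + u0) + N%:Z *: k.
Proof.
exists (map_mx intr u) => w.
exists (map_mx (fun x => (x %/ N)%Z) (Zv w + u - Zv (w + map_mx intr u))).
apply/rowP => i; rewrite !mxE; set x := w 0 i; set z := u 0 i; set q := Posz (x + _ : 'Z_N)%R.
rewrite mulrC divzK ?[q + _]addrC ?subrK //; apply: intr_Zp_eq0.
by rewrite intrB intrD -!pmulrn !natr_Zp subrr.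
Qed.

Lemma mean_shift h u : box_periodic h -> mean (fun w => h (w + u)) = mean h.
Proof.
move=> hp; congr (_ * _); have [u0 H] := Zv_add u.
rewrite [RHS](reindex_inj (addIr u0)) /=; apply: eq_bigr => w _.
by have [k ->] := H w; rewrite hp.
Qed.

Lemma eq_mean h1 h2 : (forall w, h1 w = h2 w) -> mean h1 = mean h2.
Proof. by move=> e; congr (_ * _); apply: eq_bigr. Qed.

Lemma meanMl c h : mean (fun w => c * h w) = c * mean h.
Proof. by rewrite /mean mulrCA; congr (_ * _); rewrite mulr_sumr. Qed.

Lemma mean_sum (I : Type) (s : seq I) (P : pred I) (h : I -> 'rV[int]_r -> R[i]) :
  mean (fun w => \sum_(i <- s | P i) h i w) = \sum_(i <- s | P i) mean (h i).
Proof. by rewrite /mean exchange_big mulr_sumr. Qed.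

Lemma card_box : #|{: 'rV['Z_N]_r}| = (N ^ r)%N.
Proof. by rewrite card_mx card_ord mul1n Zp_cast. Qed.

Lemma box_natr_neq0 : ((N ^ r)%:R : R[i]) != 0.
Proof. by rewrite pnatr_eq0 -lt0n expn_gt0 ltnW. Qed.

Lemma mean_le h c : (forall w, nc (h w) <= c) -> nc (mean h) <= c.
Proof.
by move=> hc; rewrite /mean -card_box; apply: nc_avg => //; rewrite card_box expn_gt0 ltnW.
Qed.

End BoxMean.

Lemma realv_inj (R : realType) (r : nat) : injective (realv (R := R) (r := r)).
Proof.
move=> u v /rowP e; apply/rowP => i; have := e i; rewrite !mxE => /eqP.
by rewrite eqr_int => /eqP.
Qed.

Lemma realvD (R : realType) (r : nat) (u v : 'rV[int]_r) :
  realv (R := R) (u + v) = realv u + realv v.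
Proof. by apply/rowP => i; rewrite !mxE intrD. Qed.

Lemma realvZ (R : realType) (r : nat) (m : int) (v : 'rV[int]_r) :
  realv (R := R) (m *: v) = m%:~R *: realv v.
Proof. by apply/rowP => i; rewrite !mxE intrM. Qed.

Lemma realv_sum (R : realType) (r : nat) (I : Type) (s : seq I) (P : pred I)
    (F : I -> 'rV[int]_r) :
  realv (R := R) (\sum_(i <- s | P i) F i) = \sum_(i <- s | P i) realv (F i).
Proof.
apply: (big_morph _ (@realvD R r)).
by apply/rowP => i; rewrite !mxE.
Qed.

Lemma frac_shift (R : realType) (x m : R) : m \is a Num.int -> Defs.frac (x + m) = Defs.frac x.
Proof.
move=> /intrP [k ->]; rewrite /Defs.frac floorDrz ?intr_int // intrKfloor intrD.
by ring.
Qed.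

Section BoxFormula.
Context {R : realType} {r n : nat} (Lam : 'I_n -> 'rV[int]_r * R[i]).
Context (N : nat) (N_gt1 : (1 < N)%N).
Local Notation rv f := (realv (R := R) (vec Lam f)).
Local Notation base := (is_base Lam).
Local Notation dv := (dualv Lam).
Implicit Types (B S : {set 'I_n}) (f g : 'I_n) (y phi : 'rV[R]_r) (w : 'rV[int]_r).

(** It puts M Z^r inside every lattice <B>, so a single box serves all the quotients Z^r / <B>. *)
Definition clears_den (M : nat) := forall B f w, base B -> f \in B ->
  dot (realv w) (dv B f) * M%:R \is a Num.int.

Context (N_clears : clears_den N).

Lemma bfrac_shift phi y w B f u : dot (realv u) (dv B f) \is a Num.int ->
  bfrac Lam phi (y + realv (w + u)) B f = bfrac Lam phi (y + realv w) B f.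
Proof.
move=> i; rewrite /bfrac realvD addrA (dotDl (y + realv w)); case: ifP => _; first exact: frac_shift.
by congr (1 - _); rewrite (opprD (dot _ _)); apply: frac_shift; rewrite rpredN.
Qed.

Lemma lattice_dot_int B f w : base B -> f \in B -> lattice Lam B w ->
  dot (realv w) (dv B f) \is a Num.int.
Proof.
move=> bB fB [m ->]; rewrite realv_sum dot_suml rpred_sum // => g gB.
by rewrite realvZ dotZl (dualvP bB fB gB) rpredM ?intr_int ?rpred_nat.
Qed.

Lemma lattice_clear B w : base B -> lattice Lam B (N%:Z *: w).
Proof.
move=> bB; exists (fun f => Num.floor (dot (realv w) (dv B f) * N%:R)).
apply: (@realv_inj R); rewrite realv_sum realvZ [in LHS](dualv_expand (realv w) bB).
rewrite scaler_sumr; apply: eq_bigr => f fB; rewrite realvZ scalerA; congr (_ *: _).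
by rewrite floorK ?N_clears // mulrC.
Qed.

Lemma latticeD B u v : lattice Lam B u -> lattice Lam B v -> lattice Lam B (u + v).
Proof.
move=> [m ->] [m' ->]; exists (fun f => m f + m' f); rewrite -big_split.
by apply: eq_bigr => f _; rewrite /= scalerDl.
Qed.

Lemma latticeN B u : lattice Lam B u -> lattice Lam B (- u).
Proof.
move=> [m ->]; exists (fun f => - m f); rewrite -sumrN.
by apply: eq_bigr => f _; rewrite scaleNr.
Qed.

Lemma lattice0 B : lattice Lam B 0.
Proof. by exists (fun=> 0); rewrite big1 // => f _; rewrite scale0r. Qed.

Let coset B w : set 'rV[int]_r := [set w + u | u in lattice Lam B].

Lemma coset_eq B w w' : lattice Lam B (w - w') -> coset B w = coset B w'.
Proof.
move=> l; apply/seteqP; split=> x [u lu <-].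
  by exists (w - w' + u); [exact: latticeD|rewrite addrA [w' + _]addrC subrK].
exists (w' - w + u); first by apply: latticeD => //; rewrite -opprB; exact: latticeN.
by rewrite addrA [w + _]addrC subrK.
Qed.

Lemma coset_xget B w : lattice Lam B (xget 0 (coset B w) - w).
Proof.
case: xgetP => [x _ [u lu <-]|/(_ w)]; first by rewrite addrC addKr.
by case; exists 0; [exact: lattice0|rewrite addr0].
Qed.

Lemma cosets_finite B : base B -> finite_set (cosets Lam B).
Proof.
move=> bB; apply: (@sub_finite_set _ _ [set coset B (Zv w) | w in [set: 'rV['Z_N]_r]]).
  move=> W [w _ <-]; have [u0 Hu0] := Zv_add N_gt1 w; have [k] := Hu0 0.
  rewrite Zv0 !add0r => wE; exists u0 => //; apply: coset_eq.
  by rewrite wE opprD addrA subrr add0r; apply/latticeN/lattice_clear.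
by apply: finite_image; exact: finite_finset.
Qed.

(** Double counting of h (x + w), with x over coset representatives and w over the box: for fixed w,
    translation by w permutes the cosets (E1); for fixed x, the box sum is invariant under
    translation by x (E2). *)
Lemma coset_mean B (h : 'rV[int]_r -> R[i]) : base B ->
  (forall w u, lattice Lam B u -> h (w + u) = h w) ->
  (#|` fset_set (cosets Lam B)|%:R)^-1 * \sum_(W \in cosets Lam B) h (xget 0 W)
  = mean N h.
Proof.
move=> bB hp; have fin := cosets_finite bB.
rewrite fsbig_finite //=; set A := fset_set _.
have hper : box_periodic N h by move=> w u; rewrite hp //; exact: lattice_clear.
have E1 (w : 'rV['Z_N]_r) : \sum_(W <- A) h (xget 0 W + Zv w) = \sum_(W <- A) h (xget 0 W).
  rewrite -!fsbig_finite //; set v := Zv w.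
  have tE w1 : [set x + v | x in coset B w1] = coset B (w1 + v).
    apply/seteqP; split=> [_ [_ [u lu <-] <-]|_ [u lu <-]].
      by exists u => //; rewrite addrAC.
    by exists (w1 + u); [exists u|rewrite addrAC].
  have bij : set_bij (cosets Lam B) (cosets Lam B) (fun W => [set x + v | x in W]).
    split.
    - by move=> _ [w1 _ <-]; rewrite /= tE; exists (w1 + v).
    - move=> W W' _ _ e; apply/seteqP; split=> x Wx.
        have : [set x + v | x in W'] (x + v) by rewrite -e; exists x.
        by move=> [x' W'x' /addIr <-].
      have : [set x + v | x in W] (x + v) by rewrite e; exists x.
      by move=> [x' W'x' /addIr <-].
    - move=> _ [w1 _ <-]; exists (coset B (w1 - v)); first by exists (w1 - v).
      by rewrite tE subrK.
  rewrite [RHS](reindex_fsbig _ _ _ _ bij); apply: eq_fsbigr => W; rewrite inE => -[w1 _ <-].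
  rewrite tE; have l1 := coset_xget B w1; have l2 := coset_xget B (w1 + v).
  rewrite -[xget 0 (coset B w1)](subrK w1) addrAC [X in h (X + _)]addrC.
  rewrite -[xget 0 (coset B (w1 + v))](subrK (w1 + v)) [X in _ = h X]addrC.
  by rewrite [RHS]hp // addrAC [LHS]hp // addrC.
have E2 x : \sum_(w : 'rV['Z_N]_r) h (x + Zv w) = \sum_(w : 'rV['Z_N]_r) h (Zv w).
  have := mean_shift N_gt1 x hper; rewrite /mean => /(mulfI _) e.
  rewrite -e ?invr_eq0 ?box_natr_neq0 //.
  by apply: eq_bigr => w _; rewrite addrC.
have key : (N ^ r)%:R * \sum_(W <- A) h (xget 0 W)
         = #|` A|%:R * \sum_(w : 'rV['Z_N]_r) h (Zv w).
  have -> : (N ^ r)%:R * \sum_(W <- A) h (xget 0 W)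
    = \sum_(w : 'rV['Z_N]_r) \sum_(W <- A) h (xget 0 W + Zv w).
    by rewrite (eq_bigr (fun=> \sum_(W <- A) h (xget 0 W)) (fun (v : 'rV['Z_N]_r) _ => E1 v)) sumr_const card_box // mulr_natl.
  rewrite exchange_big /= (eq_bigr _ (fun W _ => E2 (xget 0 W))).
  by rewrite big_const_seq count_predT iter_addr_0 cardfE -cardfE mulr_natl.
have A0 : (#|` A|%:R : R[i]) != 0.
  rewrite pnatr_eq0 cardfs_eq0; apply/eqP => A0.
  have : coset B 0 \in A by rewrite in_fset_set // inE; exists 0.
  by rewrite A0 inE.
apply: (mulfI A0); rewrite mulVKf //; apply: (mulfI (box_natr_neq0 (R := R) (r := r) N_gt1)).
by rewrite key /mean mulrCA mulVKf // box_natr_neq0.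
Qed.

Definition cden (tau : 'I_n -> R[i]) B g : R[i] :=
  tau g - \sum_(f in B) tau f * (dot (rv g) (dv B f))%:C.

Definition bterm (tau : 'I_n -> R[i]) phi y B w : R[i] :=
  \prod_(f in B)
    (cexp (tau f * (bfrac Lam phi (y + realv w) B f)%:C) / (cexp (tau f) - 1)).

(** The numerators t_g are split off, so that only tau remains, and the product runs over S \ B:
    passing to S \ g is then one step of the recursion. *)
Definition Q S (tau : 'I_n -> R[i]) phi y : R[i] :=
  \sum_(B : {set 'I_n} | base B && (B \subset S))
    (\prod_(g in S :\: B) (cden tau B g)^-1) * mean N (bterm tau phi y B).

Lemma bterm_periodic tau phi y B : base B -> box_periodic N (bterm tau phi y B).
Proof.
move=> bB w u; apply: eq_bigr => f fB; rewrite bfrac_shift //.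
by rewrite realvZ dotZl mulrC; exact: N_clears.
Qed.

Lemma Fformula_Q phi t y :
  Fformula Lam phi t y = (\prod_g t 0 g) * Q [set: 'I_n]%SET (tshift Lam t) phi y.
Proof.
rewrite /Fformula /Q mulr_sumr; apply: eq_big => [B|B bB]; first by rewrite finset.subsetT andbT.
have -> : \prod_g t 0 g = (\prod_(g in ~: B) t 0 g) * (\prod_(g in B) t 0 g).
  rewrite (bigID (fun g => g \in B)) /= mulrC; congr (_ * _).
  by apply: eq_bigl => g; rewrite inE.
have -> : \prod_(g in ~: B) (t 0 g / den Lam t B g) =
  (\prod_(g in ~: B) t 0 g) * \prod_(g in [set: 'I_n]%SET :\: B) (cden (tshift Lam t) B g)^-1.
  rewrite big_split; congr (_ * _).
  by apply: eq_bigl => g; rewrite !inE andbT.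
rewrite -!mulrA; congr (_ * _); rewrite [RHS]mulrCA; congr (_ * _).
rewrite -(coset_mean bB); last first.
  move=> w u lu; apply: eq_bigr => f fB; rewrite bfrac_shift //.
  exact: lattice_dot_int.
rewrite mulrCA; congr (_ * _); rewrite !fsbig_finite ?mulr_sumr //; try exact: cosets_finite.
by apply: eq_bigr => W _; rewrite -big_split; apply: eq_bigr => f _; exact/esym/mulrA.
Qed.

End BoxFormula.

(** * Continuity in y *)

Lemma nbhs_forall (T : topologicalType) (x : T) (I : finType) (P : I -> T -> Prop) :
  (forall i, \forall y \near x, P i y) -> \forall y \near x, forall i, P i y.
Proof. exact: filter_forall. Qed.

Lemma cvg_nc_at (R : realType) (T : topologicalType) (x : T) (u : T -> R[i]^o) (l : R[i]^o) :
  (forall e : R, 0 < e -> \forall y \near x, nc (l - u y) < e) -> u y @[y --> x] --> l.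
Proof. by move=> H; apply/cvg_ncP. Qed.

Lemma cvg_ray (R : realType) (r : nat) (y phi : 'rV[R]_r) : (y + c *: phi) @[c --> (0 : R)^'+] --> y.
Proof.
rewrite -[X in _ --> X]addr0 -(scale0r phi); apply: cvgD; first exact: cvg_cst.
by apply: cvgZr_tmp; apply: cvg_at_right_filter; exact: cvg_id.
Qed.

(** * One-sided fractional parts and small perturbations *)

Section SidedFractionalPart.
Context {R : realType}.
Implicit Types (x m d : R) (s : bool).

(** The right-hand ([s] true, values in [0, 1)) or left-hand (values in (0, 1]) limit of the
    fractional part at x. *)
Definition sfrac s x : R := if s then Defs.frac x else 1 - Defs.frac (- x).

Lemma frac_itv x m : m \is a Num.int -> m <= x < m + 1 -> Defs.frac x = x - m.
Proof.
move=> /intrP [k ->] h; rewrite /Defs.frac; congr (_ - _%:~R).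
by apply: Num.Theory.floor_def; rewrite intrD.
Qed.

Lemma sfrac_true x m : m \is a Num.int -> m <= x < m + 1 -> sfrac true x = x - m.
Proof. exact: frac_itv. Qed.

Lemma sfrac_false x m : m \is a Num.int -> m < x <= m + 1 -> sfrac false x = x - m.
Proof.
move=> mi /andP [h1 h2]; rewrite /sfrac (frac_itv (m := - m - 1)).
- by ring.
- by rewrite rpredB ?rpredN ?rpred1.
- by apply/andP; split; lra.
Qed.

Lemma sfrac_ex s x : exists2 m, m \is a Num.int &
  sfrac s x = x - m /\ (if s then m <= x < m + 1 else m < x <= m + 1).
Proof.
case: s.
  have h : (Num.floor x)%:~R <= x < (Num.floor x)%:~R + 1.
    by rewrite Num.Theory.floor_le /= -intrD1 Num.Theory.floorD1_gt.
  by exists (Num.floor x)%:~R; [exact: intr_int|split => //; exact: sfrac_true (intr_int _) h].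
have h1 := Num.Theory.floor_le (- x); have h2 := Num.Theory.floorD1_gt (- x).
rewrite intrD1 in h2.
have mi : - (Num.floor (- x))%:~R - 1 \is a @Num.int R by rewrite rpredB ?rpredN ?rpred1 ?intr_int.
have h : - (Num.floor (- x))%:~R - 1 < x <= - (Num.floor (- x))%:~R - 1 + 1.
  by apply/andP; split; lra.
by exists (- (Num.floor (- x))%:~R - 1) => //; split => //; exact: sfrac_false.
Qed.

Lemma sfrac_ge0 s x : 0 <= sfrac s x.
Proof. by have [m _ []] := sfrac_ex s x; case: s => -> /andP [? ?]; lra. Qed.

Lemma sfrac_le1 s x : sfrac s x <= 1.
Proof. by have [m _ []] := sfrac_ex s x; case: s => -> /andP [? ?]; lra. Qed.

Lemma sfrac_notint s s' x : x \isn't a Num.int -> sfrac s x = sfrac s' x.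
Proof.
move=> nx; suff H : forall b, sfrac b x = sfrac true x by rewrite !H.
case=> //; have [m mi [_ /andP [h1 h2]]] := sfrac_ex true x.
have mx : m != x by apply: contraNneq nx => <-.
rewrite (sfrac_true mi) ?(sfrac_false mi) ?h1 ?h2 //.
by rewrite lt_neqAle mx h1 ltW.
Qed.

(** Only an integer x is delicate: leaving it by d != 0, the sign of d decides on which side of the
    jump one is, and s no longer matters. *)
Lemma sfrac_near s x : exists2 e, 0 < e & forall d, `|d| < e ->
  sfrac s (x + d) = sfrac (if d == 0 then s else 0 < d) x + d.
Proof.
have [m mi [_ /andP [h1 h2]]] := sfrac_ex true x.
have [xm|xm] := eqVneq m x.
  exists 1 => // d; rewrite ltr_norml => /andP [d1 d2].
  have [->|d0] := eqVneq d 0; first by rewrite !addr0.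
  have [dp|dp] := boolP (0 < d).
    rewrite (sfrac_true mi) -?xm; last by apply/andP; split; lra.
    by case: s; [rewrite (sfrac_true mi)|rewrite (sfrac_false mi)]; rewrite -?xm;
      (try by apply/andP; split; lra); ring.
  have dn : d < 0 by rewrite lt_neqAle d0 leNgt.
  have mi' : m - 1 \is a Num.int by rewrite rpredB // rpred1.
  rewrite (sfrac_false (m := m - 1)) -?xm //; last by apply/andP; split; lra.
  by case: s; [rewrite (sfrac_true mi')|rewrite (sfrac_false mi')]; rewrite -?xm;
    (try by apply/andP; split; lra); ring.
have mx : m < x by rewrite lt_neqAle xm.
exists (Num.min (x - m) (m + 1 - x)); first by rewrite lt_min; apply/andP; split; lra.
move=> d; rewrite lt_min !ltr_norml => /andP [/andP [d1 d2] /andP [d3 d4]].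
have E b z : m < z < m + 1 -> sfrac b z = z - m.
  by move=> /andP [z1 z2]; case: b; [apply: sfrac_true|apply: sfrac_false] => //; lra.
by rewrite !E; try (by apply/andP; split; lra); ring.
Qed.

(** For small c > 0 the sign of a + c b is lexicographic in (a, b). Every perturbation of a
    direction below relies on this. *)
Lemma sgn_near_right (a b : R) : (a != 0) || (b != 0) -> \forall c \near 0^'+,
  (a + c * b != 0) && ((0 < a + c * b) == (if a == 0 then 0 < b else 0 < a)).
Proof.
have [-> /=|a0 _] := eqVneq a 0 => [b0|].
  near=> c; have c0 : 0 < c by near: c; exact: nbhs_right_gt.
  have cb : c * b != 0 by rewrite mulf_neq0 // gt_eqF.
  by rewrite add0r cb pmulr_rgt0 /=.
near=> c.
have c0 : 0 < c by near: c; exact: nbhs_right_gt.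
have cb : c < `|a| / (`|b| + 1).
  by near: c; apply: nbhs_right_lt; rewrite divr_gt0 ?normr_gt0.
have lt : `|c * b| < `|a|.
  move: cb; rewrite ltr_pdivlMr ?ltr_wpDl // normrM (gtr0_norm c0) => h.
  by apply: le_lt_trans h; rewrite mulrDr mulr1; have := ltW c0; lra.
move: lt; rewrite ltr_norml => /andP [l1 l2].
have := a0; case: (ltrgt0P a) l1 l2 => // ha l1 l2 _.
  have h : 0 < a + c * b by lra.
  by rewrite h gt_eqF.
have h : a + c * b < 0 by lra.
by rewrite lt_eqF //= lt_gtF.
Unshelve. all: by end_near. Qed.


(** Dividing by C + 1 instead of C covers C = 0. *)
Lemma mul_div_succ_lt (C e : R) : 0 <= C -> 0 < e -> C * (e / (C + 1)) < e.
Proof.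
move=> C0 e0; rewrite mulrCA gtr_pMr // ltr_pdivrMr ?ltr_wpDl //.
by rewrite mul1r ltrDl.
Qed.

(** Factors are replaced one at a time; M >= 1 makes [M ^+ size s] a bound for every partial
    product. *)
Lemma prod_lip (I : Type) (s : seq I) (P : pred I) (a b : I -> R[i]) (M d : R) : 1 <= M -> 0 <= d ->
  (forall i, P i -> nc (a i) <= M) -> (forall i, P i -> nc (b i) <= M) ->
  (forall i, P i -> nc (a i - b i) <= d) ->
  nc (\prod_(i <- s | P i) a i) <= M ^+ size s /\
  nc (\prod_(i <- s | P i) a i - \prod_(i <- s | P i) b i) <= (size s)%:R * M ^+ size s * d.
Proof.
move=> M1 d0 aM bM ab; elim: s => [|i s [IH1 IH2]] /=.
  by rewrite !big_nil subrr nc1 nc0 !mul0r.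
have M0 : 0 <= M by lra.
have Ms : 0 <= M ^+ size s by exact: exprn_ge0.
rewrite !big_cons; case: ifP => Pi; last first.
  have le : M ^+ size s <= M ^+ (size s).+1 by rewrite exprS ler_peMl.
  split; first exact: le_trans le.
  apply: le_trans IH2 _; rewrite ler_wpM2r // ler_pM //; rewrite ?ler_nat //.
split; first by rewrite ncM exprS ler_pM ?nc_ge0 ?aM.
set A := \prod_(i <- s | P i) a i in IH1 IH2 *; set B := \prod_(i <- s | P i) b i in IH2 *.
have -> : a i * A - b i * B = (a i - b i) * A + b i * (A - B) by ring.
apply: le_trans (ncD _ _) _; rewrite !ncM.
have h1 : nc (a i - b i) * nc A <= d * M ^+ size s by rewrite ler_pM ?nc_ge0 ?ab.
have h2 : nc (b i) * nc (A - B) <= M * ((size s)%:R * M ^+ size s * d).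
  by rewrite ler_pM ?nc_ge0 ?bM.
apply: le_trans (lerD h1 h2) _; rewrite -natr1 exprS.
have : 0 <= d * M ^+ size s * (M - 1) by rewrite !mulr_ge0 // subr_ge0.
by set q := M ^+ size s; set k := _%:R; nra.
Qed.

Lemma cexp_factor_lip (z e : R[i]) : exists M L : R, [/\ 0 <= M, 0 <= L &
  forall u v : R, 0 <= u <= 1 -> 0 <= v <= 1 ->
    nc (cexp (z * u%:C) / e) <= M /\
    nc (cexp (z * u%:C) / e - cexp (z * v%:C) / e) <= L * `|u - v|].
Proof.
have [K K0 HK] := cexp_lip (nc_ge0 z).
exists (expR (nc z) / nc e), (K * nc z / nc e); split.
- by rewrite divr_ge0 ?expR_ge0 ?nc_ge0.
- by rewrite divr_ge0 ?mulr_ge0 ?nc_ge0.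
have bd (u : R) : 0 <= u <= 1 -> nc (z * u%:C) <= nc z.
  by move=> /andP [u0 u1]; rewrite ncM nc_real ger0_norm // ler_piMr ?nc_ge0.
move=> u v hu hv; split.
  rewrite ncM ncV ler_wpM2r ?invr_ge0 ?nc_ge0 //.
  by apply: le_trans (nc_cexp_le _) _; rewrite ler_expR bd.
rewrite -mulrBl ncM ncV -!mulrA [_^-1 * `|_|]mulrC !mulrA ler_wpM2r ?invr_ge0 ?nc_ge0 //.
apply: le_trans (HK _ _ (bd _ hu) (bd _ hv)) _.
by rewrite -mulrBr -rmorphB ncM nc_real mulrA.
Qed.

End SidedFractionalPart.

Section Continuity.
Context {R : realType} {r n : nat} (Lam : 'I_n -> 'rV[int]_r * R[i]).
Context (N : nat) (N_gt1 : (1 < N)%N) (N_clears : clears_den Lam N).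
Local Notation base := (is_base Lam).
Local Notation dv := (dualv Lam).
Implicit Types (B S : {set 'I_n}) (f g : 'I_n) (y phi : 'rV[R]_r).

(** The form in which genericity is used: phi enters Q only through the signs of these pairings. *)
Definition off_walls phi := forall B f, base B -> f \in B -> dot phi (dv B f) != 0.

Lemma bfracE phi y B f : bfrac Lam phi y B f = sfrac (0 < dot phi (dv B f)) (dot y (dv B f)).
Proof. by []. Qed.

Lemma bfrac_itv phi y B f : 0 <= bfrac Lam phi y B f <= 1.
Proof. by rewrite bfracE sfrac_ge0 sfrac_le1. Qed.

(** Fractional parts are the only discontinuous ingredient of Q. Directions and points may both
    differ, since a change of point will be traded for a change of direction. *)
Lemma Q_lip S tau : exists2 C : R, 0 <= C & forall phi1 phi2 y1 y2 (e : R), 0 <= e ->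
  (forall B f (w : 'rV['Z_N]_r), base B -> f \in B ->
    `|bfrac Lam phi1 (y1 + realv (Zv w)) B f - bfrac Lam phi2 (y2 + realv (Zv w)) B f| <= e) ->
  nc (Q Lam N S tau phi1 y1 - Q Lam N S tau phi2 y2) <= C * e.
Proof.
have [M HM] := choice (fun f => cexp_factor_lip (tau f) (cexp (tau f) - 1)).
have [L HL] := choice HM.
pose M1 := 1 + \sum_f M f; pose L1 := \sum_f L f.
have M0 f : 0 <= M f by have [] := HL f.
have L0 f : 0 <= L f by have [] := HL f.
have M1_ge1 : 1 <= M1 by rewrite lerDl sumr_ge0.
have MM f : M f <= M1.
  by rewrite /M1 (bigD1 f) //= addrCA lerDl addr_ge0 // sumr_ge0.
have LL f : L f <= L1 by rewrite /L1 (bigD1 f) //= lerDl sumr_ge0.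
have L1_ge0 : 0 <= L1 by rewrite sumr_ge0.
pose D B : R := nc (\prod_(g in S :\: B) (cden Lam tau B g)^-1).
pose K : R := n%:R * M1 ^+ n * L1.
have K0 : 0 <= K by rewrite !mulr_ge0 ?exprn_ge0 //; lra.
exists (\sum_(B : {set 'I_n}) D B * K).
  by rewrite sumr_ge0 // => B _; rewrite mulr_ge0 ?nc_ge0.
move=> phi1 phi2 y1 y2 e e0 H.
rewrite /Q -sumrB; apply: le_trans (nc_sum _ _ _) _; rewrite mulr_suml.
rewrite [X in _ <= X](bigID (fun B => base B && (B \subset S))) /= -[X in X <= _]addr0.
apply: lerD; last by apply: sumr_ge0 => B _; rewrite mulr_ge0 // mulr_ge0 // nc_ge0.
apply: ler_sum => B /andP [bB _]; rewrite -mulrBr ncM -mulrA ler_wpM2l ?nc_ge0 //.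
rewrite /mean -mulrBr -sumrB.
(* [mean_le] asks for a bound at all integer vectors, while the hypothesis covers the box only; the
   integrand is therefore replaced by 0 outside the box. *)
have E : (N ^ r)%:R^-1 * \sum_(w : 'rV['Z_N]_r)
    (bterm Lam tau phi1 y1 B (Zv w) - bterm Lam tau phi2 y2 B (Zv w))
  = mean N (fun w => if [exists v : 'rV['Z_N]_r, w == Zv v]
      then bterm Lam tau phi1 y1 B w - bterm Lam tau phi2 y2 B w else 0).
  congr (_ * _); apply: eq_bigr => w _.
  suff -> : [exists v : 'rV['Z_N]_r, Zv w == Zv v] by [].
  by apply/existsP; exists w.
rewrite E; apply: mean_le => // w0; case: ifP => [/existsP [w /eqP ->]|_]; last first.
  by rewrite nc0 mulr_ge0.
have -> : K * e = (size (index_enum 'I_n))%:R * M1 ^+ size (index_enum 'I_n) * (L1 * e).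
  by rewrite /index_enum -enumT -cardE card_ord /K -!mulrA.
apply: (prod_lip _ _ _ _ _ _).2 => //; rewrite ?mulr_ge0 // => f fB; have [_ _ Hf] := HL f.
- by apply: le_trans (Hf _ _ (bfrac_itv phi1 _ B f) (bfrac_itv phi1 _ B f)).1 _.
- by apply: le_trans (Hf _ _ (bfrac_itv phi2 _ B f) (bfrac_itv phi2 _ B f)).1 _.
- apply: le_trans (Hf _ _ (bfrac_itv phi1 _ B f) (bfrac_itv phi2 _ B f)).2 _.
  by rewrite ler_pM // H.
Qed.

Lemma dot_near (y0 v : 'rV[R]_r) (e : R) : 0 < e ->
  \forall y \near y0, `|dot (y - y0) v| < e.
Proof.
move=> e0; set K := \sum_(i < r) `|v 0 i|.
have K0 : 0 <= K by rewrite sumr_ge0.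
have d0 : 0 < e / (K + 1) by rewrite divr_gt0 // ltr_wpDl.
apply/nbhs_normP; exists (e / (K + 1)) => //= y; rewrite /ball_ /= distrC => h.
apply: le_lt_trans (dot_norm_le _ _) _; rewrite -/K.
move: h; rewrite ltr_pdivlMr ?ltr_wpDl // mulrDr mulr1.
by apply: le_lt_trans; rewrite lerDl.
Qed.

(** The displacement y - y0 selects the one-sided value at y0; phi decides only when the
    displacement is orthogonal to the dual vector. *)
Lemma bfrac_near phi y0 : \forall y \near y0, forall B f (w : 'rV['Z_N]_r),
  bfrac Lam phi (y + realv (Zv w)) B f =
  sfrac (if dot (y - y0) (dv B f) == 0 then 0 < dot phi (dv B f) else 0 < dot (y - y0) (dv B f))
    (dot (y0 + realv (Zv w)) (dv B f)) + dot (y - y0) (dv B f).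
Proof.
apply: nbhs_forall => B; apply: nbhs_forall => f; apply: nbhs_forall => w.
have [e e0 H] := sfrac_near (0 < dot phi (dv B f)) (dot (y0 + realv (Zv w)) (dv B f)).
apply: filterS (dot_near y0 (dv B f) e0) => y /H <-.
have -> : y + realv (Zv w) = y0 + realv (Zv w) + (y - y0) by rewrite [RHS]addrC addrA subrK.
by rewrite bfracE [in LHS]dotDl.
Qed.

(** The direction is v + c phi with c small: phi only breaks the ties left by v. *)
Lemma direction_towards phi v : off_walls phi -> exists2 phi', off_walls phi' &
  forall B f, base B -> f \in B -> (0 < dot phi' (dv B f)) =
    (if dot v (dv B f) == 0 then 0 < dot phi (dv B f) else 0 < dot v (dv B f)).
Proof.
move=> gphi.
have H : \forall c \near 0^'+, forall B f, base B -> f \in B ->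
    (dot (v + c *: phi) (dv B f) != 0) && ((0 < dot (v + c *: phi) (dv B f)) ==
     (if dot v (dv B f) == 0 then 0 < dot phi (dv B f) else 0 < dot v (dv B f))).
  apply: filter_forall => B; apply: filter_forall => f.
  have [bB|nb] := boolP (base B); last by near=> c.
  have [fB|nf] := boolP (f \in B); last by near=> c.
  have := @sgn_near_right R (dot v (dv B f)) (dot phi (dv B f)).
  rewrite gphi // orbT => /(_ isT); apply: filterS => c.
  by rewrite dotDl dotZl.
have [c Hc] := filter_ex H.
exists (v + c *: phi) => [B f bB fB|B f bB fB]; have /andP [] := Hc B f bB fB => //.
by move=> _ /eqP.
Unshelve. all: by end_near. Qed.

Lemma Q_right_continuous S tau phi y0 : off_walls phi ->
  (Q Lam N S tau phi (y0 + c *: phi) : R[i]^o) @[c --> 0^'+] --> (Q Lam N S tau phi y0 : R[i]^o).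
Proof.
move=> gphi; have [C C0 HC] := Q_lip S tau; apply/cvg_ncP => e e0.
have e1 : 0 < e / (C + 1) by rewrite divr_gt0 // ltr_wpDl.
have cv := @cvg_ray R r y0 phi.
have H1 : \forall c \near 0^'+, forall B f (w : 'rV['Z_N]_r),
    bfrac Lam phi (y0 + c *: phi + realv (Zv w)) B f =
    sfrac (if dot (y0 + c *: phi - y0) (dv B f) == 0 then 0 < dot phi (dv B f)
           else 0 < dot (y0 + c *: phi - y0) (dv B f))
      (dot (y0 + realv (Zv w)) (dv B f)) + dot (y0 + c *: phi - y0) (dv B f).
  exact: (cv _ (bfrac_near phi y0)).
have H2 : \forall c \near 0^'+, forall B f, `|dot (y0 + c *: phi - y0) (dv B f)| < e / (C + 1).
  by apply: filter_forall => B; apply: filter_forall => f; apply: (cv _ (dot_near _ _ e1)).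
apply: filterS (filterI (nbhs_right_gt 0) (filterI H1 H2)) => c [c0 [h1 h2]].
rewrite ncBC; apply: (@le_lt_trans _ _ (C * (e / (C + 1)))).
  apply: HC; first exact: ltW.
  move=> B f w bB fB; have d0 := gphi _ _ bB fB.
  have E : dot (y0 + c *: phi - y0) (dv B f) = c * dot phi (dv B f).
    by rewrite addrAC subrr add0r dotZl.
  rewrite h1 E bfracE mulf_eq0 (negbTE d0) gt_eqF //= pmulr_rgt0 // addrAC subrr add0r.
  by rewrite -E; apply/ltW/h2.
exact: mul_div_succ_lt.
Qed.

Lemma Q_continuous_at S tau phi y0 : off_walls phi ->
  (forall phi', off_walls phi' -> Q Lam N S tau phi' y0 = Q Lam N S tau phi y0) ->
  (Q Lam N S tau phi y : R[i]^o) @[y --> y0] --> (Q Lam N S tau phi y0 : R[i]^o).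
Proof.
move=> gphi ind; have [C C0 HC] := Q_lip S tau; apply: cvg_nc_at => e e0.
have e1 : 0 < e / (C + 1) by rewrite divr_gt0 // ltr_wpDl.
have H2 : \forall y \near y0, forall B f, `|dot (y - y0) (dv B f)| < e / (C + 1).
  by apply: nbhs_forall => B; apply: nbhs_forall => f; apply: (dot_near _ _ e1).
apply: filterS (filterI (bfrac_near phi y0) H2) => y [h1 h2].
(* The direction [phi'] varies with y; its independence at y0 is what ties all these values to one
   limit. *)
have [phi' gphi' sphi'] := direction_towards (y - y0) gphi.
rewrite ncBC -(ind _ gphi'); apply: (@le_lt_trans _ _ (C * (e / (C + 1)))).
  apply: HC; first exact: ltW.
  move=> B f w bB fB; rewrite h1 bfracE sphi' // addrAC subrr add0r.
  exact/ltW/h2.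
exact: mul_div_succ_lt.
Qed.

End Continuity.

(** * Independence of the direction *)

(** The constant 1 interpolated at the points p_f has degree at most #|Z| - 1, and the sum is, up to
    sign, its coefficient in that degree, which is positive. *)
Lemma lagrange_sum0 (F : fieldType) (I : finType) (Z : {set I}) (p : I -> F) :
  {in Z &, injective p} -> (1 < #|Z|)%N ->
  \sum_(f in Z) \prod_(g in Z :\ f) (p g - p f)^-1 = 0.
Proof.
move=> pI Z1; pose c f := \prod_(g in Z :\ f) (p g - p f)^-1.
pose L f : {poly F} := \prod_(g in Z :\ f) ((p g)%:P - 'X).
have szL f : f \in Z -> L f = (-1) ^+ #|Z|.-1 *: \prod_(g in Z :\ f) ('X - (p g)%:P).
  move=> fZ; rewrite -[(_ *: _)]mul_polyC rmorphXn rmorphN1.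
  have -> : #|Z|.-1 = #|Z :\ f| by rewrite (cardsD1 f Z) fZ.
  by rewrite -prodrN; apply: eq_bigr => g _; rewrite opprB.
have sz f : f \in Z -> size (\prod_(g in Z :\ f) ('X - (p g)%:P)) = #|Z|.
  by move=> fZ; rewrite -big_enum /= size_prod_XsubC -cardE (cardsD1 f Z) fZ.
pose P := \sum_(f in Z) c f *: L f - 1.
have P0 : P = 0.
  apply: (@roots_geq_poly_eq0 _ P [seq p f | f in Z]).
  - apply/allP => z /mapP [f]; rewrite mem_enum => fZ ->; rewrite /root /P !hornerE horner_sum (bigD1 f) //=.
    rewrite big1 ?addr0 => [|g /andP [gZ gf]]; last first.
      by rewrite hornerZ horner_prod (bigD1 f) ?inE ?fZ ?(eq_sym f) ?gf //= hornerD hornerN hornerC hornerX subrr mul0r mulr0.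
    rewrite hornerZ horner_prod -big_split /= big1 ?subrr // => g.
    rewrite !inE => /andP [gf gZ]; rewrite !hornerE mulVf // subr_eq0.
    by apply: contra gf => /eqP /pI ->.
  - by rewrite map_inj_in_uniq ?enum_uniq // => f g; rewrite !mem_enum; exact: pI.
  rewrite size_map -cardE; apply: leq_trans (size_polyD _ _) _.
  rewrite geq_max size_polyN size_poly1 (ltnW Z1) andbT.
  apply: leq_trans (size_sum _ _ _) _; apply/bigmax_leqP => f fZ.
  apply: leq_trans (size_scale_leq _ _) _; rewrite szL //.
  by apply: leq_trans (size_scale_leq _ _) _; rewrite sz.
have := congr1 (fun q : {poly F} => q`_(#|Z|.-1)) P0.
rewrite coef0 coefB coef1 /P.
have -> : (#|Z|.-1 == 0)%N = false by case: #|Z| Z1 => [|[|]].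
rewrite subr0 coef_sum => /eqP.
have -> : \sum_(f in Z) (c f *: L f)`_(#|Z|.-1) = (-1) ^+ #|Z|.-1 * \sum_(f in Z) c f.
  rewrite mulr_sumr; apply: eq_bigr => f fZ; rewrite coefZ szL // coefZ mulrCA; congr (_ * _).
  have /monicP := monic_prod_XsubC (index_enum I) (fun g => g \in Z :\ f) p.
  by rewrite /lead_coef sz // => ->; rewrite mulr1.
by rewrite mulf_eq0 signr_eq0 /= => /eqP.
Qed.

Section JumpPreliminaries.
Context {R : realType}.

Lemma sfrac_shift (s : bool) (x m : R) : m \is a Num.int -> sfrac s (x + m) = sfrac s x.
Proof.
move=> mi; case: s; rewrite /sfrac ?frac_shift //.
by rewrite (opprD x) frac_shift // rpredN.
Qed.

(** At an integer the two values are 0 and 1, and (1 - exp tau) / (exp tau - 1) = -1: the jump no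
    longer involves tau. *)
Lemma sfrac_jump (tau : R[i]) (q : R) : cexp tau - 1 != 0 ->
  (cexp (tau * (sfrac true q)%:C) - cexp (tau * (sfrac false q)%:C)) / (cexp tau - 1)
  = - (q \is a Num.int)%:R.
Proof.
move=> E0; have [qi|qi] := boolP (q \is a Num.int); last first.
  by rewrite (sfrac_notint true false qi) subrr mul0r oppr0.
rewrite (sfrac_true qi); last by rewrite lexx ltrDl ltr01.
rewrite (sfrac_false (m := q - 1)) ?rpredB ?rpred1 //; last by rewrite subrK lexx gtrDl ltrN10.
have -> : q - (q - 1) = 1 by ring.
by rewrite subrr mulr0 cexp0 mulr1 -[1 - _]opprB mulNr divff.
Qed.

(** Among l consecutive integers exactly one is divisible by l. Integrality conditions with
    different denominators are thereby reduced to a common one. *)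
Lemma int_split (q : R) (l : nat) : (0 < l)%N ->
  (q \is a Num.int)%:R = \sum_(i < l) ((q + i%:R) / l%:R \is a Num.int)%:R :> R[i].
Proof.
move=> l0; have lR : (l%:R : R) != 0 by rewrite pnatr_eq0 -lt0n.
have [/intrP [z ->]|qi] := boolP (q \is a Num.int); last first.
  rewrite big1 // => i _; suff -> : ((q + i%:R) / l%:R \is a Num.int) = false by [].
  apply: contraNF qi => /intrP [m h]; have -> : q = m%:~R * l%:R - i%:R by rewrite -h divfK // addrK.
  by rewrite rpredB ?rpredM ?rpred_nat ?intr_int.
have key (i : nat) : ((z%:~R + i%:R) / l%:R \is a @Num.int R) = (l%:Z %| z + i%:Z)%Z.
  apply/idP/idP => [/intrP [m h]|/dvdzP [m h]].
    apply/dvdzP; exists m; apply/eqP; rewrite -(@eqr_int R) intrD intrM -!pmulrn -h.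
    by rewrite divfK.
  have -> : z%:~R + i%:R = (m * l)%:~R :> R by rewrite -h intrD -pmulrn.
  by rewrite intrM -[l%:~R]pmulrn mulfK // intr_int.
pose j := `|((- z) %% l)%Z|%N.
have jE : j%:Z = ((- z) %% l)%Z by rewrite gez0_abs // modz_ge0 // -lt0n.
have jl : (j < l)%N by rewrite -ltz_nat jE ltz_pmod.
have dj : (l%:Z %| z + j%:Z)%Z.
  by rewrite jE -[z]opprK addrC -eqz_mod_dvd opprK modz_mod.
rewrite (bigD1 (Ordinal jl)) //= key dj big1 ?addr0 // => i ij.
rewrite key; case: (boolP (_ %| _)%Z) => // di.
have : (l%:Z %| (z + i%:Z) - (z + j%:Z))%Z by rewrite rpredB.
rewrite opprD addrACA subrr add0r -eqz_mod_dvd => /eqP.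
rewrite !modz_small ?ltz_nat ?ltn_ord //= => -[] e.
by case/eqP: ij; apply: val_inj.
Qed.

Lemma clears_mul (r n : nat) (Lam : 'I_n -> 'rV[int]_r * R[i]) M k :
  clears_den Lam M -> clears_den Lam (M * k).
Proof. by move=> H B f w bB fB; rewrite natrM mulrA rpredM ?rpred_nat // H. Qed.

End JumpPreliminaries.

(** * The jump of Q across one hyperplane *)

Section Jump.
Context {R : realType} {r n : nat} (Lam : 'I_n -> 'rV[int]_r * R[i]).
Context (N0 : nat) (N0_gt1 : (1 < N0)%N) (N0_clears : clears_den Lam N0).
Local Notation rv f := (realv (R := R) (vec Lam f)).
Local Notation base := (is_base Lam).
Local Notation dv := (dualv Lam).
Local Notation N := (N0 ^ 3)%N.
Implicit Types (B S : {set 'I_n}) (f g : 'I_n).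

(* One factor N0 clears the dual vectors, the other two clear the quotients of pairings
   that the jump lemma below compares. *)
Lemma cube_gt1 : (1 < N)%N.
Proof. by rewrite -(exp1n 3) ltn_exp2r. Qed.

Lemma cube_clears : clears_den Lam N.
Proof. by rewrite expnS; exact: clears_mul. Qed.

Definition nondegenerate (tau : 'I_n -> R[i]) := forall B, base B ->
  (forall g, g \notin B -> cden Lam tau B g != 0) /\
  (forall f, f \in B -> cexp (tau f) - 1 != 0).

(* Only a coloop [f] of [S] makes [Q] jump across the hyperplanes orthogonal to its dual vector. *)
Definition regular S (y : 'rV[R]_r) := forall B f, base B -> B \subset S -> f \in B ->
  (forall g, g \in S -> g != f -> dot (rv g) (dv B f) = 0) ->
  forall w : 'rV[int]_r, dot (y + realv w) (dv B f) \isn't a Num.int.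

Context (S : {set 'I_n}) (tau : 'I_n -> R[i]) (y phi0 phi1 phi2 : 'rV[R]_r).
Context (B0 : {set 'I_n}) (f0 : 'I_n) (bB0 : base B0) (f0B0 : f0 \in B0).
Context (tau_nd : nondegenerate tau) (y_reg : regular S y).

(** [eta] is normal to the hyperplane being crossed: phi0 lies on it, with phi1 and phi2 on its two
    sides. By the assumptions below, phi0 is orthogonal to no dual vectors but multiples of eta, and
    all other signs are common to the three directions. *)
Let eta := dv B0 f0.
Let c g := dot (rv g) eta.

Context (phi0_eta : dot phi0 eta = 0) (phi1_eta : 0 < dot phi1 eta) (phi2_eta : dot phi2 eta < 0).
Context (phi0_par : forall B f, base B -> f \in B -> dot phi0 (dv B f) = 0 ->
  exists a, dv B f = a *: eta).
Context (phi0_sg : forall B f, base B -> f \in B -> dot phi0 (dv B f) != 0 ->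
  (0 < dot phi1 (dv B f)) = (0 < dot phi0 (dv B f)) /\
  (0 < dot phi2 (dv B f)) = (0 < dot phi0 (dv B f))).

(** Pairing with [rv f] shows that 1 / c f is the only possible factor. *)
Let par B f := dv B f == (c f)^-1 *: eta.

Lemma par_neq0 B f : base B -> f \in B -> par B f -> c f != 0.
Proof.
move=> bB fB /eqP p; have := dualv_neq0 bB fB; rewrite p; apply: contra => /eqP ->.
by rewrite invr0 scale0r.
Qed.

Lemma phi0_eq0_par B f : base B -> f \in B -> dot phi0 (dv B f) = 0 -> par B f.
Proof.
move=> bB fB /(phi0_par bB fB) [a aE]; have := dualvP bB fB fB.
rewrite aE dotZr eqxx -/(c f) => h; rewrite /par aE.
have c0 : c f != 0 by apply: contra_eq_neq h => ->; rewrite mulr0 eq_sym oner_neq0.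
by apply/eqP; congr (_ *: _); apply: (mulIf c0); rewrite h mulVf.
Qed.

Lemma par_uniq B f h : base B -> f \in B -> h \in B -> h != f -> par B f -> c h = 0.
Proof.
move=> bB fB hB hf p; have := dualvP bB fB hB; rewrite (eqP p) dotZr (negbTE hf) -/(c h).
by move=> /eqP; rewrite mulf_eq0 invr_eq0 (negbTE (par_neq0 bB fB p)) => /eqP.
Qed.

(** Exchanging f0 for g in B0 gives a base with dual vector eta / c g, and this pairs with f0 to 1 /
    c g. *)
Lemma inv_c_int g : c g != 0 -> N0%:R / c g \is a Num.int.
Proof.
move=> cg; have [bB' dB' _] := base_exchange bB0 f0B0 cg.
have := N0_clears (vec Lam f0) bB' (setU11 _ _).
by rewrite dB' dotZr (dualvP bB0 f0B0 f0B0) eqxx mulr1 mulrC.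
Qed.

Let X h (s : bool) (q : R) : R[i] := cexp (tau h * (sfrac s q)%:C) / (cexp (tau h) - 1).
Let k (w : 'rV[int]_r) : R := dot (y + realv w) eta.

Let Phi B f (w : 'rV[int]_r) : R[i] :=
  \prod_(h in B :\ f) X h (0 < dot phi0 (dv B h)) (dot (y + realv w) (dv B h)).

Lemma not_par_sg B h : base B -> h \in B -> ~~ par B h ->
  (0 < dot phi1 (dv B h)) = (0 < dot phi0 (dv B h)) /\
  (0 < dot phi2 (dv B h)) = (0 < dot phi0 (dv B h)).
Proof.
move=> bB hB np; apply: phi0_sg => //; apply: contra np => /eqP.
exact: phi0_eq0_par.
Qed.

Lemma bterm_diff_none B w : base B -> (forall f, f \in B -> ~~ par B f) ->
  bterm Lam tau phi1 y B w = bterm Lam tau phi2 y B w.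
Proof.
move=> bB np; apply: eq_bigr => f fB; rewrite !bfracE.
by have [-> ->] := not_par_sg bB fB (np f fB).
Qed.

Lemma bterm_diff_par B f w : base B -> f \in B -> par B f ->
  bterm Lam tau phi1 y B w - bterm Lam tau phi2 y B w =
  - (Num.sg (c f))%:C * ((k w / c f \is a Num.int)%:R * Phi B f w).
Proof.
move=> bB fB p; have cf := par_neq0 bB fB p.
have E (phi : 'rV[R]_r) : (forall h, h \in B -> h != f -> (0 < dot phi (dv B h)) = (0 < dot phi0 (dv B h))) ->
    bterm Lam tau phi y B w = X f (0 < dot phi (dv B f)) (k w / c f) * Phi B f w.
  move=> H; rewrite /bterm (bigD1 f) //=; congr (_ * _).
    have kE : dot (y + realv w) (dv B f) = k w / c f by rewrite (eqP p) dotZr mulrC.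
    by rewrite bfracE /X kE.
  rewrite /Phi; apply: eq_big => [h|h /andP [hB hf]]; first by rewrite !inE andbC.
  by rewrite bfracE H.
have np h : h \in B -> h != f -> ~~ par B h.
  move=> hB hf; apply/negP => ph.
  by have := par_neq0 bB hB ph; rewrite (par_uniq bB fB hB hf p) eqxx.
rewrite !E; last first.
- by move=> h hB hf; have [] := not_par_sg bB hB (np _ hB hf).
- by move=> h hB hf; have [] := not_par_sg bB hB (np _ hB hf).
rewrite -mulrBl mulrA; congr (_ * _); rewrite /X -mulrBl.
have Ef : cexp (tau f) - 1 != 0 by have [_] := tau_nd bB; apply.
(* The sign of c f decides which of phi1 and phi2 takes the right-hand value; it survives as
   [Num.sg (c f)]. *)
rewrite (eqP p) !dotZr; case: (ltrgt0P (c f)) cf => // cf _.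
  rewrite gtr0_sg // !pmulr_rgt0 ?invr_gt0 // phi1_eta ltNge (ltW phi2_eta) /=.
  by rewrite sfrac_jump // rmorph1 mulN1r.
rewrite ltr0_sg // !nmulr_rgt0 ?invr_lt0 // phi2_eta ltNge (ltW phi1_eta) /=.
rewrite -[LHS]opprK -mulNr opprB sfrac_jump // opprK rmorphN1 opprK mul1r //.
Qed.

(** * Bases obtained by completing a fixed basis R' of the hyperplane orthogonal to eta *)

Section FixedFlat.
Context (R' : {set 'I_n}) (f1 : 'I_n) (f1R' : f1 \notin R').
Let B1 := f1 |: R'.
Context (bB1 : base B1) (p1 : par B1 f1).

Let f1B1 : f1 \in B1. Proof. exact: setU11. Qed.
Let B1D : B1 :\ f1 = R'. Proof. by rewrite setU1K. Qed.
Let c1 : c f1 != 0. Proof. exact: par_neq0 bB1 f1B1 p1. Qed.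

Lemma flat_c0 h : h \in R' -> c h = 0.
Proof.
move=> hR; apply: (par_uniq bB1 f1B1 _ _ p1); first by rewrite !inE hR orbT.
by apply: contraNneq f1R' => <-.
Qed.

(** Any f off the hyperplane may replace f1; the dual vectors of R' then change by multiples of eta
    only. *)
Lemma flat_exchange f : c f != 0 ->
  [/\ base (f |: R'), par (f |: R') f, f \notin R' &
    forall h, h \in R' -> dv (f |: R') h = dv B1 h - (dot (rv f) (dv B1 h) / c f) *: eta].
Proof.
move=> cf; have e : dot (rv f) (dv B1 f1) = c f / c f1.
  by rewrite (eqP p1) dotZr mulrC.
have e0 : dot (rv f) (dv B1 f1) != 0 by rewrite e mulf_neq0 // invr_neq0.
have [] := base_exchange bB1 f1B1 e0; rewrite B1D => bB df dh; split => //.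
- by rewrite /par df e (eqP p1) scalerA invf_div mulrAC divff // mul1r.
- by apply: contraNN cf => /flat_c0 ->.
move=> h hR; rewrite dh ?inE ?hR ?orbT //; last by apply: contraNneq f1R' => <-.
rewrite e (eqP p1) scalerA; congr (_ - _ *: _).
by field; rewrite c1 cf.
Qed.

Let x g := tau g - \sum_(h in R') tau h * (dot (rv g) (dv B1 h))%:C.

(** With p = x / c this is c g (p g - p f) when c g != 0, the shape of Lagrange's identity, and it
    does not depend on f when c g = 0. *)
Lemma flat_cden f g : c f != 0 ->
  cden Lam tau (f |: R') g = x g - (c g / c f)%:C * x f.
Proof.
move=> cf; have [bB pf fR dh] := flat_exchange cf.
rewrite /cden (big_setU1 _ fR) /= (eqP pf) dotZr -/(c g) [_^-1 * _]mulrC.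
have -> : \sum_(h in R') tau h * (dot (rv g) (dv (f |: R') h))%:C =
   \sum_(h in R') tau h * (dot (rv g) (dv B1 h))%:C
   - (c g / c f)%:C * \sum_(h in R') tau h * (dot (rv f) (dv B1 h))%:C.
  rewrite mulr_sumr -sumrB; apply: eq_bigr => h hR; rewrite dh // dotBr dotZr -/(c g).
  rewrite rmorphB !rmorphM /= fmorphV; ring.
rewrite /x; ring.
Qed.

Let Z := [set f in S | c f != 0].
Let L : R := (N0 ^ 2)%:R.
(** L = N0^2 is an integral multiple of every nonzero c f, so divisibility of k w by L is a
    condition common to all completions f. *)
Let hL f w : R[i] := (k w / L \is a Num.int)%:R * Phi (f |: R') f w.

Lemma PhiD f w : f \notin R' -> Phi (f |: R') f w =
  \prod_(h in R') X h (0 < dot phi0 (dv (f |: R') h)) (dot (y + realv w) (dv (f |: R') h)).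
Proof. by move=> fR; rewrite /Phi setU1K. Qed.

Lemma L_neq0 : L != 0.
Proof. by rewrite /L pnatr_eq0 -lt0n expn_gt0 ltnW. Qed.

(** Passing from f1 to f moves the pairings of y + w with the dual vectors of R' by <f, h*> k w / c
    f. This is an integer if L divides k w: one factor N0 clears <f, h*>, the other 1 / c f. The
    signs agree because phi0 is orthogonal to eta. *)
Lemma hL_indep f w : c f != 0 -> hL f w = hL f1 w.
Proof.
move=> cf; have [bB pf fR dh] := flat_exchange cf; rewrite /hL !PhiD //.
case: (boolP (_ \is a Num.int)) => [ki|]; last by rewrite !mul0r.
congr (_ * _); apply: eq_bigr => h hR; rewrite dh // !dotBr !dotZr phi0_eta mulr0 subr0.
congr (_ / _); congr (cexp (_ * _%:C)); rewrite -/B1; apply: sfrac_shift.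
suff : dot (rv f) (dv B1 h) / c f * k w \is a Num.int by rewrite rpredN.
have -> : dot (rv f) (dv B1 h) / c f * k w =
    (dot (rv f) (dv B1 h) * N0%:R) * (N0%:R / c f) * (k w / L).
  have n0 : (N0%:R : R) != 0 by rewrite pnatr_eq0 -lt0n ltnW.
  by rewrite /L natrX; field; rewrite n0 cf.
rewrite rpredM // rpredM ?inv_c_int //; apply: N0_clears => //.
by rewrite !inE hR orbT.
Qed.

(** Integrality of k w / c f splits into l = L / |c f| conditions, the i-th being divisibility by L
    after translating w by i f. Such translations do not affect Phi, and each of the l terms has the
    same mean. *)
Lemma flat_mean f : c f != 0 ->
  mean N (fun w => (k w / c f \is a Num.int)%:R * Phi (f |: R') f w) =
  (L / `|c f|)%:C * mean N (hL f1).
Proof.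
move=> cf; have [bB pf fR dh] := flat_exchange cf.
have n0 : (N0%:R : R) != 0 by rewrite pnatr_eq0 -lt0n ltnW.
have li : L / `|c f| \is a Num.int.
  have -> : L / `|c f| = N0%:R * (N0%:R * Num.sg (c f) / c f).
    rewrite /L natrX normrEsg;
    have s2 : Num.sg (c f) * Num.sg (c f) = 1 by rewrite -expr2 sqr_sg cf.
    have s0 : Num.sg (c f) != 0 by rewrite sgr_eq0.
    rewrite invfM -[X in X * _^-1](_ : Num.sg (c f) = (Num.sg (c f))^-1); first by ring.
    by apply: (mulIf s0); rewrite s2 mulVf.
  rewrite rpredM ?rpred_nat // mulrAC rpredM ?inv_c_int //.
  by case: sgrP => _; rewrite ?rpredN ?rpred0 ?rpred1.
have lpos : 0 < L / `|c f|.
  by rewrite divr_gt0 ?normr_gt0 // lt0r L_neq0 ler0n.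
have [l lE] : exists l : nat, L / `|c f| = l%:R.
  move: li => /intrP [z zE]; exists `|z|%N; rewrite zE; move: lpos; rewrite zE ltr0z.
  by case: z {zE} => // m _; rewrite -pmulrn.
have l0 : (0 < l)%N by rewrite -(@ltr0n R) -lE.
have LE : L = l%:R * `|c f| by rewrite -lE divfK // normr_eq0.
(* Adding N0^3 u to w moves k w / L by N0 <u, eta>, an integer. *)
have hper : box_periodic N (hL f).
  move=> w u; rewrite /hL !PhiD //; congr (_ * _).
    rewrite /k realvD addrA (dotDl (y + realv w)) mulrDl rpredDr //.
    rewrite realvZ dotZl /L -pmulrn !natrX.
    have -> : N0%:R ^+ 3 * dot (realv u) eta / N0%:R ^+ 2 = dot (realv u) eta * N0%:R.
      by field.
    exact: N0_clears.
  apply: eq_bigr => h hR; congr (_ / _); congr (cexp (_ * _%:C)).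
  rewrite realvD addrA (dotDl (y + realv w)); apply: sfrac_shift.
  rewrite realvZ dotZl mulrC -pmulrn; apply: cube_clears => //.
  by rewrite !inE hR orbT.
rewrite -(eq_mean N (fun w => hL_indep w cf)) lE.
have -> : mean N (fun w => (k w / c f \is a Num.int)%:R * Phi (f |: R') f w) =
  mean N (fun w => \sum_(i < l) hL f (w + (i%:Z *: vec Lam f))).
  apply: eq_mean => w; rewrite (int_split _ l0) mulr_suml; apply: eq_bigr => i _.
  rewrite /hL !PhiD //; congr (_%:R * _); last first.
    apply: eq_bigr => h hR; congr (_ / _); congr (cexp (_ * _%:C)).
    rewrite realvD addrA (dotDl (y + realv w)); apply/esym/sfrac_shift.
    rewrite realvZ dotZl (dualvP bB) ?inE ?eqxx ?hR ?orbT //.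
    have -> : (f == h) = false by apply: contraNF fR => /eqP ->.
    by rewrite mulr0 rpred0.
  rewrite /k realvD addrA (dotDl (y + realv w)) realvZ dotZl -/(c f) -pmulrn LE.
  have [cp|cn|c0] := ltrgt0P (c f); last by rewrite c0 eqxx in cf.
    congr (_ \is a _); field; rewrite cf /= pnatr_eq0 -lt0n l0 //.
  have -> : (dot (y + realv w) eta + i%:R * c f) / (l%:R * - c f) =
    - ((dot (y + realv w) eta / c f + i%:R) / l%:R).
    by field; rewrite cf pnatr_eq0 -lt0n l0.
  by rewrite rpredN.
rewrite mean_sum (eq_bigr (fun=> mean N (hL f))) => [|i _]; last first.
  exact: (mean_shift cube_gt1 (i%:Z *: vec Lam f) hper).
have -> : (l%:R : R)%:C = l%:R :> R[i] by rewrite -(rmorph_nat (real_complex R)).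
by rewrite sumr_const card_ord mulr_natl.
Qed.

Let G f : R[i] := (\prod_(g in S :\: (f |: R')) (cden Lam tau (f |: R') g)^-1) *
  mean N (fun w => - (Num.sg (c f))%:C *
    ((k w / c f \is a Num.int)%:R * Phi (f |: R') f w)).

Context (R'S : R' \subset S).

(** The terms share all factors but the Lagrange products: [kap] collects the denominators inside
    the hyperplane, and the sign of c f from the jump turns the |c f| of [flat_mean] into c f. *)
Lemma flat_sum0 : \sum_(f in Z) G f = 0.
Proof.
pose kap := \prod_(g in S :\: R' | c g == 0) (x g)^-1.
pose p g := x g / (c g)%:C.
have cZ g : g \in Z -> c g != 0 by rewrite inE => /andP [].
have cC g : g \in Z -> (c g)%:C != 0 :> R[i].
  by move=> /cZ; apply: contra => /eqP [/eqP].
have GE f : f \in Z -> G f = - kap * (L%:C * mean N (hL f1)) * (\prod_(g in Z) ((c g)%:C)^-1)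
     * \prod_(g in Z :\ f) (p g - p f)^-1.
  move=> fZ; have cf := cZ _ fZ; have [bB pf fR dh] := flat_exchange cf.
  rewrite /G meanMl flat_mean //.
  have -> : \prod_(g in S :\: (f |: R')) (cden Lam tau (f |: R') g)^-1 =
     kap * \prod_(g in Z :\ f) (cden Lam tau (f |: R') g)^-1.
    rewrite (bigID (fun g => c g == 0)) /=; congr (_ * _); last first.
      apply: eq_bigl => g; rewrite !inE negb_or.
      have [_|cg] := eqVneq (c g) 0; first by rewrite !andbF.
      rewrite !andbT; case: (boolP (g \in R')) => [/flat_c0 /eqP|]; first by rewrite (negbTE cg).
      by rewrite andbT.
    apply: eq_big => [g|g /andP [_ /eqP cg]]; last by rewrite flat_cden // cg mul0r mul0r subr0.
    rewrite !inE negb_or; have [cg|] := eqVneq (c g) 0; last by rewrite !andbF.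
    rewrite !andbT; have -> : g != f by apply: contraNneq cf => <-; rewrite cg.
    by rewrite andbC.
  have -> : \prod_(g in Z :\ f) (cden Lam tau (f |: R') g)^-1 =
     (\prod_(g in Z :\ f) ((c g)%:C)^-1) * \prod_(g in Z :\ f) (p g - p f)^-1.
    rewrite -big_split; apply: eq_bigr => g; rewrite !inE => /andP [gf gZ] /=.
    have gZ' : g \in Z by rewrite inE.
    rewrite -invfM flat_cden // /p; congr (_^-1); rewrite rmorphM fmorphV /=.
    by field; rewrite !cC.
  rewrite [in RHS](bigD1 f fZ) /=.
  have -> : \prod_(g in Z | g != f) ((c g)%:C)^-1 = \prod_(g in Z :\ f) ((c g)%:C)^-1.
    by apply: eq_bigl => g; rewrite !inE andbC.
  have -> : (L / `|c f|)%:C = L%:C * (Num.sg (c f))%:C / (c f)%:C.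
    rewrite -rmorphM -fmorphV -rmorphM /=; congr _%:C.
    have s2 : Num.sg (c f) * Num.sg (c f) = 1 by rewrite -expr2 sqr_sg cf.
    have s0 : Num.sg (c f) != 0 by rewrite sgr_eq0.
    rewrite normrEsg; apply: (mulIf cf); rewrite divfK // invfM mulrA mulrAC mulfK //.
    by apply: (mulIf s0); rewrite divfK // -mulrA s2 mulr1.
  have s2 : (Num.sg (c f))%:C * (Num.sg (c f))%:C = 1 :> R[i].
    by rewrite -rmorphM -expr2 sqr_sg cf /= rmorph1.
  set s := (Num.sg (c f))%:C in s2 *; set m := mean _ _; set q1 := \prod_(g in _) _; set q2 := \prod_(g in _) _.
  set d := (c f)%:C; set l := L%:C.
  have -> : kap * (q1 * q2) * (- s * (l * s / d * m)) =
    - (s * s) * (kap * (q1 * q2) * (l / d * m)) by ring.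
  rewrite s2; ring.
have [Z1|Z1] := ltnP 1 #|Z|.
  (* If p f = p g, the denominator of g with respect to f |: R' would vanish, against
     nondegeneracy. *)
  rewrite (eq_bigr _ GE) -mulr_sumr lagrange_sum0 ?mulr0 // => f g fZ gZ pfg.
  apply/eqP; apply: contraT => fg.
  have cf := cZ _ fZ; have [bB pf fR dh] := flat_exchange cf.
  have gB : g \notin f |: R'.
    rewrite !inE negb_or eq_sym fg /=; apply: contraNN (cZ _ gZ) => /flat_c0 ->; exact: eqxx.
  have [/(_ _ gB) + _] := tau_nd bB; rewrite flat_cden //.
  move: pfg; rewrite /p => pfg.
  have -> : x g = (c g / c f)%:C * x f.
    have e : x g = (c g)%:C * (x f / (c f)%:C) by rewrite pfg mulrC divfK ?cC.
    by rewrite [LHS]e rmorphM fmorphV /=; ring.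
  by rewrite subrr eqxx.
(* Here Z = {f}, so f is a coloop of S, and regularity of y keeps k w / c f away from the
   integers. *)
rewrite big1 // => f fZ; have cf := cZ _ fZ; have [bB pf fR dh] := flat_exchange cf.
have G0 : mean N (fun w => - (Num.sg (c f))%:C *
    ((k w / c f \is a Num.int)%:R * Phi (f |: R') f w)) = 0; last by rewrite /G G0 mulr0.
rewrite /mean big1 ?mulr0 // => w0 _; move: (Zv w0) => w; have fS : f \in S by move: fZ; rewrite inE => /andP [].
have sub : f |: R' \subset S by rewrite finset.subUset finset.sub1set fS.
have := y_reg bB sub (setU11 _ _) _ w; rewrite (eqP pf) !dotZr -/(k w).
have H g : g \in S -> g != f -> dot (rv g) ((c f)^-1 *: eta) = 0.
  move=> gS gf; rewrite dotZr -/(c g); apply/eqP; rewrite mulf_eq0; apply/orP; right.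
  apply: contraTT Z1 => cg; rewrite -ltnNge (cardsD1 f) fZ (cardsD1 g).
  by rewrite !inE gf gS cg.
by move=> /(_ H); rewrite mulrC => /negbTE ->; rewrite mul0r mulr0.
Qed.

(** The regrouping in [Q_jump] produces pairs (R', f) subject to the right-hand conditions; this
    identifies them with the index set of Lagrange's sum. *)
Lemma flat_mem f : f \in Z = [&& f \notin R', base (f |: R'), f |: R' \subset S & par (f |: R') f].
Proof.
rewrite inE; apply/andP/and4P => [[fS cf]|[fR bB sub pf]].
  have [bB pf fR _] := flat_exchange cf.
  by split => //; rewrite finset.subUset finset.sub1set fS.
split; first by move: sub; rewrite finset.subUset finset.sub1set => /andP [].
exact: par_neq0 bB (setU11 _ _) pf.
Qed.

End FixedFlat.

(** A base contributes only if one of its dual vectors, necessarily unique, is parallel to eta. The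
    pairs (B, f) so obtained are grouped by R' = B \ f, and each group sums to 0. *)
Lemma Q_jump : Q Lam N S tau phi1 y = Q Lam N S tau phi2 y.
Proof.
apply/eqP; rewrite -subr_eq0 /Q -sumrB; apply/eqP.
pose coef B := \prod_(g in S :\: B) (cden Lam tau B g)^-1.
pose D B f := coef B * mean N (fun w => - (Num.sg (c f))%:C *
    ((k w / c f \is a Num.int)%:R * Phi B f w)).
have E B : base B && (B \subset S) ->
  coef B * mean N (bterm Lam tau phi1 y B) - coef B * mean N (bterm Lam tau phi2 y B) =
  \sum_(f in B | par B f) D B f.
  move=> /andP [bB BS]; rewrite -mulrBr.
  have -> : mean N (bterm Lam tau phi1 y B) - mean N (bterm Lam tau phi2 y B) =
    mean N (fun w => bterm Lam tau phi1 y B w - bterm Lam tau phi2 y B w).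
    by rewrite /mean sumrB mulrBr.
  have [/existsP [f /andP [fB pf]]|/existsPn np] := boolP [exists f, (f \in B) && par B f].
    rewrite (bigD1 f) ?fB //= big1 ?addr0 => [|h /andP [/andP [hB ph] hf]]; last first.
      by have := par_neq0 bB hB ph; rewrite (par_uniq bB fB hB hf pf) eqxx.
    congr (_ * _); apply: eq_mean => w; exact: bterm_diff_par.
  have -> : mean N (fun w => bterm Lam tau phi1 y B w - bterm Lam tau phi2 y B w) = 0.
    rewrite /mean big1 ?mulr0 // => w _.
    by rewrite (bterm_diff_none _ bB) ?subrr // => f fB; have := np f; rewrite fB.
  rewrite mulr0.
  by rewrite big_pred0 // => f; have := np f; rewrite negb_and; case: (f \in B) => //= /negbTE.
rewrite (eq_bigr _ E) (exchange_big_dep predT) //=.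
pose qual (R' : {set 'I_n}) (f : 'I_n) := [&& f \notin R', base (f |: R'), f |: R' \subset S & par (f |: R') f].
rewrite (eq_bigr (fun f => \sum_(R' | qual R' f) D (f |: R') f)) => [|f _]; last first.
  rewrite (reindex_onto (fun R' => f |: R') (fun B => B :\ f)) /=; last first.
    by move=> B /andP [_ /andP [fB _]]; rewrite finset.setD1K.
  apply: eq_bigl => R'; rewrite /qual setU11 /=; have [fR|fR] := boolP (f \in R').
    rewrite (_ : (_ == R') = false) ?andbF //; apply/negP => /eqP e.
    by move: fR; rewrite -e !inE eqxx.
  by rewrite setU1K // eqxx andbT /= andbA.
rewrite (exchange_big_dep predT) //= big1 // => R' _.
have [/existsP [f1 q1]|/existsPn nq] := boolP [exists f, qual R' f]; last first.
  by rewrite big_pred0 // => f; apply/negbTE/nq.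
have /and4P [f1R bB1 sub p1] := q1.
have R'S : R' \subset S by move: sub; rewrite finset.subUset => /andP [].
rewrite -[RHS](flat_sum0 f1R bB1 p1 R'S); apply: eq_bigl => f.
by rewrite (flat_mem f1R bB1 p1 R'S).
Qed.

End Jump.

(** * Avoiding finitely many hyperplanes *)

Section AvoidHyperplanes.
Context {R : realType} {r : nat}.

Lemma near_seq (T : Type) (F : set_system T) {FF : Filter F} (I : eqType) (s : seq I)
    (P : I -> T -> Prop) :
  (forall i, i \in s -> \forall c \near F, P i c) ->
  \forall c \near F, forall i, i \in s -> P i c.
Proof.
elim: s => [|i s IH] H; first by apply: filterE.
have H1 := H i (mem_head _ _).
have H2 : \forall c \near F, forall j, j \in s -> P j c.
  by apply: IH => j js; apply: H; rewrite inE js orbT.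
by apply: filterS (filterI H1 H2) => c [h1 h2] j; rewrite inE => /predU1P [->|/h2].
Qed.

(** A small multiple of b added to u repairs <u, b> = 0, since <b, b> > 0, and spoils none of the
    earlier conditions. *)
Lemma avoid_hyperplanes (s : seq 'rV[R]_r) :
  exists u, forall b, b \in s -> b != 0 -> dot u b != 0.
Proof.
elim: s => [|b s [u Hu]]; first by exists 0.
have H : \forall c \near (0 : R)^'+, forall b', b' \in b :: s ->
    b' != 0 -> dot (u + c *: b) b' != 0.
  apply: near_seq => b'; rewrite inE => b's.
  have [->|b'0] := eqVneq b' 0; first by apply: filterE.
  have : (dot u b' != 0) || (dot b b' != 0).
    case/predU1P : b's => [e|/Hu -> //].
    by rewrite -e (gt_eqF (dot_self_gt0 b'0)) orbT.
  move=> /sgn_near_right; apply: filterS => c /andP [h _] _.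
  by rewrite dotDl dotZl.
by have [c Hc] := filter_ex H; exists (u + c *: b).
Qed.

(** A / (A - A') is the zero of the affine function running from A to A'. As s0 exceeds no zero
    inside (0, 1), the value at s0 is 0 or still has the sign of A. *)
Lemma crossing_sign (A A' s0 : R) : A != 0 -> A' != 0 -> 0 < s0 < 1 ->
  ((0 < A) != (0 < A') -> s0 <= A / (A - A')) ->
  (A + s0 * (A' - A) != 0 -> (0 < A + s0 * (A' - A)) = (0 < A)) /\
  (A + s0 * (A' - A) = 0 -> (0 < A) != (0 < A') /\ s0 = A / (A - A')).
Proof.
move=> A0 A'0 /andP [s1 s2].
have [Ap|An|e] := ltrgt0P A; last by rewrite e eqxx in A0.
  have [A'p|A'n|e] := ltrgt0P A'; last by rewrite e eqxx in A'0.
    have h : 0 < A + s0 * (A' - A) by nra.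
    by move=> _; rewrite h; split => // e; rewrite e ltxx in h.
  move=> /(_ isT); have d : 0 < A - A' by lra.
  rewrite ler_pdivlMr // => h; split=> [v0|v0].
    by apply/idP; rewrite lt_neqAle eq_sym v0 /=; lra.
  have d0 : A - A' != 0 by rewrite gt_eqF.
  by split=> //; apply: (mulIf d0); rewrite divfK //; lra.
have [A'p|A'n|e] := ltrgt0P A'; last by rewrite e eqxx in A'0.
  move=> /(_ isT); have d : A - A' < 0 by lra.
  rewrite ler_ndivlMr // => h; split=> [v0|v0].
    by apply/negbTE; rewrite -leNgt; lra.
  have d0 : A - A' != 0 by rewrite lt_eqF.
  by split=> //; apply: (mulIf d0); rewrite divfK //; lra.
have h : A + s0 * (A' - A) < 0 by nra.
by move=> _; rewrite lt_gtF //; split => // e; rewrite e ltxx in h.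
Qed.

End AvoidHyperplanes.

(** * Independence of the direction at a regular point *)

Section DirectionIndependence.
Context {R : realType} {r n : nat} (Lam : 'I_n -> 'rV[int]_r * R[i]).
Context (N0 : nat) (N0_gt1 : (1 < N0)%N) (N0_clears : clears_den Lam N0).
Local Notation base := (is_base Lam).
Local Notation dv := (dualv Lam).
Local Notation N := (N0 ^ 3)%N.
Local Notation QN := (Q Lam N).
Context (S : {set 'I_n}) (tau : 'I_n -> R[i]) (y : 'rV[R]_r).
Context (tau_nd : nondegenerate Lam tau) (y_reg : regular Lam S y).
Implicit Types (phi : 'rV[R]_r) (p q : {set 'I_n} * 'I_n).

Lemma Q_sign phi phi' :
  (forall B f, base B -> f \in B -> (0 < dot phi (dv B f)) = (0 < dot phi' (dv B f))) ->
  QN S tau phi y = QN S tau phi' y.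
Proof.
move=> H; apply: eq_bigr => B /andP [bB _]; congr (_ * _); apply: eq_mean => w.
by apply: eq_bigr => f fB; rewrite !bfracE H.
Qed.

Let okp p := base p.1 && (p.2 \in p.1).
Let a p := dv p.1 p.2.
Let diff phi phi' : {set {set 'I_n} * 'I_n} :=
  [set p | okp p && ((0 < dot phi (a p)) != (0 < dot phi' (a p)))]%SET.

(** The segment from phi to phi'' can meet the hyperplanes of p and q at the same parameter only if
    these products agree; a small perturbation of phi' excludes this unless the hyperplanes
    coincide. *)
Lemma generic_segment phi phi' : off_walls Lam phi -> off_walls Lam phi' ->
  exists phi'', [/\ off_walls Lam phi'',
    forall p, okp p -> (0 < dot phi'' (a p)) = (0 < dot phi' (a p)) &
    forall p q, okp p -> okp q ->
      dot phi (a q) * dot phi'' (a p) = dot phi (a p) * dot phi'' (a q) ->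
      dot phi (a q) *: a p = dot phi (a p) *: a q].
Proof.
move=> g g'; pose b (pq : ({set 'I_n} * 'I_n) * ({set 'I_n} * 'I_n)) :=
  dot phi (a pq.2) *: a pq.1 - dot phi (a pq.1) *: a pq.2.
have [u Hu] := avoid_hyperplanes [seq b pq | pq <- enum {: ({set 'I_n} * 'I_n) * ({set 'I_n} * 'I_n)}].
have H1 : \forall c \near (0 : R)^'+, forall p, okp p ->
   (dot (phi' + c *: u) (a p) != 0) && ((0 < dot (phi' + c *: u) (a p)) == (0 < dot phi' (a p))).
  apply: filter_forall => p; have [okP|nok] := boolP (okp p); last by apply: filterE.
  have a0 : dot phi' (a p) != 0 by case/andP : okP => ? ?; apply: g'.
  have := @sgn_near_right R (dot phi' (a p)) (dot u (a p)); rewrite a0 => /(_ isT).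
  by apply: filterS => c; rewrite (negbTE a0) dotDl dotZl.
have H2 : \forall c \near (0 : R)^'+, forall pq, b pq != 0 -> dot (phi' + c *: u) (b pq) != 0.
  apply: filter_forall => pq; have [->|b0] := eqVneq (b pq) 0; first by apply: filterE.
  have u0 : dot u (b pq) != 0 by apply: Hu => //; apply: map_f; rewrite mem_enum.
  have := @sgn_near_right R (dot phi' (b pq)) (dot u (b pq)); rewrite u0 orbT => /(_ isT).
  by apply: filterS => c /andP [h _] _; rewrite dotDl dotZl.
have [c [h1 h2]] := filter_ex (filterI H1 H2).
exists (phi' + c *: u); split.
- by move=> B f bB fB; have /andP [] := h1 (B, f) (introT andP (conj bB fB)).
- by move=> p /h1 /andP [_ /eqP].
move=> p q okP okQ e; apply/eqP; rewrite -subr_eq0 -/(b (p, q)).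
by apply: contraT => /h2; rewrite /b dotBr !dotZr e subrr eqxx.
Qed.

(** Induction on the number of dual vectors on which the directions differ in sign: cross the first
    hyperplane met by a generic segment, then continue from just behind it. *)
Lemma Q_phi_indep_rec m phi phi' : off_walls Lam phi -> off_walls Lam phi' ->
  (#|diff phi phi'| <= m)%N -> QN S tau phi y = QN S tau phi' y.
Proof.
elim: m phi phi' => [|m IH] phi phi' g g' le.
  apply: Q_sign => B f bB fB; have : (B, f) \notin diff phi phi'.
    by move: le; rewrite leqn0 cards_eq0 => /eqP ->; rewrite inE.
  by rewrite inE /okp /= bB fB /= negbK => /eqP.
have [D0|[p1 p1D]] := set_0Vmem (diff phi phi').
  by apply: IH => //; rewrite D0 cards0.
have [phi'' [g'' sg'' cross]] := generic_segment g g'.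
have E'' : QN S tau phi'' y = QN S tau phi' y.
  by apply: Q_sign => B f bB fB; apply: (sg'' (B, f)); rewrite /okp /= bB fB.
have dE : diff phi phi'' = diff phi phi'.
  by apply/setP => p; rewrite !inE; case: (boolP (okp p)) => //= /sg'' ->.
rewrite -E''.
pose A p := dot phi (a p); pose A' p := dot phi'' (a p).
pose st p := A p / (A p - A' p).
have A0 p : okp p -> A p != 0 by move=> /andP [? ?]; apply: g.
have A'0 p : okp p -> A' p != 0 by move=> /andP [? ?]; apply: g''.
have p1D' : p1 \in diff phi phi'' by rewrite dE.
case: (arg_minP st p1D') => p0 p0D' p0min; have p0D : p0 \in diff phi phi'' := p0D'.
have okp0 : okp p0 by move: p0D; rewrite inE => /andP [].
have dif0 : (0 < A p0) != (0 < A' p0) by move: p0D; rewrite inE => /andP [].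
have s0_itv : 0 < st p0 < 1.
  move: dif0; rewrite /st.
  have [Ap|An|e] := ltrgt0P (A p0); last by have := A0 _ okp0; rewrite e eqxx.
    have [A'p|A'n|e] := ltrgt0P (A' p0) => // _; last by have := A'0 _ okp0; rewrite e eqxx.
    have d : 0 < A p0 - A' p0 by lra.
    by rewrite divr_gt0 // ltr_pdivrMr // mul1r; lra.
  have [A'p _|//] := boolP (0 < A' p0).
  have d : A p0 - A' p0 < 0 by lra.
  by rewrite nmulr_rgt0 // invr_lt0 d ltr_ndivrMr // mul1r; lra.
set s0 := st p0 in s0_itv p0min.
have CS p : okp p -> (A p + s0 * (A' p - A p) != 0 -> (0 < A p + s0 * (A' p - A p)) = (0 < A p)) /\
  (A p + s0 * (A' p - A p) = 0 -> (0 < A p) != (0 < A' p) /\ s0 = st p).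
  move=> ok; apply: crossing_sign => //; rewrite ?A0 ?A'0 // => dif.
  by apply: p0min; suff : p \in diff phi phi'' by []; rewrite inE ok.
(* The minimal parameter s0 makes phi0 the first point of the segment on a separating hyperplane. *)
pose phi0 := phi + s0 *: (phi'' - phi).
have phi0E p : dot phi0 (a p) = A p + s0 * (A' p - A p) by rewrite dotDl dotZl dotBl.
have parE p : okp p -> dot phi0 (a p) = 0 -> exists k, a p = k *: a p0.
  move=> ok; rewrite phi0E => /(CS _ ok).2 [dif sE].
  have d0 q : okp q -> (0 < A q) != (0 < A' q) -> A q - A' q != 0.
    by move=> _; apply: contraNneq => /eqP; rewrite subr_eq0 => /eqP ->.
  have : A p0 * A' p = A p * A' p0.
    move: sE; rewrite /s0 /st => /eqP; rewrite eqr_div ?d0 // => /eqP h.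
    have : A p0 * (A p - A' p) - A p * (A p0 - A' p0) = 0 by rewrite h subrr.
    move=> h2; apply/eqP; rewrite -subr_eq0; apply/eqP; rewrite -[RHS]oppr0 -h2; ring.
  move=> /(cross p p0 ok okp0) h; exists (A p / A p0).
  by rewrite mulrC -scalerA -h scalerA mulVf ?A0 // scale1r.
have H : \forall c \near (0 : R)^'+, forall p, okp p ->
   (dot (phi0 + c *: (phi'' - phi)) (a p) != 0) &&
   ((0 < dot (phi0 + c *: (phi'' - phi)) (a p)) ==
     (if dot phi0 (a p) == 0 then 0 < A' p else 0 < A p)).
  apply: filter_forall => p; have [ok|nok] := boolP (okp p); last by apply: filterE.
  have : (dot phi0 (a p) != 0) || (dot (phi'' - phi) (a p) != 0).
    have [e|//] := eqVneq (dot phi0 (a p)) 0; rewrite /= dotBl -/(A p) -/(A' p).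
    have [dif _] := (CS _ ok).2 (etrans (esym (phi0E p)) e).
    by apply: contraNneq dif => /eqP; rewrite subr_eq0 => /eqP ->.
  move=> /sgn_near_right; apply: filterS => c; rewrite (dotDl phi0) dotZl => /andP [h1 /eqP h2] _.
  rewrite h1 h2 /=; case: (eqVneq (dot phi0 (a p)) 0) => [e|ne]; last first.
    by rewrite phi0E in ne *; rewrite (CS _ ok).1.
  have [dif _] := (CS _ ok).2 (etrans (esym (phi0E p)) e).
  rewrite dotBl -/(A p) -/(A' p); move: dif.
  have [Ap|An|e1] := ltrgt0P (A p); last by have := A0 _ ok; rewrite e1 eqxx.
    have [A'p|A'n|e1] := ltrgt0P (A' p) => // _; last by have := A'0 _ ok; rewrite e1 eqxx.
    by apply/eqP/negbTE; rewrite -leNgt; lra.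
  have [A'p _|//] := boolP (0 < A' p).
  by apply/eqP; lra.
(* [phi1] lies just behind phi0: it has the signs of phi'' on dual vectors orthogonal to phi0, and
   those of phi on all others. *)
have [c Hc] := filter_ex H; set phi1 := phi0 + c *: (phi'' - phi) in Hc.
have g1 : off_walls Lam phi1.
  by move=> B f bB fB; have /andP [] := Hc (B, f) (introT andP (conj bB fB)).
have sg1 p : okp p -> (0 < dot phi1 (a p)) = (if dot phi0 (a p) == 0 then 0 < A' p else 0 < A p).
  by move=> /Hc /andP [_ /eqP].
have phi0p0 : dot phi0 (a p0) = 0.
  rewrite phi0E /s0 /st; have d0 : A p0 - A' p0 != 0.
    by apply: contraNneq dif0 => /eqP; rewrite subr_eq0 => /eqP ->.
  by field.
have sg1p0 : (0 < dot phi1 (a p0)) = (0 < A' p0) by rewrite sg1 // phi0p0 eqxx.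
have [bB0 f0B0] := andP okp0.
have par0 B f : base B -> f \in B -> dot phi0 (dv B f) = 0 -> exists k, dv B f = k *: dv p0.1 p0.2.
  by move=> bB fB e; apply: (parE (B, f)); rewrite /okp /= ?bB.
have sgB B f : base B -> f \in B -> dot phi0 (dv B f) != 0 ->
  (0 < dot phi1 (dv B f)) = (0 < dot phi0 (dv B f)) /\ (0 < dot phi (dv B f)) = (0 < dot phi0 (dv B f)).
  move=> bB fB ne; have ok : okp (B, f) by rewrite /okp /= bB.
  have := sg1 _ ok; rewrite /a /= (negbTE ne) => ->.
  have := (CS _ ok).1; rewrite -phi0E => /(_ ne) ->; split=> //.
transitivity (QN S tau phi1 y).
  have [Ap|An|e] := ltrgt0P (A p0); last by have := A0 _ okp0; rewrite e eqxx.
    apply: (@Q_jump _ _ _ _ _ N0_gt1 N0_clears S tau y phi0 phi phi1 p0.1 p0.2) => //.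
      have : ~~ (0 < dot phi1 (a p0)) by rewrite sg1p0; move: dif0; rewrite Ap; case: (0 < A' p0).
      by rewrite -leNgt lt_neqAle => ->; rewrite andbT; apply: (g1 p0.1 p0.2).
    by move=> B f bB fB ne; have [] := sgB B f bB fB ne.
  apply/esym; apply: (@Q_jump _ _ _ _ _ N0_gt1 N0_clears S tau y phi0 phi1 phi p0.1 p0.2) => //.
  by rewrite -/(a p0) sg1p0; move: dif0; rewrite (lt_gtF An); case: (0 < A' p0).
(* [phi1] differs from phi'' only where phi does, and no longer at p0. *)
apply: IH => //; rewrite -ltnS; apply: leq_trans le; rewrite -dE; apply: proper_card.
apply/properP; split.
  apply/fintype.subsetP => p; rewrite !inE => /andP [ok]; rewrite ok sg1 //=.
  by have [_|//] := eqVneq (dot phi0 (a p)) 0; rewrite /A' eqxx.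
by exists p0 => //; rewrite inE negb_and negbK sg1p0 eqxx orbT.
Qed.

Lemma Q_phi_indep phi phi' : off_walls Lam phi -> off_walls Lam phi' ->
  QN S tau phi y = QN S tau phi' y.
Proof. by move=> g g'; exact: Q_phi_indep_rec (leqnn _). Qed.

End DirectionIndependence.

(** * Holomorphy near the origin *)

(** An l^1 norm with real values; the norm of the normed module takes its values in R[i]. *)
Definition nv (R : realType) (n : nat) (t : 'rV[R[i]^o]_n) : R := \sum_i nc (t 0 i).
Arguments nv {R n} t : simpl never.

Section VectorModulus.
Context {R : realType} {n : nat}.
Implicit Types (t s : 'rV[R[i]^o]_n).

Lemma nv_ge0 t : 0 <= nv t.
Proof. by apply: sumr_ge0 => i _; exact: nc_ge0. Qed.

Lemma nc_le_nv t i : nc (t 0 i) <= nv t.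
Proof. by rewrite /nv (bigD1 i) //= lerDl sumr_ge0 // => j _; exact: nc_ge0. Qed.

Lemma nvB t s : nv (t - s) <= nv t + nv s.
Proof.
rewrite /nv -big_split; apply: ler_sum => i _; rewrite /= !mxE.
exact: (ncB (t 0 i) (s 0 i)).
Qed.

Lemma nvD t s : nv (t + s) <= nv t + nv s.
Proof.
rewrite /nv -big_split; apply: ler_sum => i _; rewrite /= !mxE.
exact: (ncD (t 0 i) (s 0 i)).
Qed.

Lemma nv0 : nv (0 : 'rV[R[i]^o]_n) = 0.
Proof. by rewrite /nv big1 // => i _; rewrite mxE; exact: nc0. Qed.

Lemma nc_le_norm t i : nc (t 0 i) <= Re `|t|.
Proof.
have : `|t 0 i| <= `|t|.
  by rewrite [ `|t| ]mx_normE -[X in X <= _]nngE num_le; exact: (le_bigmax _ _ (0, i)).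
by rewrite lecE => /andP [_].
Qed.

Lemma nv_le_norm t : nv t <= n%:R * Re `|t|.
Proof.
apply: le_trans (ler_sum _ (fun i _ => nc_le_norm t i)) _.
by rewrite sumr_const card_ord mulr_natl.
Qed.

Lemma near_nv_lt t (e : R) : 0 < e -> \forall s \near t, nv (s - t) < e.
Proof.
move=> e0; have d0 : 0 < e / (n%:R + 1) by rewrite divr_gt0 // ltr_wpDl.
have d0' : 0 < (e / (n%:R + 1))%:C :> R[i] by rewrite ltcE /= eqxx.
apply/nbhs_normP; exists (e / (n%:R + 1))%:C => //= s; rewrite /ball_ /= distrC.
rewrite ltcE => /andP [_] /= h; apply: le_lt_trans (nv_le_norm _) _.
have : 0 <= Re `|s - t|.
  by have := normr_ge0 (s - t); rewrite lecE => /andP [_].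
move: h; rewrite ltr_pdivlMr ?ltr_wpDl //; lra.
Qed.

End VectorModulus.

Lemma cvg_sumC (R : realType) (T : Type) (F : set_system T) {FF : Filter F} (I : Type)
    (s : seq I) (u : I -> T -> R[i]) (l : I -> R[i]) :
  (forall i, (u i x : R[i]^o) @[x --> F] --> (l i : R[i]^o)) ->
  (\sum_(i <- s) u i x : R[i]^o) @[x --> F] --> (\sum_(i <- s) l i : R[i]^o).
Proof.
move=> H; elim: s => [|i s IH].
  rewrite big_nil (_ : (fun x => _) = fun=> 0); first exact: cvg_cst.
  by apply/funext => x; rewrite big_nil.
apply/cvg_ncP => e e0; have e2 : 0 < e / 2 by rewrite divr_gt0.
move/cvg_ncP : (H i) => /(_ _ e2) h1; move/cvg_ncP : IH => /(_ _ e2) h2.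
apply: filterS (filterI h1 h2) => x [k1 k2]; rewrite !big_cons.
have -> : l i + \sum_(j <- s) l j - (u i x + \sum_(j <- s) u j x) =
  (l i - u i x) + (\sum_(j <- s) l j - \sum_(j <- s) u j x) by ring.
apply: le_lt_trans (ncD _ _) _; lra.
Qed.

(** * Functions with uniform quadratic Taylor remainders *)

Section QuadraticClass.
Context {R : realType} {n : nat} (rho : R).
Local Notation T := 'rV[R[i]^o]_n.
Implicit Types (t s : T) (H : T -> R[i]).

(* A quantitative form of holomorphy that survives pointwise limits: no uniform
   convergence of derivatives is needed when the constant is common. *)
Definition K2 (C : R) H : Prop :=
  (forall t, nv t <= rho -> nc (H t) <= C) /\
  (forall t, nv t <= rho -> exists a : 'I_n -> R[i], (forall i, nc (a i) <= C) /\
    forall s, nv s <= rho ->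
      nc (H s - H t - \sum_i a i * (s 0 i - t 0 i)) <= C * nv (s - t) ^+ 2).

Definition K2fam (I : Type) (P : I -> Prop) (H : I -> T -> R[i]) :=
  exists2 C : R, 0 <= C & forall i, P i -> K2 C (H i).

Lemma K2_mono C C' H : C <= C' -> K2 C H -> K2 C' H.
Proof.
move=> CC [h1 h2]; split=> [t /h1 /le_trans|t /h2 [a [a1 a2]]]; first exact.
exists a; split=> [i|s /a2 /le_trans]; first exact: le_trans (a1 i) CC.
by apply; rewrite ler_wpM2r // sqr_ge0.
Qed.

Lemma K2_ext C H H' : (forall t, nv t <= rho -> H t = H' t) -> K2 C H -> K2 C H'.
Proof.
move=> e [h1 h2]; split=> [t tr|t tr]; first by rewrite -e // h1.
have [a [a1 a2]] := h2 t tr; exists a; split=> // s sr.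
by rewrite -!e // a2.
Qed.

Lemma nc_lin (a : 'I_n -> R[i]) (d : T) (C : R) : (forall i, nc (a i) <= C) ->
  nc (\sum_i a i * d 0 i) <= C * nv d.
Proof.
move=> aC; apply: le_trans (nc_sum _ _ _) _; rewrite /nv mulr_sumr; apply: ler_sum => i _.
by rewrite ncM ler_wpM2r // nc_ge0.
Qed.

Lemma sum_sub_lin (a : 'I_n -> R[i]) s t :
  \sum_i a i * (s 0 i - t 0 i) = \sum_i a i * ((s - t) 0 i).
Proof. by apply: eq_bigr => i _; rewrite !mxE. Qed.

Lemma K2_lip C H t s (a : 'I_n -> R[i]) : 0 <= C -> nv t <= rho -> nv s <= rho ->
  (forall i, nc (a i) <= C) ->
  nc (H s - H t - \sum_i a i * (s 0 i - t 0 i)) <= C * nv (s - t) ^+ 2 ->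
  nc (H s - H t) <= C * (1 + (rho + rho)) * nv (s - t).
Proof.
move=> C0 tr sr aC h; set L := \sum_i _ in h.
have LL : nc L <= C * nv (s - t) by rewrite /L sum_sub_lin; exact: nc_lin.
have -> : H s - H t = (H s - H t - L) + L by rewrite subrK.
apply: le_trans (ncD _ _) _; apply: le_trans (lerD h LL) _.
have d1 : nv (s - t) <= rho + rho by apply: le_trans (nvB _ _) _; exact: lerD.
have d0 := nv_ge0 (s - t); move: d0 d1; set d := nv _ => d0 d1.
have : C * (d * d) <= C * ((rho + rho) * d) by rewrite ler_wpM2l // ler_wpM2r.
by rewrite expr2; lra.
Qed.

Lemma K2fam_const (I : Type) (P : I -> Prop) (c : R[i]) : K2fam P (fun _ _ => c).
Proof.
exists (nc c); first exact: nc_ge0.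
move=> i _; split=> // t tr; exists (fun=> 0); split=> [j|s sr]; first by rewrite nc0 nc_ge0.
rewrite subrr sub0r big1 ?oppr0 ?nc0 => [|j _]; last by rewrite mul0r.
by apply: mulr_ge0; [exact: nc_ge0|exact: sqr_ge0].
Qed.

Lemma K2fam_mul (I : Type) (P : I -> Prop) (H H' : I -> T -> R[i]) :
  K2fam P H -> K2fam P H' -> K2fam P (fun i t => H i t * H' i t).
Proof.
move=> [C1 C10 h1] [C2 C20 h2]; pose C := C1 + C2.
have C0 : 0 <= C by exact: addr_ge0.
have HC i : P i -> K2 C (H i) by move=> /h1; apply: K2_mono; rewrite lerDl.
have HC' i : P i -> K2 C (H' i) by move=> /h2; apply: K2_mono; rewrite lerDr.
pose M := 1 + (rho + rho).
have CC : 0 <= C * C by exact: mulr_ge0.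
have MM : 0 <= C * C * (M * M) by apply: mulr_ge0 => //; rewrite -expr2 sqr_ge0.
exists (C * C * 2 + C * C * (M * M)); first by apply: addr_ge0 => //; apply: mulr_ge0.
move=> i Pi; have [b1 d1] := HC i Pi; have [b2 d2] := HC' i Pi; split=> [t tr|t tr].
  rewrite ncM; apply: le_trans (ler_pM (nc_ge0 _) (nc_ge0 _) (b1 t tr) (b2 t tr)) _; lra.
have [a [aC ha]] := d1 t tr; have [a' [aC' ha']] := d2 t tr.
exists (fun j => a j * H' i t + a' j * H i t); split=> [j|s sr].
  apply: le_trans (ncD _ _) _; rewrite !ncM.
  have := ler_pM (nc_ge0 _) (nc_ge0 _) (aC j) (b2 t tr).
  have := ler_pM (nc_ge0 _) (nc_ge0 _) (aC' j) (b1 t tr); lra.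
have l1 := K2_lip C0 tr sr aC (ha s sr); have l2 := K2_lip C0 tr sr aC' (ha' s sr).
move: (ha s sr) (ha' s sr).
have -> : \sum_j (a j * H' i t + a' j * H i t) * (s 0 j - t 0 j) =
  (\sum_j a j * (s 0 j - t 0 j)) * H' i t + (\sum_j a' j * (s 0 j - t 0 j)) * H i t.
  by rewrite !mulr_suml -big_split; apply: eq_bigr => j _ /=; ring.
set S1 := \sum_j _; set S2 := \sum_j _; set D := nv (s - t) in l1 l2 * => e1 e2.
have -> : H i s * H' i s - H i t * H' i t - (S1 * H' i t + S2 * H i t) =
  (H i s - H i t - S1) * H' i t + (H' i s - H' i t - S2) * H i t
  + (H i s - H i t) * (H' i s - H' i t) by ring.
apply: le_trans (ncD _ _) _; apply: le_trans (lerD (ncD _ _) (lexx _)) _; rewrite !ncM.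
have p1 := ler_pM (nc_ge0 _) (nc_ge0 _) e1 (b2 t tr).
have p2 := ler_pM (nc_ge0 _) (nc_ge0 _) e2 (b1 t tr).
have p3 := ler_pM (nc_ge0 _) (nc_ge0 _) l1 l2.
apply: le_trans (lerD (lerD p1 p2) p3) _; rewrite le_eqVlt; apply/orP; left; apply/eqP.
by rewrite /M; ring.
Qed.

Lemma K2fam_prod (I J : Type) (P : I -> Prop) (s : seq J) (Pj : pred J) (H : J -> I -> T -> R[i]) :
  (forall j, K2fam P (H j)) -> K2fam P (fun i t => \prod_(j <- s | Pj j) H j i t).
Proof.
move=> HH; elim: s => [|j s [C C0 IH]].
  have [C C0 h] := K2fam_const P 1; exists C => // i /h; apply: K2_ext => t _.
  by rewrite big_nil.
case Pjj : (Pj j).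
  have [C' C'0 h] := K2fam_mul (HH j) (ex_intro2 _ _ C C0 IH).
  by exists C' => // i /h; apply: K2_ext => t _; rewrite big_cons Pjj.
by exists C => // i /IH; apply: K2_ext => t _; rewrite big_cons Pjj.
Qed.

(** The constant does not grow with the number of terms, so Riemann sums of any mesh stay in one
    class. *)
Lemma K2_avg (J : finType) (H : J -> T -> R[i]) C : (0 < #|J|)%N -> 0 <= C ->
  (forall j, K2 C (H j)) -> K2 C (fun t => #|J|%:R^-1 * \sum_j H j t).
Proof.
move=> J0 C0 HH; have avg := fun F c => @nc_avg R J F c J0.
split=> [t tr|t tr]; first by apply: avg => j; have [h _] := HH j; exact: h.
have [a Ha] := choice (fun j => (HH j).2 t tr).
exists (fun i => #|J|%:R^-1 * \sum_j a j i); split=> [i|s sr].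
  by apply: avg => j; have [] := Ha j.
have -> : \sum_i #|J|%:R^-1 * (\sum_j a j i) * (s 0 i - t 0 i) =
  #|J|%:R^-1 * \sum_j \sum_i a j i * (s 0 i - t 0 i).
  rewrite exchange_big mulr_sumr; apply: eq_bigr => i _.
  by rewrite -mulrA mulr_suml.
rewrite -!mulrBr -!sumrB; apply: avg => j; have [_ h] := Ha j; exact: h.
Qed.

Lemma K2fam_cexp (I : Type) (P : I -> Prop) (f : 'I_n) (b : R[i]) (u : I -> R) : 0 <= rho ->
  (forall i, P i -> 0 <= u i <= 1) ->
  K2fam P (fun i t => cexp ((t 0 f - b) * (u i)%:C)).
Proof.
move=> rho0 uP; have rr : 0 <= rho + rho by exact: addr_ge0.
have [K K0 HK] := cexp_taylor1 rr.
pose M := expR (rho + nc b); have M0 : 0 < M by exact: expR_gt0.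
exists (M + M * K); first by rewrite addr_ge0 ?mulr_ge0 // ltW.
move=> i /uP /andP [u0 u1]; set v := (u i)%:C.
have vE : nc v = u i by rewrite /v nc_real ger0_norm.
have bd t : nv t <= rho -> nc (cexp ((t 0 f - b) * v)) <= M.
  move=> tr; apply: le_trans (nc_cexp_le _) _; rewrite ler_expR ncM vE.
  apply: (@le_trans _ _ (nc (t 0 f - b))); first by rewrite ler_piMr ?nc_ge0.
  by apply: le_trans (ncB _ _) _; rewrite lerD2r; exact: le_trans (nc_le_nv _ _) tr.
have MK : 0 <= M * K by rewrite mulr_ge0 // ltW.
split=> [t /bd /le_trans|t tr]; first by apply; rewrite lerDl.
exists (fun j => if j == f then cexp ((t 0 f - b) * v) * v else 0); split=> [j|s sr].
  case: ifP => _; last by rewrite nc0 addr_ge0 // ltW.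
  rewrite ncM vE; apply: le_trans (ler_pM (nc_ge0 _) u0 (bd t tr) u1) _; lra.
rewrite (bigD1 f) //= eqxx big1 ?addr0 => [|j /negbTE ->]; last by rewrite mul0r.
set d := s 0 f - t 0 f.
have dE : nc d <= nv (s - t) by have := nc_le_nv (s - t) f; rewrite !mxE.
have dr : nc d <= rho + rho.
  by apply: le_trans dE _; apply: le_trans (nvB _ _) _; exact: lerD.
have -> : cexp ((s 0 f - b) * v) - cexp ((t 0 f - b) * v) - cexp ((t 0 f - b) * v) * v * d =
  cexp ((t 0 f - b) * v) * (cexp (d * v) - 1 - d * v).
  have -> : cexp ((s 0 f - b) * v) = cexp ((t 0 f - b) * v) * cexp (d * v).
    by rewrite -cexpD; congr cexp; rewrite /d; ring.
  by ring.
have dv : nc (d * v) <= nc d by rewrite ncM vE ler_piMr ?nc_ge0.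
rewrite ncM; apply: le_trans (ler_pM (nc_ge0 _) (nc_ge0 _) (bd t tr) (HK _ (le_trans dv dr))) _.
have : nc (d * v) ^+ 2 <= nv (s - t) ^+ 2.
  by rewrite lerXn2r ?nnegrE ?nc_ge0 ?nv_ge0 //; exact: le_trans dE.
move=> /(ler_wpM2l MK) h; rewrite mulrA; apply: le_trans h _.
by rewrite ler_wpM2r ?sqr_ge0 // lerDr ltW.
Qed.

(** Values and first-order coefficients are bounded by C, hence converge along U, and the
    inequalities pass to the limit. The ultrafilter removes the need to extract subsequences for
    each t. *)
Lemma K2_ultra (U : set_system nat) (UU : UltraFilter U) (H : nat -> T -> R[i]) C :
  (forall k, K2 C (H k)) -> exists2 G : T -> R[i], K2 C G &
  forall t, nv t <= rho -> (H k t : R[i]^o) @[k --> U] --> (G t : R[i]^o).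
Proof.
move=> HH; have PU := @ultra_proper _ _ UU.
have HG t : exists g : R[i], nv t <= rho -> (H k t : R[i]^o) @[k --> U] --> (g : R[i]^o).
  have [tr|_] := boolP (nv t <= rho); last by exists 0.
  have [|g hg] := @ultra_cvg R nat U UU (fun k => H k t) C; last by exists g.
  by move=> k; have [h _] := HH k; exact: h.
have [G GP] := choice HG; exists G => //; split=> [t tr|t tr].
  by apply: (cvg_nc_le (GP t tr)); apply: filterE => k; have [h _] := HH k; exact: h.
have [a Ha] := choice (fun k => (HH k).2 t tr).
have Hl i : exists l : R[i], (a k i : R[i]^o) @[k --> U] --> (l : R[i]^o).
  by apply: (@ultra_cvg R nat U UU _ C) => k; have [] := Ha k.
have [l lP] := choice Hl; exists l; split=> [i|s sr].
  by apply: (cvg_nc_le (lP i)); apply: filterE => k; have [] := Ha k.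
have cv : (H k s - H k t - \sum_i a k i * (s 0 i - t 0 i) : R[i]^o) @[k --> U] -->
    (G s - G t - \sum_i l i * (s 0 i - t 0 i) : R[i]^o).
  apply: cvgB; first by apply: cvgB; exact: GP.
  apply: (@cvg_sumC R nat U _ 'I_n (index_enum _) (fun i k => a k i * (s 0 i - t 0 i))) => i.
  by apply: cvgM; [exact: lP|exact: cvg_cst].
by apply: (cvg_nc_le cv); apply: filterE => k; have [_ h] := Ha k; exact: h.
Qed.

Lemma K2_inv C H (c : R) : 0 <= C -> 0 < c -> (forall t, nv t <= rho -> c <= nc (H t)) ->
  K2 C H -> exists2 C', 0 <= C' & K2 C' (fun t => (H t)^-1).
Proof.
move=> C0 c0 Hc [b d]; pose M := 1 + (rho + rho).
pose C' := c^-1 + C * c^-1 ^+ 2 + C * (C * `|M|) * c^-1 ^+ 3.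
have ci : 0 <= c^-1 by rewrite invr_ge0 ltW.
have q1 : 0 <= C * c^-1 ^+ 2 by rewrite mulr_ge0 ?exprn_ge0.
have q2 : 0 <= C * (C * `|M|) * c^-1 ^+ 3 by rewrite !mulr_ge0 ?exprn_ge0.
have ib t : nv t <= rho -> nc (H t)^-1 <= c^-1.
  by move=> tr; rewrite ncV lef_pV2 ?posrE ?Hc //; apply: lt_le_trans (Hc t tr).
have H0 t : nv t <= rho -> H t != 0.
  by move=> tr; rewrite -nc_gt0; apply: lt_le_trans (Hc t tr).
exists C'; first by rewrite !addr_ge0.
split=> [t /ib /le_trans|t tr]; first by apply; rewrite /C'; lra.
have [a [aC ha]] := d t tr; exists (fun i => - a i * (H t)^-1 ^+ 2); split=> [i|s sr].
  rewrite ncM ncN expr2 ncM.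
  have := ler_pM (nc_ge0 _) (nc_ge0 _) (ib t tr) (ib t tr).
  rewrite -expr2 => /(ler_pM (nc_ge0 _) (mulr_ge0 (nc_ge0 _) (nc_ge0 _)) (aC i)) h.
  by apply: le_trans h _; rewrite /C'; lra.
have l1 := K2_lip C0 tr sr aC (ha s sr).
have -> : \sum_i - a i * (H t)^-1 ^+ 2 * (s 0 i - t 0 i) =
  - (\sum_i a i * (s 0 i - t 0 i)) * (H t)^-1 ^+ 2.
  by rewrite mulNr mulr_suml -sumrN; apply: eq_bigr => i _; ring.
move: (ha s sr); rewrite sum_sub_lin; have := nc_lin (s - t) aC.
set S1 := \sum_i _ => s1 e1.
(* After the linear term there remain the Taylor remainder of H and a product of two first-order
   quantities. *)
have -> : (H s)^-1 - (H t)^-1 - - S1 * (H t)^-1 ^+ 2 =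
   - ((H s - H t - S1) * ((H t)^-1 * (H s)^-1)) +
   S1 * (H s - H t) * ((H t)^-1 * ((H t)^-1 * (H s)^-1)).
  by field; rewrite !H0.
apply: le_trans (ncD _ _) _; rewrite ncN !ncM; set D := nv (s - t) in l1 e1 s1 *.
have D0 : 0 <= D by exact: nv_ge0.
have it := ib t tr; have is_ := ib s sr.
have ll : nc (H s - H t) <= C * `|M| * D.
  by apply: le_trans l1 _; rewrite ler_wpM2r // ler_wpM2l // ler_norm.
have p2 := ler_pM (nc_ge0 _) (nc_ge0 _) it is_.
have p3 := ler_pM (nc_ge0 _) (mulr_ge0 (nc_ge0 _) (nc_ge0 _)) it p2.
have r1 := ler_pM (nc_ge0 _) (mulr_ge0 (nc_ge0 _) (nc_ge0 _)) e1 p2.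
have r2 := ler_pM (mulr_ge0 (nc_ge0 _) (nc_ge0 _)) (mulr_ge0 (nc_ge0 _) (mulr_ge0 (nc_ge0 _) (nc_ge0 _)))
  (ler_pM (nc_ge0 _) (nc_ge0 _) s1 ll) p3.
apply: le_trans (lerD r1 r2) _.
have -> : C * D ^+ 2 * (c^-1 * c^-1) + C * D * (C * `|M| * D) * (c^-1 * (c^-1 * c^-1)) =
  (C * c^-1 ^+ 2 + C * (C * `|M|) * c^-1 ^+ 3) * D ^+ 2 by ring.
by rewrite ler_wpM2r ?sqr_ge0 // /C' -addrA lerDr.
Qed.

End QuadraticClass.

Section QuadraticDifferentiable.
Context {R : realType} {n : nat}.
Local Notation T := 'rV[R[i]^o]_n.

Definition lin_form (a : 'I_n -> R[i]) (h : T) : R[i]^o := \sum_i a i * h 0 i.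

Fact lin_form_is_linear a : linear (lin_form a).
Proof.
move=> k u v; rewrite /lin_form scaler_sumr -big_split; apply: eq_bigr => i _ /=.
by rewrite !mxE mulrDr; congr (_ + _); exact: mulrCA.
Qed.

HB.instance Definition _ (a : 'I_n -> R[i]) :=
  GRing.isLinear.Build R[i] T (R[i]^o) *:%R (lin_form a) (lin_form_is_linear a).

Lemma lin_form_continuous a : continuous (lin_form a).
Proof.
move=> h; apply: cvg_nc_at => e e0.
pose C := \sum_i nc (a i); have C0 : 0 <= C by apply: sumr_ge0 => i _; exact: nc_ge0.
have d0 : 0 < e / (C + 1) by rewrite divr_gt0 // ltr_wpDl.
apply: filterS (near_nv_lt h d0) => s hs.
have -> : lin_form a h - lin_form a s = - lin_form a (s - h).
  by rewrite linearB opprB.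
rewrite ncN; apply: le_lt_trans (nc_lin (C := C) _ _) _.
  by move=> i; rewrite /C (bigD1 i) //= lerDl sumr_ge0 // => j _; exact: nc_ge0.
apply: le_lt_trans (mul_div_succ_lt C0 e0); rewrite ler_wpM2l //; exact: ltW.
Qed.

Lemma quadratic_differentiable (H : T -> R[i]^o) (t : T) (a : 'I_n -> R[i]) (C : R) : 0 <= C ->
  (\forall s \near t, nc (H s - H t - \sum_i a i * (s 0 i - t 0 i)) <= C * nv (s - t) ^+ 2) ->
  differentiable H t.
Proof.
move=> C0 hH.
have E := @diff_unique R[i] T (R[i]^o : normedModType R[i]) H (lin_form a) t (@lin_form_continuous a).
(* The premise of [E] is the little-o expansion at t with linear part [lin_form a]; it is extracted
   from the type instead of being restated. *)
match type of E with ?A -> _ => have key : A end.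
  apply/eqaddoP => /= e e0.
  have [e0' _] := ltC_nc e0.
  pose K := C * n%:R + 1; have K0 : 0 < K by rewrite ltr_wpDl // mulr_ge0.
  have d0 : 0 < Re e / K by rewrite divr_gt0.
  have near0 : \forall h \near (0 : T), nv h < Re e / K.
    by apply: filterS (near_nv_lt (0 : T) d0) => h; rewrite subr0.
  have H1 : \forall h \near (0 : T), nc (H (h + t) - H t - \sum_i a i * ((h + t) 0 i - t 0 i)) <=
      C * nv (h + t - t) ^+ 2.
    by have := hH; rewrite (near_shift 0) subr0.
  apply: filterS (filterI near0 H1) => h [h1 h2].
  have hn : 0 <= `|h| by exact: normr_ge0.
  rewrite [X in `|X|](_ : _ = H (h + t) - H t - \sum_i a i * ((h + t) 0 i - t 0 i)); last first.
    rewrite /= /cst /lin_form /= opprD addrA; congr (_ - _).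
    by apply: eq_bigr => i _; rewrite mxE addrK.
  rewrite addrK in h2.
  have -> : e * `|h| = (Re e * Re `|h|)%:C.
    by rewrite rmorphM /= !RRe_real // ?ger0_real // ltW.
  rewrite ncE lecR; apply: le_trans h2 _.
  have nh := nv_le_norm h; have nh0 := nv_ge0 h.
  have rn : 0 <= Re `|h| by move: hn; rewrite lecE => /andP [_].
  move: h1; rewrite ltr_pdivlMr // => h1.
  have k1 : C * nv h * (n%:R * Re `|h|) <= Re e * Re `|h|.
    rewrite mulrA ler_wpM2r //; apply: le_trans (ltW h1); rewrite /K; lra.
  apply: le_trans k1; rewrite expr2 mulrA ler_wpM2l // mulr_ge0 //.
by apply/diff_locallyP; rewrite (E key); split => //; exact: lin_form_continuous.
Qed.

Lemma K2_differentiable (rho C : R) (H : T -> R[i]^o) t : 0 <= C -> nv t < rho ->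
  K2 rho C H -> differentiable H t.
Proof.
move=> C0 tr [_ /(_ t (ltW tr)) [a [_ ha]]]; apply: (quadratic_differentiable (a := a) C0).
have d0 : 0 < rho - nv t by rewrite subr_gt0.
apply: filterS (near_nv_lt t d0) => s hs; apply: ha.
have -> : s = (s - t) + t by rewrite subrK.
apply: le_trans (nvD _ _) _; lra.
Qed.

End QuadraticDifferentiable.

(** * Steps along a rational grid *)

Section GridSteps.
Context {R : realType}.
Implicit Types (a b x m e : R).

Lemma int_lt_succ a b : a \is a Num.int -> b \is a Num.int -> a < b -> a + 1 <= b.
Proof.
move=> /intrP [i ->] /intrP [j ->]; rewrite ltr_int -intrD1 ler_int.
by rewrite -lezD1.
Qed.

(** The integers and x are multiples of e, so no integer lies strictly between x and x + e: the
    value on leaving x and the value on reaching x + e belong to one linear branch. *)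
Lemma sfrac_grid_step e x : e != 0 -> e^-1 \is a Num.int -> x / e \is a Num.int ->
  sfrac (0 < - e) (x + e) = sfrac (0 < e) x + e.
Proof.
move=> e0 ei xi; have [ep|en|h] := ltrgt0P e; last by rewrite h eqxx in e0.
  have -> : (0 < - e) = false by rewrite oppr_gt0 ltNge (ltW ep).
  have [m mi [-> /andP [h1 h2]]] := sfrac_ex true x.
  rewrite (sfrac_false mi); first by ring.
  apply/andP; split; first by lra.
  have m1i : (m + 1) / e \is a Num.int by rewrite rpredM // rpredD // rpred1.
  have : x / e < (m + 1) / e by rewrite ltr_pM2r ?invr_gt0.
  move=> /(int_lt_succ xi m1i); rewrite -(ler_pM2r ep) mulrDl !divfK // mul1r //.
rewrite oppr_gt0 en.
have [m mi [-> /andP [h1 h2]]] := sfrac_ex false x.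
rewrite (sfrac_true mi); first by ring.
apply/andP; split; last by lra.
have m1i : m / e \is a Num.int by rewrite rpredM.
have : x / e < m / e by rewrite ltr_nM2r ?invr_lt0.
by move=> /(int_lt_succ xi m1i); rewrite -(ler_nM2r en) mulrDl !divfK // mul1r.
Qed.

Lemma notint_near x : exists2 e, 0 < e & forall d, d != 0 -> `|d| < e -> x + d \isn't a Num.int.
Proof.
have [m mi [_ /andP [h1 h2]]] := sfrac_ex true x.
have key k d : k \is a Num.int -> k < x + d < k + 1 -> x + d \isn't a Num.int.
  move=> ki /andP [l1 l2]; apply/negP => xi.
  by have := int_lt_succ ki xi l1; rewrite leNgt l2.
have [xm|xm] := eqVneq m x.
  exists 1 => // d d0; rewrite ltr_norml => /andP [d1 d2].
  have [dp|dn|h] := ltrgt0P d; last by rewrite h eqxx in d0.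
    by apply: (key m) => //; rewrite -xm; apply/andP; split; lra.
  by apply: (key (m - 1)); rewrite ?rpredB ?rpred1 // -?xm; apply/andP; split; lra.
have mx : m < x by rewrite lt_neqAle xm.
exists (Num.min (x - m) (m + 1 - x)); first by rewrite lt_min; apply/andP; split; lra.
move=> d _; rewrite lt_min !ltr_norml => /andP [/andP [d1 d2] /andP [d3 d4]].
by apply: (key m) => //; apply/andP; split; lra.
Qed.

End GridSteps.

(** * The discrete recursion that removes one functional *)

Section Recursion.
Context {R : realType} {r n : nat} (Lam : 'I_n -> 'rV[int]_r * R[i]).
Context (N0 : nat) (N0_gt1 : (1 < N0)%N) (N0_clears : clears_den Lam N0).
Local Notation rv f := (realv (R := R) (vec Lam f)).
Local Notation base := (is_base Lam).
Local Notation dv := (dualv Lam).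
Local Notation N := (N0 ^ 3)%N.
Local Notation QN := (Q Lam N).
Implicit Types (B S : {set 'I_n}) (f g : 'I_n) (y phi : 'rV[R]_r).

Lemma base_cst_int B f g : base B -> f \in B -> dot (rv g) (dv B f) != 0 ->
  N0%:R / dot (rv g) (dv B f) \is a Num.int.
Proof. by move=> bB fB; exact: inv_c_int. Qed.

Lemma sum_cden tau B g : \sum_(f in B) tau f * (dot (rv g) (dv B f))%:C = tau g - cden Lam tau B g.
Proof. by rewrite /cden opprB addrC subrK. Qed.

Lemma cden_mem tau B g : base B -> g \in B -> cden Lam tau B g = 0.
Proof.
move=> bB gB; rewrite /cden (bigD1 g) //= (dualvP bB gB gB) eqxx rmorph1 mulr1 big1 ?addr0 ?subrr //.
move=> f /andP [fB fg]; rewrite (dualvP bB fB gB) eq_sym (negbTE fg) rmorph0 mulr0 //.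
Qed.

Lemma Q_periodic S tau phi y (u : 'rV[int]_r) :
  QN S tau phi (y + realv u) = QN S tau phi y.
Proof.
apply: eq_bigr => B /andP [bB _]; congr (_ * _).
rewrite -(mean_shift (cube_gt1 N0_gt1) u (bterm_periodic (cube_clears N0_clears) tau phi y bB)).
apply: eq_mean => w; apply: eq_bigr => f _.
by rewrite realvD addrAC addrA.
Qed.

Lemma bterm_bound tau : exists2 M : R, 0 <= M & forall phi y B w, nc (bterm Lam tau phi y B w) <= M.
Proof.
have [M HM] := choice (fun f => cexp_factor_lip (tau f) (cexp (tau f) - 1)).
have [L HL] := choice HM.
pose M1 := 1 + \sum_f M f.
have M0 f : 0 <= M f by have [] := HL f.
have M1_ge1 : 1 <= M1 by rewrite lerDl sumr_ge0.
have MM f : M f <= M1.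
  by rewrite /M1 (bigD1 f) //= addrCA lerDl addr_ge0 // sumr_ge0.
exists (M1 ^+ size (index_enum 'I_n)); first by rewrite exprn_ge0 //; lra.
move=> phi y B w.
have bd f : nc (cexp (tau f * (bfrac Lam phi (y + realv w) B f)%:C) / (cexp (tau f) - 1)) <= M1.
  have [_ _ Hf] := HL f.
  by apply: le_trans (Hf _ _ (bfrac_itv Lam phi _ B f) (bfrac_itv Lam phi _ B f)).1 _.
pose F f := cexp (tau f * (bfrac Lam phi (y + realv w) B f)%:C) / (cexp (tau f) - 1).
have F0 f : f \in B -> nc (F f - F f) <= 0 by rewrite subrr nc0.
exact: (prod_lip (index_enum 'I_n) M1_ge1 (lexx 0) (fun f _ => bd f) (fun f _ => bd f) F0).1.
Qed.

(** For g outside B, (exp(- d q) - 1) / d = - q + O(q^2) with d = [cden] of g: the denominator of g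
    cancels, leaving the coefficient of B in Q for S \ g. For g in B, d = 0 and the term vanishes. C
    depends on neither q nor m. *)
Lemma step_const tau S g (M : R) : nondegenerate Lam tau -> 0 <= M -> g \in S ->
  exists2 C : R, 0 <= C & forall (q : R) (m : {set 'I_n} -> R[i]), 0 <= q <= 1 ->
    (forall B, nc (m B) <= M) ->
    nc (\sum_(B : {set 'I_n} | base B && (B \subset S))
          (\prod_(h in S :\: B) (cden Lam tau B h)^-1) *
            ((cexp (- cden Lam tau B g * q%:C) - 1) * m B)
        + q%:C * \sum_(B : {set 'I_n} | base B && (B \subset S :\ g))
          (\prod_(h in (S :\ g) :\: B) (cden Lam tau B h)^-1) * m B) <= C * q ^+ 2.
Proof.
move=> nd M0 gS; pose d B := cden Lam tau B g.
pose c0 := \sum_(B : {set 'I_n}) nc (d B).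
have c0_ge0 : 0 <= c0 by apply: sumr_ge0 => B _; exact: nc_ge0.
have dc B : nc (d B) <= c0.
  by rewrite /c0 (bigD1 B) //= lerDl sumr_ge0 // => B' _; exact: nc_ge0.
have [K K0 HK] := cexp_taylor1 c0_ge0.
pose coef B := \prod_(h in (S :\ g) :\: B) (cden Lam tau B h)^-1.
exists (\sum_(B : {set 'I_n}) nc (coef B) * (K * nc (d B) * M)).
  by apply: sumr_ge0 => B _; rewrite !mulr_ge0 ?nc_ge0.
move=> q m /andP [q0 q1] mM.
have subE B : (g \notin B) && (B \subset S) = (B \subset S :\ g).
  by rewrite subsetD1 andbC.
rewrite (bigID (fun B : {set 'I_n} => g \in B)) /= big1 ?add0r; last first.
  move=> B /andP [/andP [bB _] gB].
  by rewrite (cden_mem tau bB gB) oppr0 mul0r cexp0 subrr mul0r mulr0.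
rewrite (eq_bigl (fun B : {set 'I_n} => base B && (B \subset S :\ g))); last first.
  by move=> B; rewrite -subE -andbA [X in _ && X]andbC.
rewrite mulr_sumr -big_split /=; apply: le_trans (nc_sum _ _ _) _; rewrite mulr_suml.
rewrite [X in _ <= X](bigID (fun B : {set 'I_n} => base B && (B \subset S :\ g))) /= -[X in X <= _]addr0.
apply: lerD; last first.
  by apply: sumr_ge0 => B _; rewrite !mulr_ge0 ?nc_ge0 ?exprn_ge0.
apply: ler_sum => B /andP [bB sub].
have [gB BS] : g \notin B /\ B \subset S by apply/andP; rewrite subE.
have d0 : d B != 0 by have [h _] := nd B bB; exact: h.
have -> : \prod_(h in S :\: B) (cden Lam tau B h)^-1 = (d B)^-1 * coef B.
  rewrite (bigD1 g) /=; last by rewrite !inE gB.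
  by congr (_ * _); apply: eq_bigl => h; rewrite !inE; case: (h == g); rewrite ?andbF ?andbT.
rewrite -/(coef B) -/(d B).
have -> : (d B)^-1 * coef B * ((cexp (- d B * q%:C) - 1) * m B) + q%:C * (coef B * m B) =
  coef B * (((cexp (- d B * q%:C) - 1 - (- d B * q%:C)) / d B) * m B).
  by field.
have dq : nc (- d B * q%:C) = nc (d B) * q by rewrite ncM ncN nc_real ger0_norm.
have := HK (- d B * q%:C); rewrite dq => /(_ _) h.
rewrite ncM -[X in _ <= X]mulrA ler_wpM2l ?nc_ge0 // ncM [nc (_ / _)]ncM ncV.
have dp : 0 < nc (d B) by rewrite nc_gt0.
have h' : nc (cexp (- d B * q%:C) - 1 - - d B * q%:C) / nc (d B) <= K * nc (d B) * q ^+ 2.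
  rewrite ler_pdivrMr //; have -> : K * nc (d B) * q ^+ 2 * nc (d B) = K * (nc (d B) * q) ^+ 2 by ring.
  by apply: h; apply: le_trans (dc B); rewrite ler_piMr ?nc_ge0.
apply: le_trans (ler_pM _ (nc_ge0 _) h' (mM B)) _; first by rewrite divr_ge0 ?nc_ge0.
by rewrite mulrAC.
Qed.

Section Step.
Context (S : {set 'I_n}) (g : 'I_n) (gS : g \in S).
Context (phi phi1 phi2 : 'rV[R]_r) (gphi : off_walls Lam phi).
Context (gphi1 : off_walls Lam phi1) (gphi2 : off_walls Lam phi2).
Context (phi1_sg : forall B f, base B -> f \in B -> (0 < dot phi1 (dv B f)) =
    (if dot (rv g) (dv B f) == 0 then 0 < dot phi (dv B f) else 0 < dot (rv g) (dv B f))).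
Context (phi2_sg : forall B f, base B -> f \in B -> (0 < dot phi2 (dv B f)) =
    (if dot (- rv g) (dv B f) == 0 then 0 < dot phi (dv B f) else 0 < dot (- rv g) (dv B f))).
Context (y : 'rV[R]_r) (M : nat) (M_gt0 : (0 < M)%N).
Context (yM : forall B f, base B -> f \in B -> dot y (dv B f) * M%:R \is a Num.int).
Context (k : nat).
Local Notation K := (N0 * N0 * M * k.+1)%N.

(** A grid from y to y + g. In K, one N0 clears 1 / <g, f*>, M clears y, the other N0 clears w, and
    k.+1 refines the mesh; [phi1] and [phi2] are the directions of leaving a node forwards and
    backwards. *)
Let yj (j : nat) : 'rV[R]_r := y + (j%:R / K%:R) *: rv g.

Let K_gt0 : (0 < K)%N.
Proof. by rewrite !muln_gt0 M_gt0 ltnW. Qed.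
Let KR : (K%:R : R) != 0.
Proof. by rewrite pnatr_eq0 -lt0n. Qed.

(** The dual coordinates of the nodes are multiples of their own increments, so between consecutive
    nodes the fractional parts are linear. *)
Lemma step_bfrac j B f (w : 'rV[int]_r) : base B -> f \in B ->
  bfrac Lam phi2 (yj j.+1 + realv w) B f =
  bfrac Lam phi1 (yj j + realv w) B f + dot (rv g) (dv B f) / K%:R.
Proof.
move=> bB fB; rewrite !bfracE phi1_sg // phi2_sg // dotNl oppr_eq0.
set c := dot (rv g) (dv B f).
have xE i : dot (yj i + realv w) (dv B f) = dot y (dv B f) + i%:R / K%:R * c + dot (realv w) (dv B f).
  by rewrite !dotDl dotZl.
have -> : dot (yj j.+1 + realv w) (dv B f) = dot (yj j + realv w) (dv B f) + c / K%:R.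
  by rewrite !xE -natr1; ring.
have [c0|c0] := eqVneq c 0; first by rewrite c0 mul0r !addr0.
have e0 : c / K%:R != 0 by rewrite mulf_neq0 // invr_neq0.
have sgE (z : R) : (0 < z / K%:R) = (0 < z) by rewrite pmulr_lgt0 // invr_gt0 ltr0n.
have <- : (0 < - (c / K%:R)) = (0 < - c) by rewrite -mulNr sgE.
rewrite -(sgE c); apply: sfrac_grid_step => //.
  rewrite invf_div.
  have -> : K%:R / c = (N0%:R / c) * (N0 * M * k.+1)%:R :> R by rewrite !natrM; field.
  by rewrite rpredM ?rpred_nat // base_cst_int.
rewrite xE invf_div.
have -> : (dot y (dv B f) + j%:R / K%:R * c + dot (realv w) (dv B f)) * (K%:R / c) =
  (N0%:R / c) * ((dot y (dv B f) * M%:R) * (N0 * k.+1)%:R) + j%:R +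
  (N0%:R / c) * ((dot (realv w) (dv B f) * N0%:R) * (M * k.+1)%:R).
  move: KR; rewrite !natrM => KR'; field; move: KR'; rewrite !mulf_eq0 !negb_or.
  by move=> /andP [/andP [/andP [_ h1] h2] h3]; rewrite c0 h1 h2 addrC natr1 h3.
by rewrite !rpredD ?rpred_nat // rpredM ?base_cst_int // rpredM ?rpred_nat ?yM // N0_clears.
Qed.

(** The tau-weighted increments of the fractional parts add up to (tau g - cden) / K, whatever w
    is. *)
Lemma step_bterm tau j B (w : 'rV[int]_r) : base B ->
  bterm Lam tau phi2 (yj j.+1) B w =
  cexp ((tau g - cden Lam tau B g) * (K%:R^-1)%:C) * bterm Lam tau phi1 (yj j) B w.
Proof.
move=> bB; rewrite -sum_cden mulr_suml cexp_sum /bterm -big_split; apply: eq_bigr => f fB /=.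
rewrite mulrA step_bfrac // -cexpD; congr (cexp _ / _).
rewrite rmorphD !rmorphM /=; ring.
Qed.

Lemma step_Q tau C (m0 := fun j B => mean N (bterm Lam tau phi1 (yj j) B)) :
  (forall j, nc (\sum_(B : {set 'I_n} | base B && (B \subset S))
          (\prod_(h in S :\: B) (cden Lam tau B h)^-1) *
            ((cexp (- cden Lam tau B g * (K%:R^-1)%:C) - 1) * m0 j B)
        + (K%:R^-1)%:C * \sum_(B : {set 'I_n} | base B && (B \subset S :\ g))
          (\prod_(h in (S :\ g) :\: B) (cden Lam tau B h)^-1) * m0 j B) <= C * (K%:R^-1) ^+ 2) ->
  forall j, nc (cexp (- tau g * (K%:R^-1)%:C) * QN S tau phi2 (yj j.+1) - QN S tau phi1 (yj j)
      + (K%:R^-1)%:C * QN (S :\ g) tau phi1 (yj j)) <= C * (K%:R^-1) ^+ 2.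
Proof.
move=> H j; move: (H j); congr (nc (_ + _) <= _).
rewrite /Q mulr_sumr -sumrB; apply: eq_bigr => B /andP [bB _].
have -> : mean N (bterm Lam tau phi2 (yj j.+1) B) =
  cexp ((tau g - cden Lam tau B g) * (K%:R^-1)%:C) * m0 j B.
  by rewrite /m0 -meanMl; apply: eq_mean => w; exact: step_bterm.
have -> : cexp ((tau g - cden Lam tau B g) * (K%:R^-1)%:C) =
   cexp (tau g * (K%:R^-1)%:C) * cexp (- cden Lam tau B g * (K%:R^-1)%:C).
  by rewrite -cexpD; congr cexp; ring.
have t1 : cexp (- tau g * (K%:R^-1)%:C) * cexp (tau g * (K%:R^-1)%:C) = 1.
  by rewrite -cexpD mulNr addNr cexp0.
rewrite -/(m0 j B) [RHS]/=; move: t1 (m0 j B) (\prod_(h in S :\: B) _).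
move: (cexp (- cden _ _ _ _ * _)) (cexp (- tau g * _)) (cexp (tau g * _)) => x a b t1 m p.
have -> : a * (p * (b * x * m)) = (a * b) * (p * (x * m)) by ring.
by rewrite t1; ring.
Qed.

(* Discrete form of (exp tau_g - 1) Q_S(y) = int_0^1 exp(tau_g (1 - s)) Q_{S \ g}(y + s g) ds:
   telescope exp(- tau_g s) Q_S(y + s g) along the grid s = j / K. *)
Lemma recursion_bound tau C : 0 <= C ->
  (forall j, QN S tau phi1 (yj j) = QN S tau phi (yj j)) ->
  (forall j, QN S tau phi2 (yj j) = QN S tau phi (yj j)) ->
  (forall j, nc (cexp (- tau g * (K%:R^-1)%:C) * QN S tau phi2 (yj j.+1) - QN S tau phi1 (yj j)
      + (K%:R^-1)%:C * QN (S :\ g) tau phi1 (yj j)) <= C * (K%:R^-1) ^+ 2) ->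
  nc ((cexp (tau g) - 1) * QN S tau phi y - #|'I_K|%:R^-1 * \sum_(j < K)
    cexp (tau g * (1 - j%:R / K%:R)%:C) * QN (S :\ g) tau phi1 (yj j))
  <= expR (nc (tau g)) * expR (nc (tau g)) * C / K%:R.
Proof.
move=> C0 e1 e2 H; set q := (K%:R^-1)%:C in H *.
have K0 : (0 : R) < K%:R by rewrite ltr0n.
pose e (j : nat) := cexp (- tau g * (j%:R / K%:R)%:C).
pose p j := e j * QN S tau phi (yj j).
pose err j := p j.+1 - p j + q * (e j * QN (S :\ g) tau phi1 (yj j)).
have errE j : err j = e j * (cexp (- tau g * q) * QN S tau phi2 (yj j.+1)
    - QN S tau phi1 (yj j) + q * QN (S :\ g) tau phi1 (yj j)).
  rewrite /err /p e1 e2; have -> : e j.+1 = e j * cexp (- tau g * q).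
    by rewrite /e /q -cexpD -mulrDr -rmorphD -natr1 mulrDl mul1r.
  move: (QN S tau phi (yj j.+1)) (QN S tau phi (yj j)) (QN (S :\ g) tau phi1 (yj j)).
  by move: (cexp (- tau g * q)) (e j) => x1 x2 x3 x4 x5; ring.
have ej j : (j <= K)%N -> nc (e j) <= expR (nc (tau g)).
  move=> jK; apply: le_trans (nc_cexp_le _) _; rewrite ler_expR ncM ncN nc_real.
  rewrite ger0_norm ?divr_ge0 // ler_piMr ?nc_ge0 // ler_pdivrMr // mul1r ler_nat //.
have eb (j : 'I_K) : nc (err j) <= expR (nc (tau g)) * (C * K%:R^-1 ^+ 2).
  by rewrite errE ncM ler_pM ?nc_ge0 ?ej ?H // ltnW.
have tel : \sum_(j < K) err j =
   (cexp (- tau g) - 1) * QN S tau phi y + q * \sum_(j < K) e j * QN (S :\ g) tau phi1 (yj j).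
  rewrite /err big_split -mulr_sumr; congr (_ + _).
  rewrite -(big_mkord predT (fun j => p j.+1 - p j)) telescope_sumr // /p /e /yj.
  rewrite divff // mul0r scale1r scale0r addr0 Q_periodic rmorph0 rmorph1 mulr0 mulr1 cexp0.
  by rewrite mulrBl.
have -> : (cexp (tau g) - 1) * QN S tau phi y - #|'I_K|%:R^-1 * \sum_(j < K)
    cexp (tau g * (1 - j%:R / K%:R)%:C) * QN (S :\ g) tau phi1 (yj j) =
  - cexp (tau g) * \sum_(j < K) err j.
  rewrite tel mulrDr cexpN; congr (_ + _); first by field; exact: cexp_neq0.
  have -> : #|'I_K|%:R^-1 = q :> R[i].
    by rewrite card_ord /q fmorphV /= -(rmorph_nat (real_complex R)).
  rewrite mulNr; congr (- _); rewrite mulrCA; congr (_ * _); rewrite mulr_sumr; apply: eq_bigr => j _.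
  rewrite mulrA /e -cexpD; congr (cexp _ * _).
  rewrite rmorphB rmorph1; ring.
rewrite ncM ncN.
have s1 : nc (\sum_(j < K) err j) <= expR (nc (tau g)) * C / K%:R.
  apply: le_trans (nc_sum _ _ _) _; apply: le_trans (ler_sum _ (fun j _ => eb j)) _.
  rewrite sumr_const card_ord -[X in X <= _]mulr_natr; set E := expR _.
  have -> : E * (C * K%:R^-1 ^+ 2) * K%:R = E * C * K%:R^-1 * (K%:R^-1 * K%:R).
    by move: (K%:R : R) => z; move: (z^-1) => z'; ring.
  by rewrite mulVf // mulr1.
apply: le_trans (ler_pM (nc_ge0 _) (nc_ge0 _) (nc_cexp_le _) s1) _.
by rewrite !mulrA.
Qed.

End Step.

(** The first clause avoids every discontinuity; the second, rationality, provides the grid on which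
    fractional parts are tracked. *)
Definition special y := (forall B f (w : 'rV[int]_r), base B -> f \in B ->
    dot (y + realv w) (dv B f) \isn't a Num.int) /\
  exists2 M : nat, (0 < M)%N &
    forall B f, base B -> f \in B -> dot y (dv B f) * M%:R \is a Num.int.

(** If f != g is a coloop of S, its dual vector is orthogonal to g and the pairing is constant along
    the line. The element g is no coloop: its dual vector would be orthogonal to the base B0. *)
Lemma special_regular S g B0 y (c : R) : g \in S -> special y -> base B0 -> B0 \subset S :\ g ->
  regular Lam S (y + c *: rv g).
Proof.
move=> gS [sp _] bB0 sub B f bB BS fB col w.
have [fg|fg] := eqVneq f g; last first.
  have gE : dot (rv g) (dv B f) = 0 by apply: col; rewrite // eq_sym.
  by have := sp B f w bB fB; rewrite !dotDl dotZl gE mulr0 addr0.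
have := dualv_neq0 bB fB; case/eqP; apply: (dual_unique bB0) => h hB0.
have := fintype.subsetP sub h hB0; rewrite !inE => /andP [hg hS].
by rewrite dot0r; apply: col => //; rewrite fg.
Qed.

Lemma rational_near (y0 : 'rV[R]_r) (A : set 'rV[R]_r) : nbhs y0 A ->
  exists2 M : nat, (0 < M)%N & exists u : 'rV[int]_r, A (M%:R^-1 *: realv u).
Proof.
move=> /nbhs_normP [e /= e0 eA].
pose M := (Num.truncn e^-1).+1.
have M0 : (0 : R) < M%:R by rewrite ltr0n.
exists M => //; exists (map_mx (fun x : R => Num.floor (x * M%:R)) y0); apply: eA.
rewrite /ball_ /=; apply: (@le_lt_trans _ _ M%:R^-1); last first.
  rewrite invf_plt ?posrE //; apply: truncnS_gt.
rewrite /Num.norm /= mx_normrE; apply: bigmax_le; first by rewrite invr_ge0 ltW.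
move=> [i j] _; rewrite !mxE /= ord1.
have h1 := Num.Theory.floor_le (y0 0 j * M%:R); have h2 := Num.Theory.floorD1_gt (y0 0 j * M%:R).
rewrite intrD1 in h2; set z := (Num.floor _)%:~R in h1 h2 *.
have -> : y0 0 j - M%:R^-1 * z = (y0 0 j * M%:R - z) / M%:R.
  by field; rewrite gt_eqF.
rewrite normrM normfV (gtr0_norm M0) ler_piMl ?invr_ge0 //.
by rewrite ger0_norm; lra.
Qed.

(** The point y' is taken near y + c phi with c > 0 small. Then y' - y has the signs of phi, so
    [bfrac] at y' continues the one-sided value at y that phi selects. *)
Lemma special_dense phi y (e : R) : off_walls Lam phi -> 0 < e ->
  exists2 y', special y' & forall B f (w : 'rV['Z_N]_r), base B -> f \in B ->
    `|bfrac Lam phi (y' + realv (Zv w)) B f - bfrac Lam phi (y + realv (Zv w)) B f| <= e.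
Proof.
move=> gphi e0.
have H2 : \forall y' \near y, forall B f, `|dot (y' - y) (dv B f)| < e.
  by apply: nbhs_forall => B; apply: nbhs_forall => f; apply: (dot_near _ _ e0).
have H3 : \forall y' \near y, forall B f (w : 'rV['Z_N]_r), dot (y' - y) (dv B f) != 0 ->
    dot (y' + realv (Zv w)) (dv B f) \isn't a Num.int.
  apply: nbhs_forall => B; apply: nbhs_forall => f; apply: nbhs_forall => w.
  have [d d0 H] := notint_near (dot (y + realv (Zv w)) (dv B f)).
  apply: filterS (dot_near y (dv B f) d0) => y' h1 h0.
  have -> : y' + realv (Zv w) = y + realv (Zv w) + (y' - y) by rewrite [RHS]addrC addrA subrK.
  by rewrite (dotDl (y + _)); apply: H.
have := nbhs_interior (filterI (bfrac_near Lam N phi y) (filterI H2 H3)).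
set A := (X in X^°%classic) => HA0; have HA := HA0 (nbhs_filter y) (nbhs_filter y).
have cv := @cvg_ray R r y phi.
have H1 : \forall c \near (0 : R)^'+, A^°%classic (y + c *: phi) := cv _ HA.
have [c [c0 Ac]] := filter_ex (filterI (nbhs_right_gt (0 : R)) H1).
have Hs : \forall y' \near (y + c *: phi), forall B f, base B -> f \in B ->
    (dot (y' - y) (dv B f) != 0) && ((0 < dot (y' - y) (dv B f)) == (0 < dot phi (dv B f))).
  apply: nbhs_forall => B; apply: nbhs_forall => f.
  have [bB|nb] := boolP (base B); last by apply: filterE.
  have [fB|nf] := boolP (f \in B); last by apply: filterE.
  have a0 := gphi _ _ bB fB.
  have ca0 : 0 < `|c * dot phi (dv B f)| by rewrite normr_gt0 mulf_neq0 // gt_eqF.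
  apply: filterS (dot_near (y + c *: phi) (dv B f) ca0) => y' h _ _.
  have E : dot (y' - y) (dv B f) = c * dot phi (dv B f) + dot (y' - (y + c *: phi)) (dv B f).
    by rewrite !dotBl dotDl dotZl; ring.
  move: h; rewrite E; set d := dot (y' - _) _; set p := dot phi _ in a0 ca0 *.
  case: (ltrgt0P p) a0 => // hp _.
    have cp : 0 < c * p by exact: mulr_gt0.
    rewrite (gtr0_norm cp) ltr_norml => /andP [l1 l2].
    have h : 0 < c * p + d by lra.
    by rewrite h gt_eqF.
  have cp : c * p < 0 by rewrite pmulr_rlt0.
  rewrite (ltr0_norm cp) ltr_norml => /andP [l1 l2].
  have h : c * p + d < 0 by lra.
  by rewrite lt_eqF //= lt_gtF.
(* All the conditions hold on a neighbourhood of y + c phi, which contains a rational point. *)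
have [M M0 [u [[Hb [Hd Hn]] Hs']]] := rational_near (filterI Ac Hs).
set y' := M%:R^-1 *: realv u in Hb Hd Hn Hs'.
exists y'; first split.
- move=> B f w bB fB; have [u0 Hu0] := Zv_add (cube_gt1 N0_gt1) w; have [k] := Hu0 0.
  rewrite Zv0 !add0r => ->; rewrite realvD addrA (dotDl (y' + _)).
  rewrite rpredDr; first by apply: Hn; have /andP [] := Hs' B f bB fB.
  by rewrite realvZ dotZl mulrC -pmulrn; apply: cube_clears.
- exists (M * N0)%N; first by rewrite muln_gt0 M0 ltnW.
  move=> B f bB fB; rewrite /y' dotZl natrM.
  have -> : M%:R^-1 * dot (realv u) (dv B f) * (M%:R * N0%:R) = dot (realv u) (dv B f) * N0%:R.
    by field; rewrite pnatr_eq0 -lt0n.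
  exact: N0_clears.
move=> B f w bB fB; have /andP [h1 /eqP h2] := Hs' B f bB fB.
rewrite Hb (negbTE h1) h2 bfracE addrAC subrr add0r.
exact/ltW/Hd.
Qed.

End Recursion.

Section UltraLimits.
Context {R : realType}.

Lemma eventually_div_le (C e : R) : 0 <= C -> 0 < e -> exists K : nat, forall k, (K <= k)%N ->
  C / k.+1%:R <= e.
Proof.
move=> C0 e0; exists (Num.truncn (C / e)) => k Kk; rewrite ler_pdivrMr ?ltr0n //.
have h : C / e < (Num.truncn (C / e)).+1%:R by exact: truncnS_gt.
have h2 : (Num.truncn (C / e)).+1%:R <= (k.+1%:R : R) by rewrite ler_nat.
by rewrite mulrC -ler_pdivrMr //; apply: le_trans (ltW h) h2.
Qed.

Lemma ultra_lim_eq (U : set_system nat) (UU : UltraFilter U) (oU : \oo `<=` U)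
    (u : nat -> R[i]) (G l : R[i]) :
  (u k : R[i]^o) @[k --> U] --> (G : R[i]^o) ->
  (forall e : R, 0 < e -> exists K : nat, forall k, (K <= k)%N -> nc (l - u k) <= e) -> G = l.
Proof.
move=> cv H; have PU := @ultra_proper _ _ UU; apply/eqP; rewrite -subr_eq0 -nc_eq0.
apply: contraT => ne; have p : 0 < nc (G - l) by rewrite lt0r ne nc_ge0.
have p2 : 0 < nc (G - l) / 2 by rewrite divr_gt0.
move/cvg_ncP : cv => /(_ _ p2) h1; have [K HK] := H _ p2.
have h2 : U [set k | (K <= k)%N] by apply: oU; exact: nbhs_infty_ge.
have [k [k1 k2]] := filter_ex (filterI h1 h2).
have := ncD (G - u k) (u k - l); rewrite addrA subrK [nc (u k - l)]ncBC.
by have := HK k k2; lra.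
Qed.

End UltraLimits.

(** * Holomorphic extension, by induction on the set of functionals *)

Section Extension.
Context {R : realType} {r n : nat} (Lam : 'I_n -> 'rV[int]_r * R[i]).
Context (N0 : nat) (N0_gt1 : (1 < N0)%N) (N0_clears : clears_den Lam N0).
Local Notation rv f := (realv (R := R) (vec Lam f)).
Local Notation base := (is_base Lam).
Local Notation N := (N0 ^ 3)%N.
Local Notation QN := (Q Lam N).
Local Notation T := 'rV[R[i]^o]_n.
Context (rho : R) (rho_ge0 : 0 <= rho).
Implicit Types (B S : {set 'I_n}) (f g : 'I_n) (y phi : 'rV[R]_r) (t : T).

Let PS S t phi y := (\prod_(g in S) (cexp (tshift Lam t g) - 1)) * QN S (tshift Lam t) phi y.

(** The bound is uniform in the direction as well as in y, because the step for phi uses the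
    extension for a direction turned towards g. *)
Definition Q_extends S := exists H : 'rV[R]_r * 'rV[R]_r -> T -> R[i],
  K2fam rho (fun p => off_walls Lam p.1) H /\
  forall p t, off_walls Lam p.1 -> nv t <= rho -> offpoles Lam t -> H p t = PS S t p.1 p.2.

(** B is the only base inside B, no [cden] occurs, and the factors exp tau_f - 1 cancel; what is
    left is a mean of exponentials. *)
Lemma Q_extends_base B : base B -> Q_extends B.
Proof.
move=> bB.
pose I := ('rV[R]_r * 'rV[R]_r * 'rV['Z_N]_r)%type.
pose F (p : I) t := \prod_(f in B) cexp ((t 0 f - ((2 * pi)%:C * 'i * bcst Lam f)%C) *
   (bfrac Lam p.1.1 (p.1.2 + realv (Zv p.2)) B f)%:C).
have [C C0 HF] : K2fam rho (fun=> True) F.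
  by apply: K2fam_prod => f; apply: K2fam_cexp => // p _; exact: bfrac_itv.
exists (fun p t => #|{: 'rV['Z_N]_r}|%:R^-1 * \sum_w F (p.1, p.2, w) t); split.
  exists C => // p _; apply: K2_avg => // [|w]; last exact: HF.
  by rewrite card_box ?cube_gt1 // expn_gt0 ltnW // cube_gt1.
move=> [phi y] t g tr off; rewrite /PS /= /Q (big_pred1 B) => [|B']; last first.
  apply/andP/eqP => [[bB' sub]|->]; last by rewrite bB subxx.
  have [cB _] := baseP bB; have [cB' _] := baseP bB'.
  by apply/eqP; rewrite eqEcard sub cB cB' /=.
rewrite finset.setDv big_set0 mul1r /mean card_box ?cube_gt1 // mulrCA; congr (_ * _).
rewrite mulr_sumr; apply: eq_bigr => w _; rewrite /F /bterm -big_split; apply: eq_bigr => f fB /=.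
have [_ /(_ f fB) E0] := off B bB.
by rewrite mulrCA divff // mulr1.
Qed.

Lemma Q_extends_nobase S : (forall B, base B -> ~~ (B \subset S)) -> Q_extends S.
Proof.
move=> nb; exists (fun _ _ => 0); split; first exact: K2fam_const.
move=> p t _ _ _; rewrite /PS /Q [X in _ * X]big_pred0 ?mulr0 // => B.
by apply/negbTE/negP => /andP [/nb /negP].
Qed.

(** The Riemann sums inherit the constant of Q for S \ g. Their identification with Q for S is made
    at one t at a time, so the constants used there may depend on t. *)
Lemma Q_extends_step S g B0 : g \in S -> base B0 -> B0 \subset S :\ g ->
  Q_extends (S :\ g) -> Q_extends S.
Proof.
move=> gS bB0 sub [H' [KH' EH']].
have [U [UU oU]] := ultraFilterLemma (eventually_filter : ProperFilter \oo).
pose I := ('rV[R]_r * 'rV[R]_r * R)%type.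
pose A (p : I) t := cexp ((t 0 g - ((2 * pi)%:C * 'i * bcst Lam g)%C) * (p.2)%:C) * H' p.1 t.
have [C C0 HA] : K2fam rho (fun p : I => off_walls Lam p.1.1 /\ 0 <= p.2 <= 1) A.
  apply: K2fam_mul; first by apply: K2fam_cexp => // p [].
  by have [C C0 h] := KH'; exists C => // p [h1 _]; apply: h.
have special_case phi y : off_walls Lam phi -> special Lam y ->
  exists2 G, K2 rho C G & forall t, nv t <= rho -> offpoles Lam t -> G t = PS S t phi y.
  move=> gphi sp; have [_ [M M0 yM]] := sp.
  have [phi1 gphi1 sg1] := direction_towards (rv g) gphi.
  have [phi2 gphi2 sg2] := direction_towards (- rv g) gphi.
  pose K k := (N0 * N0 * M * k.+1)%N.
  have K0 k : (0 < K k)%N by rewrite !muln_gt0 M0 ltnW.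
  pose yj k (j : nat) : 'rV[R]_r := y + (j%:R / (K k)%:R) *: rv g.
  pose Hk k t := #|'I_(K k)|%:R^-1 * \sum_(j < K k) A (phi1, yj k j, 1 - j%:R / (K k)%:R) t.
  have HK k : K2 rho C (Hk k).
    apply: K2_avg; rewrite ?card_ord // => j; apply: HA; split => //=.
    have KR : (0 : R) < (K k)%:R by rewrite ltr0n.
    have h0 : 0 <= (j%:R / (K k)%:R : R) by rewrite divr_ge0.
    have h1 : (j%:R / (K k)%:R : R) <= 1 by rewrite ler_pdivrMr // mul1r ler_nat ltnW.
    by apply/andP; split; lra.
  have [G KG GP] := K2_ultra UU HK; exists G => // t tr off.
  have nd : nondegenerate Lam (tshift Lam t) by [].
  have [Mb Mb0 HMb] := bterm_bound Lam (tshift Lam t).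
  (* [C1] depends on t, which is harmless: it only has to be divided by a mesh number tending to
     infinity. *)
  have [C1 C10 HC1] := step_const nd Mb0 gS.
  apply: (ultra_lim_eq UU oU (GP t tr)) => e e0.
  set tg := tshift Lam t g.
  pose PE := \prod_(h in S :\ g) (cexp (tshift Lam t h) - 1).
  pose C2 := nc PE * (expR (nc tg) * expR (nc tg) * C1).
  have C20 : 0 <= C2 by rewrite !mulr_ge0 ?nc_ge0 ?expR_ge0.
  have [K1 HK1] := eventually_div_le C20 e0; exists K1 => k /HK1 hk.
  have regj j : regular Lam S (yj k j) by exact: special_regular sp bB0 sub.
  have E1 j : QN S (tshift Lam t) phi1 (yj k j) = QN S (tshift Lam t) phi (yj k j).
    exact: Q_phi_indep.
  have E2 j : QN S (tshift Lam t) phi2 (yj k j) = QN S (tshift Lam t) phi (yj k j).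
    exact: Q_phi_indep.
  have q01 : 0 <= ((K k)%:R^-1 : R) <= 1.
    by rewrite invr_ge0 ler0n invf_le1 ?ltr0n ?K0 // ler1n K0.
  have st := step_Q (S := S) N0_gt1 N0_clears sg1 sg2 M0 yM (k := k) (tau := tshift Lam t) (C := C1)
    (fun j => HC1 _ _ q01 (fun B => mean_le (cube_gt1 N0_gt1) (HMb phi1 _ B))).
  have rb := recursion_bound N0_gt1 N0_clears M0 C10 E1 E2 st.
  have -> : PS S t phi y - Hk k t = PE * ((cexp tg - 1) * QN S (tshift Lam t) phi y
      - #|'I_(K k)|%:R^-1 * \sum_(j < K k) cexp (tg * (1 - j%:R / (K k)%:R)%:C) *
        QN (S :\ g) (tshift Lam t) phi1 (yj k j)).
    rewrite mulrBr; congr (_ - _).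
      by rewrite /PS (big_setD1 g gS) /= -/PE -/tg; ring.
    rewrite /Hk mulrCA; congr (_ * _); rewrite mulr_sumr; apply: eq_bigr => j _.
    by rewrite /A EH' //= /PS -/PE mulrCA.
  rewrite ncM; apply: le_trans (ler_wpM2l (nc_ge0 _) rb) _.
  apply: le_trans hk; rewrite /C2 -/tg -[X in _ <= X]mulrA ler_wpM2l ?nc_ge0 //.
  have Kp : (0 < N0 * N0 * M * k.+1)%N := K0 k.
  rewrite ler_wpM2l ?mulr_ge0 ?expR_ge0 // lef_pV2 ?posrE ?ltr0n ?Kp // ler_nat.
  by rewrite leq_pmull // !muln_gt0 M0 ltnW.
(* Any y is approached by special points on the side of phi, along which Q converges; the bound C is
   the same at all of them. *)
have gen phi y : off_walls Lam phi ->
  exists2 G, K2 rho C G & forall t, nv t <= rho -> offpoles Lam t -> G t = PS S t phi y.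
  move=> gphi.
  have Hy (k : nat) : exists y', special Lam y' /\ forall B f (w : 'rV['Z_N]_r), base B -> f \in B ->
    `|bfrac Lam phi (y' + realv (Zv w)) B f - bfrac Lam phi (y + realv (Zv w)) B f| <= k.+1%:R^-1.
    have [||y' s1 s2] := @special_dense _ _ _ Lam N0 N0_gt1 N0_clears phi y k.+1%:R^-1 => //.
    by exists y'.
  have [ys Hys] := choice Hy.
  have HGk k : exists G, K2 rho C G /\ forall t, nv t <= rho -> offpoles Lam t -> G t = PS S t phi (ys k).
    by have [G KG GP] := special_case phi (ys k) gphi (Hys k).1; exists G.
  have [Gk HG] := choice HGk.
  have [G KG GP] := K2_ultra UU (fun k => (HG k).1); exists G => // t tr off.
  have [C1 C10 HC1] := Q_lip Lam (cube_gt1 N0_gt1) S (tshift Lam t).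
  apply: (ultra_lim_eq UU oU (GP t tr)) => e e0.
  pose PE := \prod_(h in S) (cexp (tshift Lam t h) - 1).
  have C20 : 0 <= nc PE * C1 by rewrite mulr_ge0 ?nc_ge0.
  have [K1 HK1] := eventually_div_le C20 e0; exists K1 => k /HK1 hk.
  rewrite (HG k).2 // /PS -mulrBr ncM ncBC; apply: le_trans hk; rewrite -mulrA ler_wpM2l ?nc_ge0 //.
  by apply: HC1; rewrite ?invr_ge0 //; exact: (Hys k).2.
have HH (p : 'rV[R]_r * 'rV[R]_r) : exists G, off_walls Lam p.1 -> K2 rho C G /\
    forall t, nv t <= rho -> offpoles Lam t -> G t = PS S t p.1 p.2.
  have [gp|ng] := pselect (off_walls Lam p.1); last by exists (fun=> 0).
  by have [G KG GP] := gen p.1 p.2 gp; exists G.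
have [H HP] := choice HH; exists H; split.
  by exists C => // p /HP [].
by move=> p t gp; have [_ h] := HP p gp; exact: h.
Qed.

Lemma Q_extends_all S : Q_extends S.
Proof.
move: {2}#|S| (leqnn #|S|) => m; elim: m S => [|m IH] S leS.
  have [[B bB BS]|nb] := pselect (exists2 B, base B & B \subset S).
    have SB : S = B.
      apply/esym/eqP; rewrite eqEcard BS; exact: leq_trans leS (leq0n _).
    by rewrite SB; exact: Q_extends_base.
  by apply: Q_extends_nobase => B bB; apply/negP => BS; apply: nb; exists B.
have [[B bB BS]|nb] := pselect (exists2 B, base B & B \subset S); last first.
  by apply: Q_extends_nobase => B bB; apply/negP => BS; apply: nb; exists B.
(* Removing g outside a base B keeps B, as the recursion requires; if there is no such g, then S =
   B. *)
have [SB|/fintype.subsetPn [g gS gB]] := boolP (S \subset B).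
  have -> : S = B by apply/eqP; rewrite finset.eqEsubset SB BS.
  exact: Q_extends_base.
have sub : B \subset S :\ g by rewrite finset.subsetD1 BS.
apply: (Q_extends_step gS bB sub); apply: IH.
by rewrite -ltnS; apply: leq_trans leS; rewrite [in X in (_ < X)%N](cardsD1 g S) gS.
Qed.

End Extension.

Section ExponentialMeans.
Context {R : realType}.

(** A Riemann sum of int_0^1 exp(w s) ds = (exp w - 1) / w, made of exponentials only and hence
    regular at w = 0. *)
Definition expmean (k : nat) (w : R[i]) : R[i] :=
  #|'I_k.+1|%:R^-1 * \sum_(j < k.+1) cexp (w * (j%:R / k.+1%:R)%:C).

Lemma expmean_geom k (w : R[i]) :
  expmean k w * (k.+1%:R * (cexp (w * (k.+1%:R^-1)%:C) - 1)) = cexp w - 1.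
Proof.
have kR : (k.+1%:R : R) != 0 by rewrite pnatr_eq0.
have kC : (k.+1%:R : R[i]) != 0 by rewrite pnatr_eq0.
set q := cexp (w * (k.+1%:R^-1)%:C).
have E (j : nat) : cexp (w * (j%:R / k.+1%:R)%:C) = q ^+ j.
  by rewrite mulr_natl (raddfMn (real_complex R)) mulrnAr cexpX.
rewrite /expmean card_ord (eq_bigr (fun j : 'I_k.+1 => q ^+ j)) => [|j _]; last exact: E.
have -> : k.+1%:R^-1 * (\sum_(j < k.+1) q ^+ j) * (k.+1%:R * (q - 1)) = (q - 1) * \sum_(j < k.+1) q ^+ j.
  by move: kC; move: (k.+1%:R : R[i]) => z z0; field.
rewrite -subrX1; congr (_ - _).
by rewrite -E divff // rmorph1 mulr1.
Qed.

Lemma expmean_bound k (w : R[i]) : nc (expmean k w) <= expR (nc w).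
Proof.
apply: nc_avg => [|j]; first by rewrite card_ord.
apply: le_trans (nc_cexp_le _) _; rewrite ler_expR ncM nc_real.
rewrite ger0_norm ?divr_ge0 // ler_piMr ?nc_ge0 // ler_pdivrMr ?ltr0n // mul1r ler_nat.
exact: ltnW.
Qed.

Lemma expmean_lim (w : R[i]) : exists2 C : R, 0 <= C & forall k,
  nc (cexp w - 1 - expmean k w * w) <= C / k.+1%:R.
Proof.
have [K K0 HK] := cexp_taylor1 (nc_ge0 w).
exists (expR (nc w) * (K * nc w ^+ 2)); first by rewrite !mulr_ge0 ?expR_ge0 ?exprn_ge0 ?nc_ge0.
move=> k; rewrite -(expmean_geom k w) -mulrBr ncM -mulrA.
apply: ler_pM; rewrite ?nc_ge0 ?expmean_bound //.
have kR : (0 : R) < k.+1%:R by rewrite ltr0n.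
set q := (k.+1%:R^-1)%:C.
have qE : q * k.+1%:R = 1.
  by rewrite /q -(rmorph_nat (real_complex R)) -rmorphM /= mulVf ?rmorph1 // gt_eqF.
have -> : k.+1%:R * (cexp (w * q) - 1) - w = k.+1%:R * (cexp (w * q) - 1 - w * q).
  by rewrite [RHS]mulrBr; congr (_ - _); rewrite mulrCA mulrC [k.+1%:R * _]mulrC qE mul1r.
have nq : nc (w * q) = nc w / k.+1%:R.
  by rewrite ncM /q nc_real ger0_norm // invr_ge0 ltW.
have h : nc (w * q) <= nc w.
  by rewrite nq ler_pdivrMr // ler_peMr ?nc_ge0 // ler1n.
have := HK _ h; rewrite nq ncM -(rmorph_nat (real_complex R)) nc_real ger0_norm // => h2.
apply: le_trans (ler_wpM2l (ltW kR) h2) _; rewrite le_eqVlt; apply/orP; left; apply/eqP.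
by move: (k.+1%:R : R) kR => z z0; field; rewrite gt_eqF.
Qed.

End ExponentialMeans.

Section LocalQuotients.
Context {R : realType} {n : nat}.
Local Notation T := 'rV[R[i]^o]_n.
Implicit Types (t s : T) (H : T -> R[i]).

Lemma K2_restrict (rho rho' C : R) H : rho' <= rho -> K2 rho C H -> K2 rho' C H.
Proof.
move=> le [h1 h2]; split=> [t tr|t tr]; first by apply: h1; exact: le_trans le.
have [a [a1 a2]] := h2 t (le_trans tr le); exists a; split=> // s sr.
by apply: a2; exact: le_trans le.
Qed.

Lemma K2_addc (rho C : R) H (c : R[i]) : 0 <= C -> K2 rho C H -> K2 rho (C + nc c) (fun t => H t + c).
Proof.
move=> C0 [h1 h2]; split=> [t tr|t tr]; first by apply: le_trans (ncD _ _) _; rewrite lerD2r h1.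
have [a [a1 a2]] := h2 t tr; exists a; split=> [i|s sr].
  by apply: le_trans (a1 i) _; rewrite lerDl nc_ge0.
have -> : H s + c - (H t + c) = H s - H t by ring.
by apply: le_trans (a2 s sr) _; rewrite ler_wpM2r ?sqr_ge0 // lerDl nc_ge0.
Qed.

Lemma K2_coord (rho : R) (g : 'I_n) : 0 <= rho -> K2 rho (rho + 1) (fun t => t 0 g).
Proof.
move=> rho0; split=> [t tr|t tr].
  by apply: le_trans (nc_le_nv t g) _; lra.
exists (fun i => (i == g)%:R); split=> [i|s sr].
  by case: eqP => _ /=; rewrite ?nc1 ?nc0; lra.
rewrite (bigD1 g) //= eqxx mul1r big1 ?addr0 ?subrr ?nc0.
  by rewrite mulr_ge0 ?sqr_ge0 // addr_ge0.
by move=> i /negbTE ->; rewrite mul0r.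
Qed.

Lemma K2_lower (rho C : R) H : 0 < rho -> 0 <= C -> K2 rho C H -> H 0 != 0 ->
  exists rho', [/\ 0 < rho', rho' <= rho & forall t, nv t <= rho' -> nc (H 0) / 2 <= nc (H t)].
Proof.
move=> rho0 C0 [_ h2] H0; have z0 : nv (0 : T) <= rho by rewrite nv0 ltW.
have [a [a1 a2]] := h2 0 z0.
pose L := C * (1 + (rho + rho)); have L0 : 0 <= L by rewrite mulr_ge0 //; lra.
have p0 : 0 < nc (H 0) by rewrite nc_gt0.
exists (Num.min rho (nc (H 0) / 2 / (L + 1))); split.
- by rewrite lt_min rho0 !divr_gt0 // ltr_wpDl.
- by rewrite ge_min lexx.
move=> t; rewrite le_min => /andP [tr]; rewrite ler_pdivlMr ?ltr_wpDl // => tl.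
have := K2_lip C0 z0 tr a1 (a2 t tr); rewrite subr0 -/L => h.
have := ncD (H t) (H 0 - H t); rewrite addrC subrK [nc (H 0 - H t)]ncBC.
have := nv_ge0 t; lra.
Qed.

(** If exp(- b) != 1 the denominator does not vanish near 0. Otherwise exp(t_g - b) = exp t_g, and
    (exp t_g - 1) / t_g extends as the limit of the means [expmean], with value 1 at the origin; psi
    is its inverse. *)
Lemma local_quotient (g : 'I_n) (b : R[i]) : exists rho C (psi : T -> R[i]),
  [/\ 0 < rho, 0 <= C, K2 rho C psi &
    forall t, nv t <= rho -> psi t * (cexp (t 0 g - b) - 1) = t 0 g].
Proof.
have [E0|E0] := eqVneq (cexp (- b)) 1; last first.
  have [C C0 HC] := @K2fam_cexp R n 1 unit (fun=> True) g b (fun=> 1) ler01 (fun _ _ => introT andP (conj ler01 (lexx 1))).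
  pose H t : R[i] := cexp (t 0 g - b) + -1.
  have KH : K2 1 (C + nc (-1)) H.
    apply: K2_addc => //; apply: K2_ext (HC tt I) => t _.
    by rewrite rmorph1 mulr1.
  have C10 : 0 <= C + nc (-1) by rewrite addr_ge0 ?nc_ge0.
  have H0 : H 0 != 0 by rewrite /H mxE sub0r subr_eq0.
  have [rho [rho0 rho1 Hl]] := K2_lower ltr01 C10 KH H0.
  have c0 : 0 < nc (H 0) / 2 by rewrite divr_gt0 ?nc_gt0.
  have [C2 C20 KI] := K2_inv C10 c0 Hl (K2_restrict rho1 KH).
  have f1 : K2fam rho (fun _ : unit => True) (fun _ t => (H t)^-1) by exists C2.
  have f2 : K2fam rho (fun _ : unit => True) (fun _ t => t 0 g).
    by exists (rho + 1); [rewrite addr_ge0 // ltW|move=> _ _; apply: K2_coord; exact: ltW].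
  have [C3 C30 K3] := K2fam_mul f2 f1.
  exists rho, C3, (fun t => t 0 g * (H t)^-1); split=> //; first exact: (K3 tt I).
  move=> t tr; rewrite -/(H t) mulfVK //.
  by rewrite -nc_gt0; apply: lt_le_trans (Hl t tr).
have [U [UU oU]] := ultraFilterLemma (eventually_filter : ProperFilter \oo).
have [C C0 HC] : K2fam (n := n) 1 (fun u : R => 0 <= u <= 1) (fun u t => cexp ((t 0 g - 0) * u%:C)).
  exact: K2fam_cexp.
have KM k : K2 1 C (fun t : T => expmean k (t 0 g)).
  apply: K2_ext (K2_avg (J := 'I_k.+1) (H := fun j t => cexp ((t 0 g - 0) * (j%:R / k.+1%:R)%:C)) _ C0 _).
  - by move=> t _; rewrite /expmean subr0.
  - by rewrite card_ord.
  move=> j; apply: HC; rewrite divr_ge0 //= ler_pdivrMr ?ltr0n // mul1r ler_nat; exact: ltnW.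
have [G KG GP] := K2_ultra UU KM.
have GE t : nv t <= 1 -> G t * t 0 g = cexp (t 0 g) - 1.
  move=> tr; have [C1 C10 HC1] := expmean_lim (t 0 g).
  have cv : (expmean k (t 0 g) * t 0 g : R[i]^o) @[k --> U] --> (G t * t 0 g : R[i]^o).
    have PU := @ultra_proper _ _ UU.
    by apply: cvgM; [exact: GP|exact: cvg_cst].
  apply: (ultra_lim_eq UU oU cv) => e e0.
  have [K1 HK1] := eventually_div_le C10 e0; exists K1 => k /HK1; apply: le_trans.
  exact: HC1.
have G0 : G 0 = 1.
  have z1 : nv (0 : T) <= 1 by rewrite nv0.
  apply: (ultra_lim_eq UU oU (GP 0 z1)) => e e0; exists 0%N => k _.
  rewrite /expmean mxE (eq_bigr (fun=> 1)) => [|j _]; last by rewrite mul0r cexp0.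
  by rewrite sumr_const mulVf ?subrr ?nc0 ?ltW // card_ord pnatr_eq0.
have Gn0 : G 0 != 0 by rewrite G0 oner_neq0.
have [rho [rho0 rho1 Hl]] := K2_lower ltr01 C0 KG Gn0.
have c0 : 0 < nc (G 0) / 2 by rewrite divr_gt0 ?nc_gt0.
have [C2 C20 KI] := K2_inv C0 c0 Hl (K2_restrict rho1 KG).
exists rho, C2, (fun t => (G t)^-1); split=> // t tr.
have Gt : G t != 0 by rewrite -nc_gt0; apply: lt_le_trans (Hl t tr).
have -> : cexp (t 0 g - b) = cexp (t 0 g) by rewrite cexpD E0 mulr1.
by rewrite -GE ?mulKf //; exact: le_trans rho1.
Qed.

End LocalQuotients.

(** * Generic real lines, and holomorphy near the origin *)

Section Lines.
Context {R : realType} {r n : nat} (Lam : 'I_n -> 'rV[int]_r * R[i]).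
Local Notation rv f := (realv (R := R) (vec Lam f)).
Local Notation base := (is_base Lam).
Local Notation dv := (dualv Lam).
Local Notation T := 'rV[R[i]^o]_n.
Implicit Types (B : {set 'I_n}) (f g : 'I_n) (t : T).

Definition tline t (v : 'rV[R]_n) (z : R) : T := \row_i (t 0 i + (z * v 0 i)%:C).

Definition rden (v : 'rV[R]_n) B g : R :=
  v 0 g - \sum_(f in B) v 0 f * dot (rv g) (dv B f).

(** No denominator is constant along such a line, whatever its base point. *)
Definition generic_line (v : 'rV[R]_n) :=
  (forall f, v 0 f != 0) /\ (forall B g, base B -> g \notin B -> rden v B g != 0).

Lemma tshift_line t v z f : tshift Lam (tline t v z) f = tshift Lam t f + (z * v 0 f)%:C.
Proof. by rewrite /tshift mxE addrAC. Qed.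

Lemma cden_line t v z B g : cden Lam (tshift Lam (tline t v z)) B g =
  cden Lam (tshift Lam t) B g + (z * rden v B g)%:C.
Proof.
rewrite /cden /rden tshift_line.
have -> : \sum_(f in B) tshift Lam (tline t v z) f * (dot (rv g) (dv B f))%:C =
  \sum_(f in B) tshift Lam t f * (dot (rv g) (dv B f))%:C
  + (z * \sum_(f in B) v 0 f * dot (rv g) (dv B f))%:C.
  rewrite mulr_sumr rmorph_sum -big_split; apply: eq_bigr => f _.
  by rewrite /= tshift_line mulrDl mulrA; congr (_ + _); exact: esym (rmorphM (real_complex R) _ _).
rewrite mulrBr rmorphB; ring.
Qed.

Lemma generic_line_exists : exists v, generic_line v.
Proof.
pose b (p : {set 'I_n} * 'I_n) : 'rV[R]_n := \row_i ((i == p.2)%:R - (i \in p.1)%:R * dot (rv p.2) (dv p.1 i)).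
pose s := [seq delta_mx 0 f : 'rV[R]_n | f <- enum 'I_n] ++ [seq b p | p <- enum {: {set 'I_n} * 'I_n}].
have [v Hv] := avoid_hyperplanes s; exists v; split=> [f|B g bB gB].
  have := Hv (delta_mx 0 f); rewrite dotC dot_delta; apply.
    by rewrite mem_cat; apply/orP; left; apply: map_f; rewrite mem_enum.
  by apply/negP => /eqP /rowP /(_ f); rewrite !mxE !eqxx => /eqP; rewrite oner_eq0.
have E : dot v (b (B, g)) = rden v B g.
  rewrite /dot /rden -[v 0 g](dot_delta g v) dotC /dot (big_mkcond (fun f => f \in B)) -sumrB.
  apply: eq_bigr => i _; rewrite !mxE eqxx /= mulrBr; congr (_ - _).
  by case: (i \in B); rewrite ?mul1r ?mul0r ?mulr0.
rewrite -E; apply: Hv.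
  by rewrite mem_cat; apply/orP; right; apply: map_f; rewrite mem_enum.
apply/negP => /eqP /rowP /(_ g); rewrite !mxE /= eqxx (negbTE gB) mul0r subr0 => /eqP.
by rewrite oner_eq0.
Qed.

(** As v is real, only real parts move. The real part of each [cden] is a nonconstant affine
    function of z, and exp tau = 1 forces Re tau = 0, so each denominator excludes at most one z. *)
Lemma offpoles_line t v : generic_line v -> \forall z \near (0 : R)^'+, offpoles Lam (tline t v z).
Proof.
move=> [v0 vB].
have H1 : \forall z \near (0 : R)^'+, forall B g, base B -> g \notin B ->
    cden Lam (tshift Lam (tline t v z)) B g != 0.
  apply: filter_forall => B; apply: filter_forall => g.
  have [bB|nb] := boolP (base B); last by apply: filterE.
  have [gB|ng] := boolP (g \notin B); last by apply: filterE.
  have := @sgn_near_right R (Re (cden Lam (tshift Lam t) B g)) (rden v B g).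
  rewrite vB // orbT => /(_ isT); apply: filterS => z /andP [h _] _ _.
  rewrite cden_line; apply: contra h => /eqP e; have := congr1 (fun x : R[i] => Re x) e.
  by case: (cden _ _ _ _) {e} => p q /= ->.
have H2 : \forall z \near (0 : R)^'+, forall f, cexp (tshift Lam (tline t v z) f) - 1 != 0.
  apply: filter_forall => f.
  have := @sgn_near_right R (Re (tshift Lam t f)) (v 0 f).
  rewrite v0 orbT => /(_ isT); apply: filterS => z /andP [h _].
  rewrite tshift_line; apply: contra h => /eqP e.
  have e1 : cexp (tshift Lam t f + (z * v 0 f)%:C) = 1 by apply/eqP; rewrite -subr_eq0 e.
  have := congr1 nc e1; rewrite nc_cexp nc1 ; rewrite -expR0 => /expR_inj /eqP.
  by case: (tshift Lam t f) {e e1} => p q.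
by apply: filterS (filterI H1 H2) => z [h1 h2] B bB; split=> [g gB|f _]; [exact: h1|exact: h2].
Qed.

Lemma tline_nv t v z : 0 <= z -> nv (tline t v z - t) <= z * \sum_i `|v 0 i|.
Proof.
move=> z0; rewrite /nv mulr_sumr; apply: ler_sum => i _; rewrite !mxE.
have -> : t 0 i + (z * v 0 i)%:C - t 0 i = (z * v 0 i)%:C by rewrite addrAC subrr add0r.
by rewrite nc_real normrM ger0_norm.
Qed.

Lemma nv_nbhs t (A : set T) : nbhs t A -> exists2 e : R, 0 < e & forall s, nv (s - t) < e -> A s.
Proof.
move=> /nbhs_ballP [e e0 eA]; have [e0' E] := ltC_nc e0; exists (Re e) => // s h.
apply: eA; split=> // i j; rewrite -ball_normE /= ord1 E.
by apply: le_lt_trans h; have := nc_le_nv (s - t) j; rewrite !mxE ncBC.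
Qed.

Lemma tline_cvg t v : tline t v z @[z --> (0 : R)^'+] --> t.
Proof.
move=> A /nv_nbhs [e e0 eA]; set K := \sum_i `|v 0 i|.
have K0 : 0 <= K by rewrite sumr_ge0.
have d0 : 0 < e / (K + 1) by rewrite divr_gt0 // ltr_wpDl.
apply: filterS (filterI (nbhs_right_gt (0 : R)) (nbhs_right_lt d0)) => z [z0 z1] /=.
apply: eA; apply: le_lt_trans (tline_nv _ _ (ltW z0)) _; rewrite -/K.
move: z1; rewrite /= ltr_pdivlMr ?ltr_wpDl // mulrDr mulr1; apply: le_lt_trans.
by rewrite lerDl ltW.
Qed.

(** The limit in [genF] is thus taken along a proper filter even at a pole, and so is unique when it
    exists. *)
Lemma offpoles_proper t : ProperFilter (within (offpoles Lam) (nbhs t)).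
Proof.
have [v gv] := generic_line_exists.
apply: Build_ProperFilter_ex => A HA; have H := @tline_cvg t v _ HA.
have [z [h1 h2]] := @filter_ex _ _ (at_right_proper_filter (0 : R)) _ (filterI (offpoles_line t gv) H).
by exists (tline t v z); exact: h2.
Qed.

Context (phi : 'rV[R]_r) (phi_off : off_walls Lam phi).
Implicit Types (s : T) (y : 'rV[R]_r).

Lemma Fformula_extends : exists rho C (Fb : 'rV[R]_r -> T -> R[i]),
  [/\ 0 < rho, 0 <= C, forall y, K2 rho C (Fb y) &
    forall y t, nv t <= rho -> offpoles Lam t -> Fformula Lam phi t y = Fb y t].
Proof.
have [N0 N0_gt1 N0_clears] := dualv_int Lam.
have lq g : exists p : R * R * (T -> R[i]), [/\ 0 < p.1.1, 0 <= p.1.2, K2 p.1.1 p.1.2 p.2 &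
    forall t, nv t <= p.1.1 -> p.2 t * (cexp (tshift Lam t g) - 1) = t 0 g].
  have [rho [C [psi h]]] := local_quotient g ((2 * pi)%:C * 'i%C * bcst Lam g).
  by exists (rho, C, psi).
have [p Hp] := choice lq.
have [rho rho0 rhog] : exists2 rho : R, 0 < rho & forall g, rho <= (p g).1.1.
  exists (\big[Num.min/1]_g (p g).1.1); last by move=> g; exact: bigmin_le.
  by apply: lt_bigmin => // g _; have [] := Hp g.
have [H [KH HE]] := Q_extends_all N0_gt1 N0_clears (ltW rho0) [set: 'I_n]%SET.
have Kpsi g : K2fam rho (fun q => off_walls Lam q.1) (fun (_ : 'rV[R]_r * 'rV[R]_r) => (p g).2).
  by have [_ C0 Kg _] := Hp g; exists (p g).1.2 => // _ _; exact: K2_restrict Kg.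
have [C C0 KC] := K2fam_mul (K2fam_prod (index_enum 'I_n) xpredT Kpsi) KH.
exists rho, C, (fun y t => (\prod_g (p g).2 t) * H (phi, y) t); split=> // [y|y t tr ot].
  exact: (KC (phi, y)).
rewrite HE //= (Fformula_Q (cube_gt1 N0_gt1) (cube_clears N0_clears)) mulrA; congr (_ * _).
rewrite [X in _ * X](eq_bigl xpredT) => [|g]; last by rewrite finset.in_setT.
rewrite -big_split; apply: eq_bigr => g _ /=; have [_ _ _ ->//] := Hp g.
exact: le_trans tr (rhog g).
Qed.

Lemma genF_holomorphic_near0 : \forall t \near (0 : T),
  forall y, holomorphic_at (fun s => genF Lam phi s y) t.
Proof.
have [rho [C [Fb [rho0 C0 KF FE]]]] := Fformula_extends.
have near_ball t : nv t < rho -> \forall s \near t, nv s < rho.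
  move=> tr; have d0 : 0 < rho - nv t by rewrite subr_gt0.
  apply: filterS (near_nv_lt t d0) => s hs; have := nvD (s - t) t; rewrite subrK; lra.
(* Off the poles this is the formula; on them, continuity of [Fb] makes its value the limit defining
   [genF]. *)
have GE y t : nv t < rho -> genF Lam phi t y = Fb y t.
  move=> tr; rewrite /genF; case: asboolP => [ot|_]; first by rewrite FE ?ltW.
  have PF := offpoles_proper t.
  apply: cvg_lim; first exact: norm_hausdorff.
  apply/cvg_ncP => e e0.
  have /cvg_ncP /(_ e e0) c : (Fb y : T -> R[i]^o) s @[s --> t] --> (Fb y t : R[i]^o).
    by apply: differentiable_continuous; exact: K2_differentiable (KF y).
  apply: filterS (filterI c (near_ball t tr)) => s [h1 h2] os.
  by rewrite FE // ltW.
have h0 : nv (0 : T) < rho by rewrite nv0.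
apply: filterS (near_ball 0 h0) => t tr y.
apply: filterS (near_ball t tr) => s sr.
have [_ /(_ s (ltW sr)) [a [_ ha]]] := KF y.
apply: (quadratic_differentiable (a := a) C0).
apply: filterS (near_ball s sr) => s' sr'; rewrite !GE //; apply: ha; exact: ltW.
Qed.

End Lines.

(** * Removable singularities *)

Section OneSidedExpansions.
Context {R : realType}.
Implicit Types (F G : R -> R[i]) (C : R) (k : nat).

(* Uniform one-sided Taylor expansion of order k: the constant C bounds every
   coefficient and the remainder. *)
Fixpoint T0 k C F : Prop :=
  match k with
  | 0 => forall z, 0 < z <= 1 -> nc (F z) <= C
  | k.+1 => exists a G, [/\ nc a <= C, T0 k C G &
              forall z, 0 < z <= 1 -> F z = a + z%:C * G z]
  end.

Definition T0fam k (I : Type) (F : I -> R -> R[i]) :=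
  exists2 C, 0 <= C & forall i, T0 k C (F i).

Lemma T0_mono k C C' F : C <= C' -> T0 k C F -> T0 k C' F.
Proof.
move=> le; elim: k F => [|k IH] F /=; first by move=> h z /h /le_trans; apply.
by move=> [a [G [h1 h2 h3]]]; exists a, G; split=> //; [exact: le_trans le|exact: IH].
Qed.

Lemma T0_ext k C F F' : (forall z, 0 < z <= 1 -> F z = F' z) -> T0 k C F -> T0 k C F'.
Proof.
case: k => [|k] e /=; first by move=> h z zz; rewrite -e // h.
by move=> [a [G [h1 h2 h3]]]; exists a, G; split=> // z zz; rewrite -e // h3.
Qed.

Lemma T0fam_ext k (I : Type) (F F' : I -> R -> R[i]) :
  (forall i z, 0 < z <= 1 -> F i z = F' i z) -> T0fam k F -> T0fam k F'.
Proof. by move=> e [C C0 h]; exists C => // i; apply: T0_ext (h i) => z; exact: e. Qed.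

Lemma T0_const k (a : R[i]) C : nc a <= C -> T0 k C (fun=> a).
Proof.
move=> aC; have C0 : 0 <= C by exact: le_trans (nc_ge0 a) aC.
elim: k a aC => [|k IH] a aC //=; exists a, (fun=> 0); split=> // [|z _].
  by apply: IH; rewrite nc0.
by rewrite mulr0 addr0.
Qed.

Lemma T0fam_const k (I : Type) (a : I -> R[i]) C : 0 <= C -> (forall i, nc (a i) <= C) ->
  T0fam k (fun i _ => a i).
Proof. by move=> C0 h; exists C => // i; exact: T0_const. Qed.

Lemma T0fam_S k (I : Type) (F : I -> R -> R[i]) : T0fam k.+1 F <->
  exists (a : I -> R[i]) (G : I -> R -> R[i]) C, [/\ 0 <= C, forall i, nc (a i) <= C, T0fam k G &
    forall i z, 0 < z <= 1 -> F i z = a i + z%:C * G i z].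
Proof.
split=> [[C C0 /= h]|[a [G [C [C0 h1 [C' C'0 h2] h3]]]]].
  have [a Ha] := choice h; have [G HG] := choice Ha.
  exists a, G, C; split=> // [i||i]; try by have [] := HG i.
  by exists C => // i; have [] := HG i.
exists (C + C'); first exact: addr_ge0.
move=> i /=; exists (a i), (G i); split=> //; last exact: h3.
  by apply: le_trans (h1 i) _; rewrite lerDl.
by apply: T0_mono (h2 i); rewrite lerDr.
Qed.

Lemma T0fam_pred k (I : Type) (F : I -> R -> R[i]) : T0fam k.+1 F -> T0fam k F.
Proof.
elim: k I F => [|k IH] I F /T0fam_S [a [G [C [C0 h1 h2 h3]]]].
  have [C' C'0 h4] := h2; exists (C + C') => [|i z /= zz]; first exact: addr_ge0.
  rewrite h3 //; apply: le_trans (ncD _ _) _; apply: lerD => //.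
  have /andP [z0 z1] := zz; rewrite ncM nc_real gtr0_norm //.
  by apply: le_trans (h4 i z zz); rewrite ler_piMl ?nc_ge0.
apply/T0fam_S; exists a, G, C; split=> //; exact: IH.
Qed.

Lemma T0fam_add k (I : Type) (F F' : I -> R -> R[i]) :
  T0fam k F -> T0fam k F' -> T0fam k (fun i z => F i z + F' i z).
Proof.
elim: k I F F' => [|k IH] I F F'.
  move=> [C C0 h] [C' C'0 h']; exists (C + C') => [|i z /= zz]; first exact: addr_ge0.
  apply: le_trans (ncD _ _) _; apply: lerD; [exact: h|exact: h'].
move=> /T0fam_S [a [G [C [C0 h1 h2 h3]]]] /T0fam_S [a' [G' [C' [C'0 h1' h2' h3']]]].
apply/T0fam_S; exists (fun i => a i + a' i), (fun i z => G i z + G' i z), (C + C'); split.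
- exact: addr_ge0.
- by move=> i; apply: le_trans (ncD _ _) _; exact: lerD.
- exact: IH.
by move=> i z zz; rewrite h3 // h3' //; ring.
Qed.

Lemma T0fam_mul k (I : Type) (F F' : I -> R -> R[i]) :
  T0fam k F -> T0fam k F' -> T0fam k (fun i z => F i z * F' i z).
Proof.
elim: k I F F' => [|k IH] I F F'.
  move=> [C C0 h] [C' C'0 h']; exists (C * C') => [|i z /= zz]; first exact: mulr_ge0.
  by rewrite ncM; apply: ler_pM; rewrite ?nc_ge0 //; [exact: h|exact: h'].
move=> hF hF'; have hF'k := T0fam_pred hF'.
move: hF hF' => /T0fam_S [a [G [C [C0 h1 h2 h3]]]] /T0fam_S [a' [G' [C' [C'0 h1' h2' h3']]]].
apply/T0fam_S.
exists (fun i => a i * a' i), (fun i z => a i * G' i z + G i z * F' i z), (C * C'); split.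
- exact: mulr_ge0.
- by move=> i; rewrite ncM; apply: ler_pM; rewrite ?nc_ge0.
- apply: T0fam_add; last exact: IH.
  by apply: IH => //; exact: T0fam_const C0 h1.
move=> i z zz; rewrite [in RHS]mulrDr addrA; have -> : F i z * F' i z = a i * F' i z + z%:C * (G i z * F' i z).
  by rewrite h3 //; ring.
by congr (_ + _); rewrite h3' //; ring.
Qed.

Lemma T0fam_sum k (I J : Type) (s : seq J) (P : pred J) (F : J -> I -> R -> R[i]) :
  (forall j, P j -> T0fam k (F j)) -> T0fam k (fun i z => \sum_(j <- s | P j) F j i z).
Proof.
move=> h; elim: s => [|j s IH].
  apply: (@T0fam_ext _ _ (fun _ _ => 0)) => [i z _|]; first by rewrite big_nil.
  by apply: (@T0fam_const _ _ (fun=> 0) 0) => // i; rewrite nc0.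
case Pj : (P j); last by apply: T0fam_ext IH => i z _; rewrite big_cons Pj.
by apply: T0fam_ext (T0fam_add (h j Pj) IH) => i z _; rewrite big_cons Pj.
Qed.

Lemma T0fam_prod k (I J : Type) (s : seq J) (P : pred J) (F : J -> I -> R -> R[i]) :
  (forall j, P j -> T0fam k (F j)) -> T0fam k (fun i z => \prod_(j <- s | P j) F j i z).
Proof.
move=> h; elim: s => [|j s IH].
  apply: (@T0fam_ext _ _ (fun _ _ => 1)) => [i z _|]; first by rewrite big_nil.
  by apply: (@T0fam_const _ _ (fun=> 1) 1) => // i; rewrite nc1.
case Pj : (P j); last by apply: T0fam_ext IH => i z _; rewrite big_cons Pj.
by apply: T0fam_ext (T0fam_mul (h j Pj) IH) => i z _; rewrite big_cons Pj.
Qed.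

Lemma T0fam_affine k (I : Type) (a b : R[i]) : T0fam k (fun (_ : I) z => a + z%:C * b).
Proof.
case: k => [|k].
  exists (nc a + nc b) => [|i z /= /andP [z0 z1]]; first by rewrite addr_ge0 ?nc_ge0.
  apply: le_trans (ncD _ _) _; rewrite lerD2l ncM nc_real gtr0_norm //.
  by rewrite ler_piMl ?nc_ge0.
apply/T0fam_S; exists (fun=> a), (fun _ _ => b), (nc a); split=> //; first exact: nc_ge0.
by apply: (@T0fam_const _ _ (fun=> b) (nc b)); rewrite ?nc_ge0.
Qed.

Lemma T0_scale k C F (b : R[i]) : T0 k C F -> T0 k (nc b * C) (fun z => b * F z).
Proof.
elim: k F => [|k IH] F /=; first by move=> h z /h; rewrite ncM => /ler_wpM2l; apply; exact: nc_ge0.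
move=> [a [G [h1 h2 h3]]]; exists (b * a), (fun z => b * G z); split.
- by rewrite ncM ler_wpM2l ?nc_ge0.
- exact: IH.
by move=> z zz; rewrite h3 // mulrDr mulrCA.
Qed.

Lemma T0_avg k (J : finType) (F : J -> R -> R[i]) C : (0 < #|J|)%N -> 0 <= C ->
  (forall j, T0 k C (F j)) -> T0 k C (fun z => #|J|%:R^-1 * \sum_j F j z).
Proof.
move=> J0 C0; have avg := fun G : J -> R[i] => @nc_avg R J G C J0.
elim: k F => [|k IH] F /= h; first by move=> z zz; apply: avg => j; exact: h.
have [a Ha] := choice h; have [G HG] := choice Ha.
exists (#|J|%:R^-1 * \sum_j a j), (fun z => #|J|%:R^-1 * \sum_j G j z); split.
- by apply: avg => j; have [] := HG j.
- by apply: IH => j; have [] := HG j.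
move=> z zz; rewrite mulrCA -mulrDr; congr (_ * _); rewrite mulr_sumr -big_split.
by apply: eq_bigr => j _; have [_ _ ->] := HG j.
Qed.

Lemma T0_ultra k (U : set_system nat) (UU : UltraFilter U) (F : nat -> R -> R[i]) C :
  (forall m, T0 k C (F m)) -> exists2 G : R -> R[i], T0 k C G &
  forall z, 0 < z <= 1 -> (F m z : R[i]^o) @[m --> U] --> (G z : R[i]^o).
Proof.
have PU := @ultra_proper _ _ UU; elim: k F => [|k IH] F /= h.
  have HG z : exists g : R[i], 0 < z <= 1 -> (F m z : R[i]^o) @[m --> U] --> (g : R[i]^o).
    have [zz|_] := boolP (0 < z <= 1); last by exists 0.
    have [|g hg] := @ultra_cvg R nat U UU (fun m => F m z) C; last by exists g.
    by move=> m; exact: h.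
  have [G GP] := choice HG; exists G => // z zz.
  by apply: (cvg_nc_le (GP z zz)); apply: filterE => m; exact: h.
have [a Ha] := choice h; have [G HG] := choice Ha.
have [|G' TG' cG'] := IH G; first by move=> m; have [] := HG m.
have [|l cl] := @ultra_cvg R nat U UU a C; first by move=> m; have [] := HG m.
exists (fun z => l + z%:C * G' z).
  exists l, G'; split=> //; apply: (cvg_nc_le cl); apply: filterE => m; by have [] := HG m.
move=> z zz; have -> : (fun m => F m z : R[i]^o) = (fun m => a m + z%:C * G m z : R[i]^o).
  by apply/funext => m; have [_ _ ->] := HG m.
apply/cvg_ncP => e e0; have e2 : 0 < e / 2 by rewrite divr_gt0.
move/cvg_ncP : cl => /(_ _ e2) k1; move/cvg_ncP : (cG' z zz) => /(_ _ e2) k2.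
apply: filterS (filterI k1 k2) => m [p1 p2].
have -> : l + z%:C * G' z - (a m + z%:C * G m z) = (l - a m) + z%:C * (G' z - G m z) by ring.
apply: le_lt_trans (ncD _ _) _; have /andP [z0 z1] := zz; rewrite ncM nc_real gtr0_norm //.
have := nc_ge0 (G' z - G m z); move: p2; set q := nc _ => p2 q0.
have : z * q <= q by rewrite ler_piMl.
by move: p1; set p := nc _; lra.
Qed.

(** exp(b z) = 1 + z b int_0^1 exp(b s z) ds. The integral is an ultralimit of means of exponentials
    with |b s| <= c, so its expansion of order k comes from the induction hypothesis with the same
    constant. *)
Lemma T0_cexp k (c : R) : 0 <= c -> exists2 C, 0 <= C &
  forall b : R[i], nc b <= c -> T0 k C (fun z => cexp (b * z%:C)).
Proof.
move=> c0; elim: k => [|k [C C0 IH]].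
  exists (expR c) => [|b bc z /andP [z0 z1]]; first exact: expR_ge0.
  apply: le_trans (nc_cexp_le _) _; rewrite ler_expR ncM nc_real gtr0_norm //.
  by apply: le_trans bc; rewrite ler_piMr ?nc_ge0.
exists (1 + c * C) => [|b bc]; first by rewrite addr_ge0 ?mulr_ge0.
have [U [UU oU]] := ultraFilterLemma (eventually_filter : ProperFilter \oo).
have PU := @ultra_proper _ _ UU.
have KM m : T0 k C (fun z => expmean m (b * z%:C)).
  apply: T0_ext (T0_avg (J := 'I_m.+1) (F := fun j z => cexp (b * (j%:R / m.+1%:R)%:C * z%:C)) _ C0 _).
  - by move=> z _; rewrite /expmean; congr (_ * _); apply: eq_bigr => j _; rewrite mulrAC.
  - by rewrite card_ord.
  move=> j; apply: IH; rewrite ncM nc_real; apply: le_trans bc.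
  rewrite ger0_norm ?divr_ge0 // ler_piMr ?nc_ge0 // ler_pdivrMr ?ltr0n // mul1r ler_nat.
  exact: ltnW.
have [G KG GP] := T0_ultra UU KM.
exists 1, (fun z => b * G z); split.
- by rewrite nc1 lerDl mulr_ge0.
- apply: T0_mono (T0_scale b KG); apply: (@le_trans _ _ (c * C)); first exact: ler_wpM2r.
  by rewrite lerDr.
move=> z zz; have [C1 C10 HC1] := expmean_lim (b * z%:C).
have cv : (expmean m (b * z%:C) * (b * z%:C) : R[i]^o) @[m --> U] --> (G z * (b * z%:C) : R[i]^o).
  by apply: cvgM; [exact: GP|exact: cvg_cst].
have <- : G z * (b * z%:C) = z%:C * (b * G z) by ring.
suff -> : G z * (b * z%:C) = cexp (b * z%:C) - 1 by rewrite addrC subrK.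
apply: (ultra_lim_eq UU oU cv) => e e0.
have [K1 HK1] := eventually_div_le C10 e0; exists K1 => m /HK1; apply: le_trans.
exact: HC1.
Qed.

Lemma T0fam_cexp k (I : Type) (a b : I -> R[i]) (c c' : R) : 0 <= c ->
  (forall i, nc (a i) <= c') -> (forall i, nc (b i) <= c) ->
  T0fam k (fun i z => cexp (a i + b i * z%:C)).
Proof.
move=> c0 ac bc; have [C C0 HC] := T0_cexp k c0.
have h1 : T0fam k (fun i z => cexp (b i * z%:C)) by exists C => // i; exact: HC.
have h2 : T0fam k (fun (i : I) (_ : R) => cexp (a i)).
  apply: (@T0fam_const _ _ _ (expR c')) => [|i]; first exact: expR_ge0.
  by apply: le_trans (nc_cexp_le _) _; rewrite ler_expR.
by apply: T0fam_ext (T0fam_mul h2 h1) => i z _; rewrite cexpD.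
Qed.

Lemma near_unit_itv : \forall z \near (0 : R)^'+, 0 < z <= 1.
Proof.
by apply: filterS (filterI (nbhs_right_gt (0 : R)) (nbhs_right_lt ltr01)) => z [/= -> /ltW ->].
Qed.

Lemma unit_itv_neq0 z : 0 < z <= 1 -> z%:C != 0 :> R[i].
Proof. by move=> /andP [z0 _]; rewrite -nc_gt0 nc_real gtr0_norm. Qed.

Definition lim0 F (l : R[i]) := forall e : R, 0 < e -> \forall z \near (0 : R)^'+, nc (F z - l) < e.

Lemma lim0_unique F l l' : lim0 F l -> lim0 F l' -> l = l'.
Proof.
move=> h h'; apply/eqP; rewrite -subr_eq0 -nc_eq0; apply: contraT => ne.
have p : 0 < nc (l - l') by rewrite lt0r ne nc_ge0.
have p2 : 0 < nc (l - l') / 2 by rewrite divr_gt0.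
have [z [h1 h2]] := @filter_ex _ _ (at_right_proper_filter (0 : R)) _ (filterI (h _ p2) (h' _ p2)).
have := ncD (l - F z) (F z - l'); rewrite addrA subrK [nc (l - F z)]ncBC; lra.
Qed.

Lemma lim0_ext F F' l : (\forall z \near (0 : R)^'+, F z = F' z) -> lim0 F l -> lim0 F' l.
Proof. by move=> e h d d0; apply: filterS (filterI e (h d d0)) => z [<-]. Qed.

Lemma lim0_bounded F a C (G : R -> R[i]) : 0 <= C -> (forall z, 0 < z <= 1 -> nc (G z) <= C) ->
  (forall z, 0 < z <= 1 -> F z = a + z%:C * G z) -> lim0 F a.
Proof.
move=> C0 hG hF e e0; have d0 : 0 < e / (C + 1) by rewrite divr_gt0 // ltr_wpDl.
apply: filterS (filterI (nbhs_right_gt (0 : R)) (filterI (nbhs_right_lt d0) (nbhs_right_lt ltr01))).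
move=> z [/= z0 [z1 z2]]; have zz : 0 < z <= 1 by rewrite z0 ltW.
rewrite hF // addrC addKr ncM nc_real gtr0_norm //.
have := hG z zz; have := nc_ge0 (G z); move: z1; rewrite ltr_pdivlMr ?ltr_wpDl //; nra.
Qed.

Lemma lim0_mul F F' l l' : lim0 F l -> lim0 F' l' -> lim0 (fun z => F z * F' z) (l * l').
Proof.
move=> h h' e e0; pose K := nc l + nc l' + 1.
have K0 : 0 < K by rewrite ltr_wpDl // addr_ge0 ?nc_ge0.
pose d := Num.min 1 (e / (K * 2)).
have d0 : 0 < d by rewrite lt_min ltr01 divr_gt0 // mulr_gt0.
apply: filterS (filterI (h _ d0) (h' _ d0)) => z [h1 h2].
have -> : F z * F' z - l * l' = (F z - l) * (F' z - l') + l * (F' z - l') + (F z - l) * l' by ring.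
apply: le_lt_trans (ncD _ _) _; apply: le_lt_trans (lerD (ncD _ _) (lexx _)) _; rewrite !ncM.
have dK : d * (K * 2) <= e by rewrite -ler_pdivlMr ?mulr_gt0 // ge_min lexx orbT.
have d1 : d <= 1 by rewrite ge_min lexx.
have := nc_ge0 (F z - l); have := nc_ge0 (F' z - l'); have := nc_ge0 l; have := nc_ge0 l'.
move: h1 h2 dK; rewrite /K; set p := nc (F z - l); set q := nc (F' z - l').
set s := nc l; set t := nc l' => p1 q1 dK t0 s0 q0 p0.
have : p * q <= d * 1 by apply: ler_pM => //; [exact: ltW|exact: le_trans (ltW q1) d1].
have : s * q <= s * d by rewrite ler_wpM2l // ltW.
have : p * t <= d * t by rewrite ler_wpM2r // ltW.
nra.
Qed.

(* A limit of F / z^m forces the first m coefficients to vanish. *)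
Lemma T0_divide m C F L : 0 <= C -> T0 m.+1 C F -> lim0 (fun z => F z / z%:C ^+ m) L ->
  nc L <= C /\ exists2 G, forall z, 0 < z <= 1 -> nc (G z) <= C &
    forall z, 0 < z <= 1 -> F z = z%:C ^+ m * (L + z%:C * G z).
Proof.
move=> C0; elim: m F => [|m IH] F [a [G [aC TG FE]]] hL.
  have e : a = L.
    apply: lim0_unique hL; apply: (lim0_bounded C0 TG) => z zz.
    by rewrite expr0 divr1 FE.
  by subst L; split=> //; exists G => // z zz; rewrite expr0 mul1r FE.
have id0 : lim0 (fun z => z%:C ^+ m.+1) 0.
  apply: (@lim0_bounded _ 0 1 (fun z => z%:C ^+ m)) => // z zz; last by rewrite add0r exprS.
  have /andP [z0 z1] := zz; rewrite -rmorphXn nc_real gtr0_norm ?exprn_gt0 //.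
  by rewrite exprn_ile1 // ltW.
have a0 : a = 0.
  have F0 : lim0 F 0.
    have := lim0_mul hL id0; rewrite mulr0; apply: lim0_ext.
    by apply: filterS near_unit_itv => z zz; rewrite divfK // expf_neq0 // unit_itv_neq0.
  have [CG CG0 hG] : exists2 C', 0 <= C' & forall z, 0 < z <= 1 -> nc (G z) <= C'.
    have : T0fam m.+1 (fun _ : unit => G) by exists C.
    elim: (m.+1) => [[C' C'0 h]|m' IHm /T0fam_pred]; last exact: IHm.
    by exists C' => // z; exact: h tt z.
  by apply: lim0_unique F0; exact: (lim0_bounded CG0 hG).
have hG : lim0 (fun z => G z / z%:C ^+ m) L.
  apply: lim0_ext hL; apply: filterS near_unit_itv => z zz; rewrite FE // a0 add0r exprS.
  by rewrite invfM mulrACA divff ?mul1r // unit_itv_neq0.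
have [LC [G' hG' GE]] := IH G TG hG; split=> //; exists G' => // z zz.
by rewrite FE // a0 add0r GE // exprS mulrA.
Qed.

Definition has_order m (D : R -> R[i]) := exists d h C, [/\ d != 0, 0 <= C,
  forall z, 0 < z <= 1 -> nc (h z) <= C &
  forall z, 0 < z <= 1 -> D z = z%:C ^+ m * (d + z%:C * h z)].

Lemma has_order_mul m m' D D' : has_order m D -> has_order m' D' ->
  has_order (m + m') (fun z => D z * D' z).
Proof.
move=> [d [h [C [d0 C0 hC DE]]]] [d' [h' [C' [d0' C0' hC' DE']]]].
exists (d * d'), (fun z => d * h' z + h z * d' + z%:C * (h z * h' z)).
exists (nc d * C' + C * nc d' + C * C'); split.
- exact: mulf_neq0.
- by rewrite !addr_ge0 ?mulr_ge0 ?nc_ge0.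
- move=> z zz; have /andP [z0 z1] := zz.
  apply: le_trans (ncD _ _) _; apply: lerD.
    apply: le_trans (ncD _ _) _; rewrite !ncM; apply: lerD.
      by rewrite ler_wpM2l ?nc_ge0 ?hC'.
    by rewrite ler_wpM2r ?nc_ge0 ?hC.
  rewrite !ncM nc_real gtr0_norm // -[leRHS]mul1r; apply: ler_pM; rewrite ?mulr_ge0 ?nc_ge0 //; first exact: ltW.
  by apply: ler_pM; rewrite ?nc_ge0 ?hC ?hC'.
by move=> z zz; rewrite DE // DE' // exprD; ring.
Qed.

Lemma has_order_ext m D D' : (forall z, 0 < z <= 1 -> D z = D' z) -> has_order m D -> has_order m D'.
Proof.
by move=> e [d [h [C [h1 h2 h3 h4]]]]; exists d, h, C; split=> // z zz; rewrite -e // h4.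
Qed.

Lemma has_order_prod (J : Type) (s : seq J) (P : pred J) (D : J -> R -> R[i]) :
  (forall j, P j -> exists m, has_order m (D j)) ->
  exists m, has_order m (fun z => \prod_(j <- s | P j) D j z).
Proof.
move=> h; elim: s => [|j s [m IH]].
  exists 0%N; exists 1, (fun=> 0), 0; split=> // [z _|z _]; rewrite ?nc0 //.
  by rewrite big_nil expr0 mulr0 addr0 mulr1.
case Pj : (P j); last by exists m; apply: has_order_ext IH => z _; rewrite big_cons Pj.
have [m' h'] := h j Pj; exists (m' + m)%N.
by apply: has_order_ext (has_order_mul h' IH) => z _; rewrite big_cons Pj.
Qed.

Lemma has_order_affine (d e : R[i]) : e != 0 -> exists m, has_order m (fun z => d + z%:C * e).
Proof.
move=> e0; have [->|d0] := eqVneq d 0.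
  exists 1%N; exists e, (fun=> 0), 0; split=> // [z _|z _]; rewrite ?nc0 //.
  by rewrite expr1 mulr0 addr0 add0r.
exists 0%N; exists d, (fun=> e), (nc e); split=> //; first exact: nc_ge0.
by move=> z _; rewrite expr0 mul1r.
Qed.

(** The order is 1 if exp a = 1 and 0 otherwise; b != 0 rules out higher orders. *)
Lemma has_order_cexp (a b : R[i]) : b != 0 ->
  exists m, has_order m (fun z => cexp (a + b * z%:C) - 1).
Proof.
move=> b0; have [K K0 HK] := cexp_taylor1 (nc_ge0 b).
pose h (z : R) : R[i] := (cexp (b * z%:C) - 1 - b * z%:C) / z%:C ^+ 2.
have hE z : 0 < z <= 1 -> cexp (b * z%:C) = 1 + z%:C * (b + z%:C * h z).
  by move=> zz; rewrite /h; field; rewrite unit_itv_neq0.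
have hK z : 0 < z <= 1 -> nc (h z) <= K * nc b ^+ 2.
  move=> zz; have /andP [z0 z1] := zz.
  have zE : nc z%:C = z by rewrite nc_real gtr0_norm.
  rewrite /h ncM ncV expr2 ncM zE -expr2 ler_pdivrMr ?exprn_gt0 // -mulrA -exprMn.
  have e : nc (b * z%:C) = nc b * z by rewrite ncM zE.
  by rewrite -e; apply: HK; rewrite e ler_piMr ?nc_ge0.
have KK : 0 <= K * nc b ^+ 2 by rewrite mulr_ge0 ?exprn_ge0 ?nc_ge0.
have [a1|a1] := eqVneq (cexp a) 1.
  exists 1%N; exists b, h, (K * nc b ^+ 2); split=> // z zz.
  by rewrite cexpD a1 mul1r hE // expr1; ring.
exists 0%N; exists (cexp a - 1), (fun z => cexp a * (b + z%:C * h z)).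
exists (nc (cexp a) * (nc b + K * nc b ^+ 2)); split.
- by rewrite subr_eq0.
- by rewrite mulr_ge0 ?addr_ge0 ?nc_ge0.
- move=> z zz; have /andP [z0 z1] := zz; rewrite ncM ler_wpM2l ?nc_ge0 //.
  apply: le_trans (ncD _ _) _; rewrite lerD2l ncM nc_real gtr0_norm //.
  by apply: le_trans (hK z zz); rewrite ler_piMl ?nc_ge0.
by move=> z zz; rewrite cexpD hE // expr0 mul1r; ring.
Qed.

(** Existence of l forces A to vanish to the order m of D. From A = z^m (d l + z G) and D = z^m (d +
    z h) one gets F - l = z (G - l h) / (d + z h), and the bound on z keeps |d + z h| >= |d| / 2.
    The constants are fixed before A, F and l. *)
Lemma quotient_rate m D C : has_order m D -> 0 <= C -> exists C' d', [/\ 0 <= C', 0 < d', d' <= 1 &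
  forall A F l, T0 m.+1 C A -> (\forall z \near (0 : R)^'+, D z * F z = A z) -> lim0 F l ->
  forall z, 0 < z < d' -> D z * F z = A z -> nc (F z - l) <= C' * z].
Proof.
move=> [d [h [Ch [d0 Ch0 hC DE]]]] C0.
have nd : 0 < nc d by rewrite nc_gt0.
have q0 : 0 < nc d / (2 * (Ch + 1)) by rewrite divr_gt0 // mulr_gt0 // ltr_wpDl.
exists ((C + C / nc d * Ch) * (2 / nc d)), (Num.min 1 (nc d / (2 * (Ch + 1)))); split.
- by rewrite !mulr_ge0 ?addr_ge0 ?mulr_ge0 ?invr_ge0 ?nc_ge0.
- by rewrite lt_min ltr01.
- by rewrite ge_min lexx.
move=> A F l TA DF hl z /andP [z0 zd] DFz.
have hL : lim0 (fun x => A x / x%:C ^+ m) (d * l).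
  have hd : lim0 (fun x => d + x%:C * h x) d by exact: (lim0_bounded Ch0 hC).
  apply: lim0_ext (lim0_mul hd hl); apply: filterS (filterI near_unit_itv DF) => x [xx <-].
  by rewrite DE // -[X in _ = X / _]mulrA [X in _ = X / _]mulrC mulfK // expf_neq0 // unit_itv_neq0.
have [LC [G hG AE]] := T0_divide C0 TA hL.
have zz : 0 < z <= 1 by move: zd; rewrite lt_min z0 => /andP [/ltW].
have hz : z * nc (h z) <= nc d / 2.
  move: zd; rewrite lt_min => /andP [_]; rewrite ltr_pdivlMr ?mulr_gt0 ?ltr_wpDl //.
  have := hC z zz; have := nc_ge0 (h z); nra.
have zE : nc z%:C = z by rewrite nc_real gtr0_norm.
have lo : nc d / 2 <= nc (d + z%:C * h z).
  have := ncB (d + z%:C * h z) (z%:C * h z); rewrite addrK [nc (_ * h z)]ncM zE; lra.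
have E : (d + z%:C * h z) * (F z - l) = z%:C * (G z - l * h z).
  have : z%:C ^+ m * ((d + z%:C * h z) * F z) = z%:C ^+ m * (d * l + z%:C * G z).
    by rewrite mulrA -DE // DFz AE.
  move/mulfI => /(_ (expf_neq0 _ (unit_itv_neq0 zz))) e; rewrite mulrBr e; ring.
have := congr1 nc E; rewrite ncM ncM zE => E'.
have lb : nc l <= C / nc d by rewrite ler_pdivlMr // mulrC -ncM.
have gb : nc (G z - l * h z) <= C + C / nc d * Ch.
  apply: le_trans (ncB _ _) _; rewrite ncM; apply: lerD; first exact: hG.
  by apply: ler_pM; rewrite ?nc_ge0 ?hC.
have k1 : nc d / 2 * nc (F z - l) <= z * (C + C / nc d * Ch).
  apply: (@le_trans _ _ (z * nc (G z - l * h z))); last by rewrite ler_wpM2l // ltW.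
  by rewrite -E' ler_wpM2r ?nc_ge0.
have -> : (C + C / nc d * Ch) * (2 / nc d) * z = (nc d / 2)^-1 * (z * (C + C / nc d * Ch)).
  by rewrite invf_div; ring.
by rewrite ler_pdivlMl ?divr_gt0.
Qed.

End OneSidedExpansions.

(** * Approximation along a generic line, uniformly in y *)

Section LineApproximation.
Context {R : realType} {r n : nat} (Lam : 'I_n -> 'rV[int]_r * R[i]).
Local Notation base := (is_base Lam).
Local Notation T := 'rV[R[i]^o]_n.
Context (N : nat) (N_gt1 : (1 < N)%N) (N_clears : clears_den Lam N).
Context (t : T) (v : 'rV[R]_n) (v_generic : generic_line Lam v).
Implicit Types (B : {set 'I_n}) (f g : 'I_n).
Local Notation tz z := (tshift Lam (tline t v z)).

Definition base_den B z : R[i] :=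
  (\prod_(g in [set: 'I_n]%SET :\: B) cden Lam (tz z) B g) * \prod_(f in B) (cexp (tz z f) - 1).

(** Neither phi nor y enters, so one order of vanishing serves for all y. *)
Definition common_den z : R[i] := \prod_(B | base B) base_den B z.

Definition base_num phi y B z : R[i] := mean N (fun w =>
  \prod_(f in B) cexp (tz z f * (bfrac Lam phi (y + realv w) B f)%:C)).

Definition line_num phi y z : R[i] := (\prod_g tline t v z 0 g) *
  \sum_(B | base B) (\prod_(B' | base B' && (B' != B)) base_den B' z) * base_num phi y B z.

Lemma tz_affine f z : tz z f = tshift Lam t f + (v 0 f)%:C * z%:C.
Proof. by rewrite tshift_line rmorphM /= mulrC. Qed.

Lemma cden_affine B g z : cden Lam (tz z) B g =
  cden Lam (tshift Lam t) B g + z%:C * (rden Lam v B g)%:C.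
Proof. by rewrite cden_line rmorphM. Qed.

Lemma common_den_order : exists m, has_order m common_den.
Proof.
have [v0 vB] := v_generic.
have r0 (x : R) : x != 0 -> x%:C != 0 :> R[i] by rewrite -nc_gt0 nc_real normr_gt0.
apply: has_order_prod => B bB.
have [m1 h1] : exists m, has_order m (fun z => \prod_(g in [set: 'I_n]%SET :\: B) cden Lam (tz z) B g).
  apply: has_order_prod => g; rewrite finset.in_setD andbC => /andP [_ gB].
  have [m hm] := has_order_affine (cden Lam (tshift Lam t) B g) (r0 _ (vB B g bB gB)).
  by exists m; apply: has_order_ext hm => z _; rewrite cden_affine.
have [m2 h2] : exists m, has_order m (fun z => \prod_(f in B) (cexp (tz z f) - 1)).
  apply: has_order_prod => f _; have [m hm] := has_order_cexp (tshift Lam t f) (r0 _ (v0 f)).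
  by exists m; apply: has_order_ext hm => z _; rewrite tz_affine.
by exists (m1 + m2)%N; exact: has_order_mul.
Qed.

Lemma base_den_T0 k (I : Type) B : T0fam k (fun (_ : I) => base_den B).
Proof.
apply: T0fam_mul; apply: T0fam_prod => g _.
  by apply: T0fam_ext (T0fam_affine k I _ _) => i z _; rewrite cden_affine.
apply: T0fam_add; last by apply: (@T0fam_const _ _ _ (fun=> -1) 1) => // i; rewrite ncN nc1.
apply: T0fam_ext (@T0fam_cexp _ k I (fun=> tshift Lam t g) (fun=> (v 0 g)%:C) _ _
  (nc_ge0 _) (fun=> lexx _) (fun=> lexx _)) => i z _.
by rewrite tz_affine.
Qed.

Lemma line_num_T0 k : T0fam k (fun p => line_num p.1 p.2).
Proof.
apply: T0fam_mul.
  apply: T0fam_prod => g _; apply: T0fam_ext (T0fam_affine k _ (t 0 g) (v 0 g)%:C) => i z _.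
  by rewrite mxE rmorphM.
apply: T0fam_sum => B bB; apply: T0fam_mul; first by apply: T0fam_prod => B' _; exact: base_den_T0.
apply: T0fam_mul.
  by apply: (@T0fam_const _ _ _ (fun=> (N ^ r)%:R^-1) (nc ((N ^ r)%:R^-1))); rewrite ?nc_ge0.
apply: T0fam_sum => w _; apply: T0fam_prod => f _.
pose u (p : 'rV[R]_r * 'rV[R]_r) := (bfrac Lam p.1 (p.2 + realv (Zv w)) B f)%:C.
have u1 p : nc (u p) <= 1.
  have /andP [h0 h1] := bfrac_itv Lam p.1 (p.2 + realv (Zv w)) B f.
  by rewrite nc_real ger0_norm.
have h : T0fam k (fun p z => cexp (tshift Lam t f * u p + (v 0 f)%:C * u p * z%:C)).
  apply: (@T0fam_cexp _ _ _ _ _ (nc (v 0 f)%:C) (nc (tshift Lam t f))); rewrite ?nc_ge0 // => p.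
    by rewrite ncM ler_piMr ?nc_ge0.
  by rewrite ncM ler_piMr ?nc_ge0.
by apply: T0fam_ext h => p z _; rewrite tz_affine; congr cexp; rewrite /u; ring.
Qed.

Lemma common_den_Fformula phi y z : offpoles Lam (tline t v z) ->
  common_den z * Fformula Lam phi (tline t v z) y = line_num phi y z.
Proof.
move=> ot; rewrite (Fformula_Q N_gt1 N_clears) mulrCA; congr (_ * _).
rewrite /Q mulr_sumr; apply: eq_big => [B|B]; first by rewrite finset.subsetT andbT.
rewrite finset.subsetT andbT => bB; have [ot1 ot2] := ot B bB.
rewrite /common_den (bigD1 B) //= mulrAC [RHS]mulrC; congr (_ * _).
have -> : mean N (bterm Lam (tz z) phi y B) =
    (\prod_(f in B) (cexp (tz z f) - 1))^-1 * base_num phi y B z.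
  by rewrite -meanMl; apply: eq_mean => w; rewrite /bterm prodf_div mulrC.
rewrite /base_den prodfV.
have n1 : \prod_(g in [set: 'I_n]%SET :\: B) cden Lam (tz z) B g != 0.
  by apply/prodf_neq0 => g; rewrite finset.in_setD andbC => /andP [_]; exact: ot1.
have n2 : \prod_(f in B) (cexp (tz z f) - 1) != 0 by apply/prodf_neq0 => f; exact: ot2.
by rewrite mulrACA divff // mul1r mulrA divff // mul1r.
Qed.

Lemma line_approx : exists C d, [/\ 0 <= C, 0 < d & forall phi y l,
  lim0 (fun z => Fformula Lam phi (tline t v z) y) l ->
  forall z, 0 < z < d -> offpoles Lam (tline t v z) ->
  nc (Fformula Lam phi (tline t v z) y - l) <= C * z].
Proof.
have [m Hm] := common_den_order; have [C0 C00 TA] := line_num_T0 m.+1.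
have [C [d [h1 h2 _ h3]]] := quotient_rate Hm C00; exists C, d; split=> // phi y l hl z zd oz.
apply: (h3 (line_num phi y) (fun z => Fformula Lam phi (tline t v z) y)) => //.
- exact: (TA (phi, y)).
- by apply: filterS (offpoles_line t v_generic) => x; exact: common_den_Fformula.
exact: common_den_Fformula.
Qed.

End LineApproximation.

(** * Generic directions, walls, and values at removable singularities *)

Section Assembly.
Context {R : realType} {r n : nat} (Lam : 'I_n -> 'rV[int]_r * R[i]).
Local Notation rv f := (realv (R := R) (vec Lam f)).
Local Notation base := (is_base Lam).
Local Notation dv := (dualv Lam).
Implicit Types (B : {set 'I_n}) (f g : 'I_n) (y phi : 'rV[R]_r).

Lemma dual_coord_mem B f y : base B -> f \in B -> dot y (dv B f) = 0 -> y \in hspan Lam (B :\ f).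
Proof.
move=> bB fB e; rewrite (dualv_expand y bB) (bigD1 f) //= e scale0r add0r.
apply: memv_suml => g /andP [gB gf]; apply: memvZ; apply: (@mem_span_image R n _ (fun f => rv f)).
by rewrite !inE gf.
Qed.

(** A phi orthogonal to the dual vector of f would lie in the span of the r - 1 independent vectors
    of B \ f. *)
Lemma generic_off_walls phi : generic Lam phi -> off_walls Lam phi.
Proof.
move=> gphi B f bB fB; have [cB _] := baseP bB.
have ind : is_indep Lam (B :\ f).
  rewrite /is_indep; apply/andP; split; first by rewrite -cB (cardsD1 f B) fB.
  apply: (free_imageP (v := fun f => rv f)) => c e h hB.
  have := congr1 (fun x => dot x (dv B h)) e; rewrite dot0l dot_suml (bigD1 h) //=.
  move: hB; rewrite !inE => /andP [hf hB]; rewrite dotZl dualvP // eqxx mulr1 big1 ?addr0 //.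
  by move=> g /andP []; rewrite !inE => /andP [_ gB] gh; rewrite dotZl dualvP // (negbTE gh) mulr0.
by apply: contra (gphi _ ind) => /eqP; exact: dual_coord_mem.
Qed.

(** [rankZ] is a dimension over Q while dual vectors are real; this transfers orthogonality from the
    integral vectors to their rational span. *)
Lemma rat_span_dot0 (s : seq 'rV[int]_r) (x : 'rV[rat]_r) (d : 'rV[R]_r) :
  x \in <<[seq (map_mx intr u : 'rV[rat]_r) | u <- s]>>%VS ->
  (forall u, u \in s -> dot (realv u) d = 0) -> dot (map_mx ratr x) d = 0.
Proof.
elim: s x => [|u s IH] x /=.
  by rewrite span_nil memv0 => /eqP -> _; rewrite map_mx0 dot0l.
rewrite span_cons => /memv_addP [x1 /vlineP [k ->] [x2 hx2 ->]] h.
rewrite map_mxD map_mxZ dotDl dotZl (IH x2) // ?addr0 => [|u' u's]; last by rewrite h // inE u's orbT.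
have -> : map_mx ratr (map_mx intr u) = realv u :> 'rV[R]_r.
  by apply/rowP => i; rewrite !mxE ratr_int.
by rewrite h ?mulr0 // inE eqxx.
Qed.

(** If the remaining vectors had rank r, their rational span would contain the vector of f, although
    they are all orthogonal to a dual vector pairing to 1 with it. *)
Lemma coloop_Ltilde B f : base B -> f \in B ->
  (forall g, g != f -> dot (rv g) (dv B f) = 0) -> f \in Ltilde Lam.
Proof.
move=> bB fB cf; rewrite inE; apply/negP => /eqP rk.
have : (map_mx intr (vec Lam f) : 'rV[rat]_r) \in
    <<[seq (map_mx intr u : 'rV[rat]_r) | u <- [seq u <- codom (vec Lam) | u != vec Lam f]]>>%VS.
  set V := <<_>>%VS; suff -> : V = fullv by exact: memvf.
  by apply/eqP; rewrite eqEdim subvf dim_rV -[X in (X <= _)%N]rk leqnn.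
move/(rat_span_dot0 (d := dv B f)).
have -> : map_mx ratr (map_mx intr (vec Lam f)) = rv f.
  by apply/rowP => i; rewrite !mxE ratr_int.
rewrite (dualvP bB fB fB) eqxx => h; suff /eqP : 1 = 0 :> R by rewrite oner_eq0.
apply: h => u; rewrite mem_filter => /andP [uf /codomP [g e]]; subst u.
by apply: cf; apply: contraNneq uf => ->.
Qed.

(** If a coloop f has integral coordinate m in y + w, then y + w - m f lies in the span of the other
    vectors, which places y on a wall of f. *)
Lemma regular_off_hyperplanes y : ~ walls Lam y -> regular Lam [set: 'I_n]%SET y.
Proof.
move=> ny B f bB _ fB cf w; apply/negP => /intrP [m hm]; apply: ny.
exists f, (m *: vec Lam f - w); split.
  by apply: (coloop_Ltilde bB fB) => g gf; apply: cf => //; rewrite finset.in_setT.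
have -> : y - realv (m *: vec Lam f - w) = y + realv w - m%:~R *: rv f.
  by apply/rowP => i; rewrite !mxE intrB intrM; ring.
have : y + realv w - m%:~R *: rv f \in hspan Lam (B :\ f).
  by apply: dual_coord_mem => //; rewrite dotBl hm dotZl dualvP // eqxx mulr1 subrr.
apply/subvP/sub_span => x /mapP [g]; rewrite mem_enum !inE => /andP [gf _] ->.
by apply: (map_f (fun f => rv f)); rewrite mem_enum !inE.
Qed.

Implicit Types t : 'rV[R[i]^o]_n.

Lemma genF_offpoles phi t y : offpoles Lam t -> genF Lam phi t y = Fformula Lam phi t y.
Proof. by move=> ot; rewrite /genF asboolT. Qed.

Lemma Fformula_cvg N phi (I : Type) (F : set_system I) (FF : Filter F) (Y : I -> 'rV[R]_r) y t :
  (1 < N)%N -> clears_den Lam N ->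
  (Q Lam N [set: 'I_n]%SET (tshift Lam t) phi (Y i) : R[i]^o) @[i --> F] -->
    (Q Lam N [set: 'I_n]%SET (tshift Lam t) phi y : R[i]^o) ->
  (Fformula Lam phi t (Y i) : R[i]^o) @[i --> F] --> (Fformula Lam phi t y : R[i]^o).
Proof.
move=> N1 cN /cvg_ncP cQ; apply/cvg_ncP => e e0; set P := \prod_g t 0 g.
have q0 : 0 < e / (nc P + 1) by rewrite divr_gt0 // ltr_wpDl ?nc_ge0.
apply: filterS (cQ _ q0) => i hi; rewrite !(Fformula_Q N1 cN) -mulrBr ncM.
apply: le_lt_trans (mul_div_succ_lt (nc_ge0 P) e0); rewrite ler_wpM2l ?nc_ge0 //; exact: ltW.
Qed.

Lemma Fformula_right_continuous phi t y : off_walls Lam phi ->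
  (Fformula Lam phi t (y + c *: phi) : R[i]^o) @[c --> (0 : R)^'+] --> (Fformula Lam phi t y : R[i]^o).
Proof.
move=> op; have [N0 g1 cl] := dualv_int Lam; apply: (Fformula_cvg _ g1 cl).
exact: Q_right_continuous.
Qed.

Lemma Fformula_phi_indep phi phi' t y : off_walls Lam phi -> off_walls Lam phi' ->
  ~ walls Lam y -> offpoles Lam t -> Fformula Lam phi t y = Fformula Lam phi' t y.
Proof.
move=> op op' wy ot; have [N0 g1 cl] := dualv_int Lam.
rewrite !(Fformula_Q (cube_gt1 g1) (cube_clears cl)); congr (_ * _).
by apply: Q_phi_indep => //; exact: regular_off_hyperplanes.
Qed.

Lemma Fformula_continuous_at phi t y : off_walls Lam phi -> ~ walls Lam y -> offpoles Lam t ->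
  (Fformula Lam phi t x : R[i]^o) @[x --> y] --> (Fformula Lam phi t y : R[i]^o).
Proof.
move=> op wy ot; have [N0 g1 cl] := dualv_int Lam.
apply: (@Fformula_cvg (N0 ^ 3) phi _ (nbhs y) (nbhs_filter y) id y t (cube_gt1 g1) (cube_clears cl)).
apply: (Q_continuous_at (cube_gt1 g1)) => // phi' op'; apply: Q_phi_indep => //; exact: regular_off_hyperplanes.
Qed.

Lemma nc_dist3 (p q a b : R[i]) (e k : R) : k < e / 3 ->
  nc (a - p) <= k -> nc (a - b) < e / 3 -> nc (b - q) <= k -> nc (p - q) < e.
Proof.
move=> ke h1 h2 h3; have -> : p - q = (p - a) + (a - b) + (b - q) by rewrite !addrA !subrK.
apply: le_lt_trans (ncD _ _) _; apply: le_lt_trans (lerD (ncD _ _) (lexx _)) _.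
rewrite ncBC in h1; lra.
Qed.

Lemma genF_line_lim phi t v y : generic_line Lam v -> holomorphic_at (genF Lam phi ^~ y) t ->
  lim0 (fun z => Fformula Lam phi (tline t v z) y) (genF Lam phi t y).
Proof.
move=> gv ht e e0; have ct : {for t, continuous (genF Lam phi ^~ y)}.
  by apply: differentiable_continuous; exact: (nbhs_singleton ht).
have /cvg_ncP /(_ e e0) h := @cvg_comp _ _ _ _ _ _ _ _ (@tline_cvg _ _ t v) ct.
apply: filterS (filterI (offpoles_line t gv) h) => z [oz /=].
by rewrite (genF_offpoles phi y oz) ncBC.
Qed.

(* At a removable singularity t, line_approx makes the approximation of F(t, y) by values
   off the poles uniform in y. *)
Lemma genF_cvg_removable phi (I : Type) (F : set_system I) (FF : Filter F) (Y : I -> 'rV[R]_r) y t :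
  (forall y, holomorphic_at (genF Lam phi ^~ y) t) ->
  (forall s, offpoles Lam s ->
    (Fformula Lam phi s (Y i) : R[i]^o) @[i --> F] --> (Fformula Lam phi s y : R[i]^o)) ->
  genF Lam phi t (Y i) @[i --> F] --> genF Lam phi t y.
Proof.
move=> ht cF; have [N0 g1 cl] := dualv_int Lam; have [v gv] := generic_line_exists Lam.
have [C [d [C0 d0 HC]]] := line_approx g1 cl t gv.
have hl x := genF_line_lim gv (ht x).
have q0 (e : R) : 0 < e -> 0 < e / 3 / (C + 1).
  by move=> e0; apply: divr_gt0; [exact: divr_gt0|exact: ltr_wpDl].
apply/cvg_ncP => e e0.
have [z [[/= z0 zd] [oz zq]]] := @filter_ex _ _ (at_right_proper_filter (0 : R)) _
  (filterI (filterI (nbhs_right_gt (0 : R)) (nbhs_right_lt d0))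
           (filterI (offpoles_line t gv) (nbhs_right_lt (q0 e e0)))).
have zz : 0 < z < d by rewrite z0.
have Cz : C * z < e / 3.
  apply: le_lt_trans (mul_div_succ_lt C0 (divr_gt0 e0 (ltr0Sn _ 2))).
  by rewrite ler_wpM2l // ltW.
have e3 : 0 < e / 3 by exact: divr_gt0.
have /cvg_ncP /(_ _ e3) := cF _ oz; apply: filterS => i hi.
exact: (nc_dist3 Cz (HC phi y _ (hl y) z zz oz) hi (HC phi (Y i) _ (hl (Y i)) z zz oz)).
Qed.

Lemma genF_cvg phi (I : Type) (F : set_system I) (FF : Filter F) (Y : I -> 'rV[R]_r) y t :
  Fdom Lam phi t ->
  (forall s, offpoles Lam s ->
    (Fformula Lam phi s (Y i) : R[i]^o) @[i --> F] --> (Fformula Lam phi s y : R[i]^o)) ->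
  genF Lam phi t (Y i) @[i --> F] --> genF Lam phi t y.
Proof.
move=> [ot|ht] cF; last exact: genF_cvg_removable.
rewrite (_ : (fun i => _) = (fun i => Fformula Lam phi t (Y i) : R[i]^o)); last first.
  by apply/funext => i; rewrite genF_offpoles.
by rewrite genF_offpoles //; exact: cF.
Qed.

Lemma genF_right_continuous phi t y : off_walls Lam phi -> Fdom Lam phi t ->
  genF Lam phi t (y + c *: phi) @[c --> (0 : R)^'+] --> genF Lam phi t y.
Proof. by move=> op dt; apply: genF_cvg dt _ => s _; exact: Fformula_right_continuous. Qed.

Lemma genF_continuous_at phi t y : off_walls Lam phi -> ~ walls Lam y -> Fdom Lam phi t ->
  {for y, continuous (genF Lam phi t)}.
Proof.
move=> op wy dt; apply: (@genF_cvg phi _ (nbhs y) (nbhs_filter y) id y t dt) => s os.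
 exact: Fformula_continuous_at.
Qed.

(** Every t is covered: at a pole, both values are limits, along the same filter, of functions that
    agree off the poles. *)
Lemma genF_phi_indep phi phi' t y : off_walls Lam phi -> off_walls Lam phi' ->
  ~ walls Lam y -> genF Lam phi t y = genF Lam phi' t y.
Proof.
move=> op op' wy; rewrite /genF; case: asboolP => [ot|_]; first exact: Fformula_phi_indep.
congr (lim _); apply/funext => A; apply/propext; split; apply: (@filterS _ (nbhs t) (nbhs_filter t)) => s h os.
  by rewrite /= -(Fformula_phi_indep op op') //; exact: h.
by rewrite /= (Fformula_phi_indep op op') //; exact: h.
Qed.

Lemma walls_no_coloop y : Ltilde Lam = finset.set0 -> ~ walls Lam y.
Proof. by move=> e [f [w []]]; rewrite e inE. Qed.

End Assembly.

Theorem theorem2p4 (R : realType) (r n : nat)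
    (Lam : 'I_n -> 'rV[int]_r * R[i]) (phi : 'rV[R]_r)
    (r_gt0 : (0 < r)%N)
    (Lam_inj : injective Lam)
    (vec_neq0 : forall f, vec Lam f != 0)
    (Lam_rank : rankZ (codom (vec Lam)) = r)
    (phi_generic : generic Lam phi) :
  (* (i) *)
  (forall t y, Fdom Lam phi t ->
     genF Lam phi t (y + c *: phi) @[c --> (0 : R)^'+] --> genF Lam phi t y) /\
  (* (ii) *)
  ((forall t, Fdom Lam phi t ->
      {within ~` walls Lam, continuous (genF Lam phi t)}) /\
   (Ltilde Lam = finset.set0 ->
      (forall t, Fdom Lam phi t -> continuous (genF Lam phi t)) /\
      (forall phi', generic Lam phi' ->
         forall t y, genF Lam phi' t y = genF Lam phi t y))) /\
  (* (iii) *)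
  (\forall t \near (0 : 'rV[R[i]^o]_n),
     forall y, holomorphic_at (fun s => genF Lam phi s y) t).
Proof.
have op := generic_off_walls phi_generic.
split; first by move=> t y; exact: genF_right_continuous.
split; last exact: genF_holomorphic_near0.
split=> [t dt|L0].
  apply: continuous_in_subspaceT => y /set_mem wy; exact: genF_continuous_at.
split=> [t dt y|phi' gphi' t y].
  by apply: genF_continuous_at => //; exact: walls_no_coloop.
apply: genF_phi_indep => //; [exact: generic_off_walls|exact: walls_no_coloop].
Qed.
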